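(* With $\zeta_5=e^{2\pi i/5}$ and $q=e^{2\pi i\tau}$, $\operatorname{Im}\tau>0$, we have \begin{align*} R^0(\zeta_5;q)&=-2S(3,5;\tau)+(\zeta_5+\zeta_5^4)\left(S(0,5;\tau)-S(1,5;\tau)\right)+(\zeta_5^2+\zeta_5^3)\left(S(2,5;\tau)+S(4,5;\tau)\right)\\ &\quad+\frac{q^5J_{150}}{[q^{15},q^{50};q^{150}]_\infty}-\frac{J_{50}[q^{25};q^{50}]_\infty}{[q^{10};q^{50}]_\infty^2}+\frac{qJ_{50}[q^{15};q^{50}]_\infty}{[q^{10};q^{50}]_\infty^2}-\frac{q^2J_{50}[q^{15};q^{50}]_\infty^2}{[q^{10},q^{10},q^{25};q^{50}]_\infty}\\ &\quad-\frac{q^{17}J_{150}}{[q^{50},q^{75};q^{150}]_\infty}+\frac{q^3J_{50}[q^5,q^{25};q^{50}]_\infty}{[q^{10},q^{10},q^{15};q^{50}]_\infty}-\frac{q^4J_{50}[q^5;q^{50}]_\infty}{[q^{10};q^{50}]_\infty^2}\\ &\quad+(\zeta_5^2+\zeta_5^3)\Bigg(\frac{q^5J_{150}}{[q^{15},q^{50};q^{150}]_\infty}-\frac{J_{50}[q^{15};q^{50}]_\infty^2}{[q^5,q^{10},q^{20};q^{50}]_\infty}-q^6\frac{J_{50}[q^5;q^{50}]_\infty}{[q^{10},q^{20};q^{50}]_\infty}\\ &\qquad-q^2\frac{J_{50}[q^{25};q^{50}]_\infty}{[q^{10},q^{20};q^{50}]_\infty}+q^3\frac{J_{50}[q^{15};q^{50}]_\infty}{[q^{10},q^{20};q^{50}]_\infty}+q^9\frac{J_{50}[q^5;q^{50}]_\infty^2}{[q^{10},q^{15},q^{20};q^{50}]_\infty}+\frac{q^{14}J_{150}}{[q^{45},q^{50};q^{150}]_\infty}\Bigg).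 \end{align*}
   Context: Notation: $(a;q)_\infty=\prod_{n\ge0}(1-aq^n)$, $(a;q)_n=\prod_{j=0}^{n-1}(1-aq^j)$, $(a_1,\dots,a_k;q)_\infty=\prod_i(a_i;q)_\infty$, $[a_1,\dots,a_k;q]_\infty=(a_1,q/a_1,\dots,a_k,q/a_k;q)_\infty$ (e.g. $[q^{10};q^{50}]_\infty=(q^{10},q^{40};q^{50})_\infty$), $J_m=(q^m;q^m)_\infty$. An odd Durfee symbol of $n$ is a two-rowed array $\begin{pmatrix}a_1&\cdots&a_s\\ b_1&\cdots&b_t\end{pmatrix}_D$ with a subscript $D\ge 0$ (rows possibly empty), all entries odd positive integers, with $2D+1\ge a_1\ge\cdots\ge a_s$, $2D+1\ge b_1\ge\cdots\ge b_t$ and $n=\sum a_i+\sum b_j+2D^2+2D+1$. Its odd rank is $s-t$. $N^0(m,n)$ is the number of odd Durfee symbols of $n$ with odd rank $m$, and $$R^0(z;q)=\sum_{n\ge1}\sum_{m\in\mathbb{Z}}N^0(m,n)z^mq^n=\sum_{n=0}^\infty\frac{q^{2n(n+1)+1}}{(zq;q^2)_{n+1}(z^{-1}q;q^2)_{n+1}}.$$ Define $$S(r,c;\tau)=\frac{i^{1-c}q^{c(6r+2-c)-3r^2-2r}}{(q^{2c^2};q^{2c^2})_\infty}\sum_{n=-\infty}^\infty\frac{(-1)^nq^{3c^2n^2+5c^2n}}{1+(-1)^cq^{6c^2n+(2+6r-c)c}}.$$ *)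

(* Defs.v *)
From HB Require Import structures.
From mathcomp Require Import all_boot all_order all_algebra finmap.
From mathcomp Require Import all_classical all_reals all_analysis.
From mathcomp Require Import complex.

Set Implicit Arguments.
Unset Strict Implicit.
Unset Printing Implicit Defensive.

Import Order.TTheory GRing.Theory Num.Theory.
Import numFieldNormedType.Exports.

Local Open Scope classical_set_scope.
Local Open Scope ring_scope.

(* A triple (a, b, D) stands for the two-rowed array with rows a, b and
   subscript D.  Positivity of the entries is implied by oddness. *)
Definition odd_durfee_row (D : nat) (a : seq nat) : bool :=
  [&& all odd a, sorted geq a & all (fun x => x <= 2 * D + 1)%N a].

Definition odd_durfee (n : nat) (w : seq nat * seq nat * nat) : bool :=
  let: (a, b, D) := w in
  [&& odd_durfee_row D a, odd_durfee_row D b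
    & n == (sumn a + sumn b + 2 * D ^ 2 + 2 * D + 1)%N].

Definition odd_rank (w : seq nat * seq nat * nat) : int :=
  let: (a, b, _) := w in (size a)%:Z - (size b)%:Z.

(* For every n there are finitely many odd Durfee symbols of n, so fset_set does
   not take its default value here. *)
Definition N0 (m : int) (n : nat) : nat :=
  #|` fset_set [set w | odd_durfee n w /\ odd_rank w = m] |%fset.

Section qseries.
Variable K : numFieldType.
Implicit Types a q z : K.

(* The inner sum has finite support: N0 m n = 0 as soon as |m| > n. *)
Definition R0 z q : K :=
  limn (series (fun n : nat =>
    \sum_(m \in [set: int]) ((N0 m n.+1)%:R * z ^ m * q ^+ n.+1))).

Definition qpoch a q : K :=
  limn (fun N : nat => \prod_(0 <= k < N) (1 - a * q ^+ k)).

Definition qbracket (s : seq K) q : K :=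
  \prod_(a <- s) (qpoch a q * qpoch (q / a) q).

Definition qJ (m : nat) q : K := qpoch (q ^+ m) (q ^+ m).

(* Negz k is - (k + 1), so the two series run over n >= 0 and over n < 0. *)
Definition bilateral (f : int -> K) : K :=
  limn (series (fun k : nat => f (Posz k))) +
  limn (series (fun k : nat => f (Negz k))).

End qseries.

Section modular.
Variable R : realType.
Local Open Scope complex_scope.

Definition cexp (z : R[i]) : R[i] :=
  let: x +i* y := z in (expR x * cos y) +i* (expR x * sin y).

Definition nome (tau : R[i]) : R[i] := cexp (2 * pi%:C * 'i * tau).

Definition zeta5 : R[i] := cexp (2 * pi%:C * 'i / 5).

Definition Src (r c : int) (tau : R[i]) : R[i] :=
  let q := nome tau in
  'i ^ (1 - c) * q ^ (c * (6 * r + 2 - c) - 3 * r ^+ 2 - 2 * r)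
    / qpoch (q ^ (2 * c ^+ 2)) (q ^ (2 * c ^+ 2))
  * bilateral (fun n : int =>
      (-1) ^ n * q ^ (3 * c ^+ 2 * n ^+ 2 + 5 * c ^+ 2 * n)
      / (1 + (-1) ^ c * q ^ (6 * c ^+ 2 * n + (2 + 6 * r - c) * c))).

End modular.

Arguments zeta5 {R}.

(* Main.v *)
Require Import Defs.
From HB Require Import structures.
From mathcomp Require Import all_boot all_order all_algebra finmap.
From mathcomp Require Import all_classical all_reals all_analysis.
From mathcomp Require Import complex ring lra zify.

(** The rank generating function of odd Durfee symbols is a Lerch sum, and at a
    fifth root of unity this Lerch sum can be written in terms of the sums
    S(r, 5) and of theta functions.

    A row of an odd Durfee symbol with subscript D is a partition into odd parts
    at most 2D + 1.  Hence, for |z| = 1, R^0(z; q) is the sum over D of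
    q^(2D^2+2D+1) / ((zq; q^2)_(D+1) (q/z; q^2)_(D+1))
    ([has_sum_rowT], [has_sum_symbolT], [R0_eq]).  Expand the D-th summand in
    partial fractions and sum the coefficients of 1/(1 - z q^(2n+1)) over D by
    Cauchy's identity sum_m p^(m^2+mr) / ((p)_m (p)_(m+r)) = 1/(p)_oo, at
    p = q^2; writing J_m for (q^m; q^m)_oo this gives
      J_2 R^0(z; q) = sum_n (-1)^n q^(3n^2+3n+1) / (1 - z q^(2n+1))
    ([cauchy_sum], [bailey], [R0_lerch]).

    If z^5 = 1, a geometric sum turns the denominators into 1 - q^(10n+5), and
    the right hand side becomes a combination, with coefficients z^k, of
      S_k = sum_n (-1)^n q^(3n^2+3n+1+k(2n+1)) / (1 - q^(10n+5)),
    which satisfy S_k = S_(5-k) and S_1 = S_6 - J_2; so only S_0, S_3 and S_6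
    are needed ([lerch_fifth]).

    Splitting S_(3k) by residues modulo 5 gives five Appell-Lerch sums, one in
    the centre and two conjugate pairs.  The relation of Atkin and
    Swinnerton-Dyer, which is the partial fraction expansion of
    1 / (theta(x) theta(xz) theta(x/z)), expresses each pair by the central sum
    and a quotient of theta functions.  The central sum thereby acquires as its
    coefficient exactly the five-dissection of J_2, so that S_(3k) is J_2 / J_50
    times one Appell-Lerch sum, plus theta quotients ([three_term],
    [euler_dissection], [lerch_part_dissection]).  After division by J_2, the three
    Appell-Lerch sums, split once more with a geometric sum of three terms,
    give the S(r, 5) and the quotients with J_150 ([appell25], [appell15], [appell5]).

    It remains to divide the theta quotients by J_2.  This amounts to two
    identities between the theta functions of q^(5k) modulo q^50; by the
    five-dissection of J_2 they fall apart into ten identities, one for each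
    residue modulo 5 of the exponent, and these follow from Weierstrass'
    three-term relation ([weierstrass], [theta_identity_A], [theta_identity_B],
    [main_identity]).

    All series converge absolutely.  They are treated as unconditional sums over
    arbitrary index sets, so that rearranging, splitting and exchanging them are
    instances of a few lemmas; the infinite products and partial fraction
    expansions are limits of finite ones. *)

Set Implicit Arguments.
Unset Strict Implicit.
Unset Printing Implicit Defensive.

Import Order.TTheory GRing.Theory Num.Theory.
Import numFieldNormedType.Exports.

Local Open Scope ring_scope.

(** * Modulus and limits of complex sequences *)

Section Modulus.
Variable R : realType.
Implicit Types (x y z : R[i]) (e : R).

(** The norm on [R[i]] takes its values in [R[i]]; this is the same number in [R]. *)
Definition nm z : R := complex.Re `|z|.

Lemma nmE z : `|z| = real_complex R (nm z).
Proof. by rewrite /nm RRe_real // normr_real. Qed.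

Lemma nm_ge0 z : 0 <= nm z.
Proof. by rewrite -(lecR 0) -nmE normr_ge0. Qed.

Lemma nmD x y : nm (x + y) <= nm x + nm y.
Proof. by rewrite -lecR rmorphD /= -!nmE ler_normD. Qed.

Lemma nmM x y : nm (x * y) = nm x * nm y.
Proof. by apply: complexI; rewrite rmorphM /= -!nmE normrM. Qed.

Lemma nmN x : nm (- x) = nm x.
Proof. by rewrite /nm normrN. Qed.

Lemma nmB x y : nm (x - y) <= nm x + nm y.
Proof. by rewrite -(nmN y) nmD. Qed.

Lemma nmBC x y : nm (x - y) = nm (y - x).
Proof. by rewrite -nmN opprB. Qed.

Lemma nm0 : nm 0 = 0. Proof. by rewrite /nm normr0. Qed.
Lemma nm1 : nm 1 = 1. Proof. by rewrite /nm normr1. Qed.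

Lemma nm_eq0 z : (nm z == 0) = (z == 0).
Proof.
apply/eqP/eqP => [h|->]; last exact: nm0.
by apply/eqP; rewrite -normr_eq0 nmE h.
Qed.

Lemma nm_gt0 z : (0 < nm z) = (z != 0).
Proof. by rewrite lt_neqAle nm_ge0 andbT eq_sym nm_eq0. Qed.

Lemma nmV z : nm z^-1 = (nm z)^-1.
Proof.
have [->|z0] := eqVneq z 0; first by rewrite invr0 nm0 invr0.
apply: (mulfI (_ : nm z != 0)); first by rewrite nm_eq0.
by rewrite -nmM !divff ?nm1 ?nm_eq0.
Qed.

Lemma nmX z n : nm (z ^+ n) = nm z ^+ n.
Proof. by elim: n => [|n IH]; rewrite ?expr0 ?nm1 // !exprS nmM IH. Qed.

Lemma nmXz z (n : int) : nm (z ^ n) = nm z ^ n.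
Proof. by case: n => n; [rewrite -!exprnP nmX | rewrite !NegzE -!exprnN nmV nmX]. Qed.

Lemma nm_real e : nm (real_complex R e) = `|e|.
Proof.
rewrite /nm normc_def /= expr0n /= addr0 sqrtr_sqr.
by [].
Qed.

Lemma nm_sum I (r : seq I) (f : I -> R[i]) :
  nm (\sum_(i <- r) f i) <= \sum_(i <- r) nm (f i).
Proof.
elim/big_rec2: _ => [|i a b _ h]; first by rewrite nm0.
by apply: le_trans (nmD _ _) _; rewrite lerD2l.
Qed.

Lemma nm_prod I (r : seq I) P (f : I -> R[i]) :
  nm (\prod_(i <- r | P i) f i) = \prod_(i <- r | P i) nm (f i).
Proof. exact: (big_morph nm nmM nm1). Qed.

Lemma nm_le0_eq z : (forall e, 0 < e -> nm z <= e) -> z = 0.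
Proof.
move=> h; apply/eqP; rewrite -nm_eq0 eq_le nm_ge0 andbT.
by apply/ler_addgt0Pl => e e0; rewrite addr0; exact: h.
Qed.

Lemma abs_Re_le z : `|complex.Re z| <= nm z.
Proof. by rewrite -lecR -nmE normc_ge_Re. Qed.

Lemma abs_Im_le z : `|complex.Im z| <= nm z.
Proof.
have -> : complex.Im z = - complex.Re (z * 'i%C) by rewrite ReiNIm opprK.
rewrite normrN; apply: le_trans (abs_Re_le _) _; rewrite nmM.
have -> : nm ('i%C : R[i]) = 1; last by rewrite mulr1.
by rewrite /nm normc_def /= expr0n expr1n /= add0r sqrtr1.
Qed.

Definition tends (u : nat -> R[i]) (l : R[i]) : Prop :=
  forall e, 0 < e -> exists N, forall n, (N <= n)%N -> nm (u n - l) < e.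

Local Notation K := (R[i] : numFieldType).

(** Limits with real tolerances are easier to estimate than filters on [R[i]]; this
    is the passage between the two. *)
Lemma tendsP (u : nat -> R[i]) (l : R[i]) :
  tends u l <-> ((u : nat -> K) @ \oo --> (l : K))%classic.
Proof.
split=> [h|/cvgrPdist_lt h e e0]; last first.
  have e0' : 0 < real_complex R e by rewrite (ltcR 0).
  have [N _ hN] := h _ e0'; exists N => n Nn.
  by rewrite nmBC -ltcR -nmE; exact: hN.
apply/cvgrPdist_lt => e e0.
have er : e = real_complex R (complex.Re e) by rewrite RRe_real // gtr0_real.
have [|N hN] := h (complex.Re e); first by rewrite -ltcR -er.
by exists N => // n Nn; rewrite distrC nmE er ltcR; exact: hN.
Qed.

Lemma limn_eq (u : nat -> R[i]) (l : R[i]) :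
  tends u l -> limn (u : nat -> K) = l.
Proof. by move=> /tendsP h; apply: cvg_lim h; exact: norm_hausdorff. Qed.

Lemma tends_unique (u : nat -> R[i]) (l l' : R[i]) :
  tends u l -> tends u l' -> l = l'.
Proof. by move=> /limn_eq <- /limn_eq. Qed.

Lemma tendsD u v a b : tends u a -> tends v b ->
  tends (fun n => u n + v n) (a + b).
Proof. by move=> /tendsP h /tendsP h'; apply/tendsP; exact: cvgD h h'. Qed.

Lemma tendsM u v a b : tends u a -> tends v b ->
  tends (fun n => u n * v n) (a * b).
Proof. by move=> /tendsP h /tendsP h'; apply/tendsP; exact: cvgM h h'. Qed.

Lemma tendsV u a : a != 0 -> tends u a -> tends (fun n => (u n)^-1) a^-1.
Proof. by move=> a0 /tendsP h; apply/tendsP; exact: cvgV h. Qed.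

Lemma tends_cst a : tends (fun _ => a) a.
Proof. by move=> e e0; exists 0 => n _; rewrite subrr nm0. Qed.

Lemma tendsZ c u a : tends u a -> tends (fun n => c * u n) (c * a).
Proof. exact/tendsM/tends_cst. Qed.

Lemma eq_tends u v a : u =1 v -> tends u a -> tends v a.
Proof. by move=> /funext <-. Qed.

Lemma tends_prod I (r : seq I) (P : pred I) (F : I -> nat -> R[i]) L :
  (forall i, P i -> tends (F i) (L i)) ->
  tends (fun n => \prod_(i <- r | P i) F i n) (\prod_(i <- r | P i) L i).
Proof.
move=> h; elim: r => [|i r IH].
  by rewrite big_nil; apply: eq_tends (tends_cst 1) => n; rewrite big_nil.
rewrite big_cons; case: ifPn => Pi; last first.
  by apply: eq_tends IH => n; rewrite big_cons (negPf Pi).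
by apply: eq_tends (tendsM (h i Pi) IH) => n; rewrite big_cons Pi.
Qed.

Lemma tends_sum I (r : seq I) (P : pred I) (F : I -> nat -> R[i]) L :
  (forall i, P i -> tends (F i) (L i)) ->
  tends (fun n => \sum_(i <- r | P i) F i n) (\sum_(i <- r | P i) L i).
Proof.
move=> h; elim: r => [|i r IH].
  by rewrite big_nil; apply: eq_tends (tends_cst 0) => n; rewrite big_nil.
rewrite big_cons; case: ifPn => Pi; last first.
  by apply: eq_tends IH => n; rewrite big_cons (negPf Pi).
by apply: eq_tends (tendsD (h i Pi) IH) => n; rewrite big_cons Pi.
Qed.

(** The map [f] is any map tending to infinity, so this covers shifts of the index. *)
Lemma tends_comp u a (f : nat -> nat) :
  (forall N, exists M, forall n, (M <= n)%N -> (N <= f n)%N) ->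
  tends u a -> tends (fun n => u (f n)) a.
Proof.
move=> hf hu e /hu [N hN]; have [M hM] := hf N.
by exists M => n /hM /hN.
Qed.

Lemma tends_bounded (u : nat -> R[i]) (l : R[i]) :
  tends u l -> exists2 M, 0 < M & forall n, nm (u n) <= M.
Proof.
move=> /(_ 1 ltr01) [N hN].
pose M := \sum_(0 <= k < N) nm (u k).
have M0 : 0 <= M by rewrite sumr_ge0 // => k _; exact: nm_ge0.
exists (M + (nm l + 1)) => [|n].
  by rewrite ltr_wpDl // ltr_wpDl // nm_ge0.
have [nN|Nn] := ltnP n N.
  have : nm (u n) <= M.
    rewrite /M (bigD1_seq n) ?mem_index_iota ?iota_uniq //=.
    by rewrite lerDl sumr_ge0 // => k _; exact: nm_ge0.
  by move=> h; apply: le_trans h _; rewrite lerDl addr_ge0 ?nm_ge0.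
have := hN _ Nn; have := nmD (u n - l) l; rewrite subrK; lra.
Qed.

End Modulus.

(** * Unconditional sums *)

Section Sums.
Variable R : realType.
Local Notation C := R[i].

(** Convergence of the net of finite partial sums.  The finite subsets are lists without
    repetition, so that a sum over an arbitrary index type is an ordinary [\sum]. *)
Definition has_sum (I : choiceType) (f : I -> C) (s : C) : Prop :=
  forall e : R, 0 < e -> exists A : seq I, forall B : seq I,
    uniq B -> {subset A <= B} -> nm (\sum_(i <- B) f i - s) < e.

Definition bsum (I : choiceType) (g : I -> R) : Prop :=
  exists M : R, forall B : seq I, uniq B -> \sum_(i <- B) g i <= M.

(** Absolute summability. *)
Definition asum (I : choiceType) (f : I -> C) : Prop :=
  bsum (fun i => nm (f i)).

Section Basic.
Variable I : choiceType.
Implicit Types (f g : I -> C) (s t : C) (h k : I -> R).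

Lemma has_sum_unique f s t : has_sum f s -> has_sum f t -> s = t.
Proof.
move=> hs ht; apply/eqP; rewrite -subr_eq0; apply/eqP/nm_le0_eq => e e0.
have e2 : 0 < e / 2 by lra.
have [A hA] := hs _ e2; have [B hB] := ht _ e2.
have u : uniq (undup (A ++ B)) by exact: undup_uniq.
have sA : {subset A <= undup (A ++ B)}.
  by move=> i iA; rewrite mem_undup mem_cat iA.
have sB : {subset B <= undup (A ++ B)}.
  by move=> i iB; rewrite mem_undup mem_cat iB orbT.
have h1 := hA _ u sA; have h2 := hB _ u sB.
set S := \sum_(i <- _) _ in h1 h2.
have := nmB (S - t) (S - s).
have -> : S - t - (S - s) = s - t by ring.
lra.
Qed.

Lemma eq_has_sum f g s : f =1 g -> has_sum f s -> has_sum g s.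
Proof. by move=> /funext <-. Qed.

Lemma has_sumD f g s t :
  has_sum f s -> has_sum g t -> has_sum (fun i => f i + g i) (s + t).
Proof.
move=> hs ht e e0; have e2 : 0 < e / 2 by lra.
have [A hA] := hs _ e2; have [B hB] := ht _ e2.
exists (A ++ B) => D uD sD; rewrite big_split /=.
have h1 : {subset A <= D} by move=> i iA; apply: sD; rewrite mem_cat iA.
have h2 : {subset B <= D} by move=> i iA; apply: sD; rewrite mem_cat iA orbT.
move: (hA _ uD h1) (hB _ uD h2); set S := \sum_(i <- D) f i; set T := \sum_(i <- D) g i.
have := nmD (S - s) (T - t).
have -> : S - s + (T - t) = S + T - (s + t) by ring.
lra.
Qed.

Lemma has_sumZ c f s : has_sum f s -> has_sum (fun i => c * f i) (c * s).
Proof.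
move=> hs e e0; have M0 : 0 < nm c + 1 by rewrite ltr_wpDl ?nm_ge0.
have [A hA] := hs (e / (nm c + 1)) ltac:(by rewrite divr_gt0).
exists A => D uD sD; rewrite -big_distrr /= -mulrBr nmM.
have := hA _ uD sD; rewrite ltr_pdivlMr // => h; apply: le_lt_trans h.
by rewrite mulrC ler_wpM2l ?nm_ge0 // lerDl.
Qed.

Lemma has_sumN f s : has_sum f s -> has_sum (fun i => - f i) (- s).
Proof.
move=> /(has_sumZ (-1)); rewrite mulN1r; apply: eq_has_sum => i.
by rewrite mulN1r.
Qed.

Lemma has_sumB f g s t :
  has_sum f s -> has_sum g t -> has_sum (fun i => f i - g i) (s - t).
Proof. by move=> hs /has_sumN; exact: has_sumD. Qed.

Lemma has_sum0 : has_sum (fun _ : I => 0) 0.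
Proof. by move=> e e0; exists [::] => B _ _; rewrite big1 // subrr nm0. Qed.

Lemma has_sum_sum J (r : seq J) (F : J -> I -> C) (S : J -> C) :
  (forall j, has_sum (F j) (S j)) ->
  has_sum (fun i => \sum_(j <- r) F j i) (\sum_(j <- r) S j).
Proof.
move=> h; elim: r => [|j r IH].
  by rewrite big_nil; apply: eq_has_sum has_sum0 => i; rewrite big_nil.
rewrite big_cons; apply: eq_has_sum (has_sumD (h j) IH) => i.
by rewrite big_cons.
Qed.

Lemma has_sum_supp (A : seq I) f :
  uniq A -> (forall i, i \notin A -> f i = 0) ->
  has_sum f (\sum_(i <- A) f i).
Proof.
move=> uA h e e0; exists A => B uB sB.
suff -> : \sum_(i <- B) f i = \sum_(i <- A) f i by rewrite subrr nm0.
rewrite (bigID (mem A)) /= addrC big1 ?add0r; last by move=> i /h.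
rewrite -big_filter; apply: perm_big; apply: uniq_perm => //.
  exact: filter_uniq.
by move=> i; rewrite mem_filter /= andb_idr // => /sB.
Qed.

(** Take a list whose sum is within [e] of the supremum of all partial sums: a list
    disjoint from it cannot contribute more than [e]. *)
Lemma bsum_tail h : (forall i, 0 <= h i) -> bsum h ->
  forall e, 0 < e -> exists A : seq I, forall B : seq I,
    uniq B -> {in B, forall i, i \notin A} -> \sum_(i <- B) h i <= e.
Proof.
move=> h0 [M hM] e e0.
pose E := [set x | exists2 B : seq I, uniq B & x = \sum_(i <- B) h i]%classic.
have supE : has_sup E.
  split; first by exists 0; exists [::] => //; rewrite big_nil.
  by exists M => _ [B uB ->]; exact: hM.
have [_ [A uA ->] hA] := sup_adherent e0 supE.
exists A => B uB dB.
have : \sum_(i <- A ++ B) h i <= sup E.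
  apply: ub_le_sup; first by case: supE.
  exists (A ++ B) => //; rewrite cat_uniq uA uB andbT /=.
  by apply/hasPn => i /dB.
rewrite big_cat /=; lra.
Qed.

Lemma asum_tail f : asum f ->
  forall e, 0 < e -> exists A : seq I, forall B : seq I,
    uniq B -> {in B, forall i, i \notin A} -> nm (\sum_(i <- B) f i) <= e.
Proof.
move=> hf e e0; have [A hA] := bsum_tail (fun i => nm_ge0 (f i)) hf e0.
by exists A => B uB dB; apply: le_trans (nm_sum _ _) (hA _ uB dB).
Qed.

Lemma bsum_le h k : (forall i, h i <= k i) -> bsum k -> bsum h.
Proof.
move=> hk [M hM]; exists M => B uB; apply: le_trans (hM _ uB).
by apply: ler_sum => i _.
Qed.

Lemma bsumZ (c : R) h : 0 <= c -> bsum h -> bsum (fun i => c * h i).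
Proof.
move=> c0 [M hM]; exists (c * M) => B uB.
by rewrite -big_distrr /= ler_wpM2l // hM.
Qed.

Lemma asum_le h f : (forall i, nm (f i) <= h i) -> bsum h -> asum f.
Proof. exact: bsum_le. Qed.

Lemma asumM_bounded M f g :
  0 <= M -> (forall i, nm (g i) <= M) -> asum f -> asum (fun i => f i * g i).
Proof.
move=> M0 hg /(bsumZ M0); apply: bsum_le => i.
by rewrite nmM mulrC ler_wpM2r ?nm_ge0.
Qed.

Lemma bsum_has_sum h : (forall i, 0 <= h i) -> bsum h ->
  exists s, has_sum (fun i => real_complex R (h i)) s.
Proof.
move=> h0 hM.
pose E := [set x | exists2 B : seq I, uniq B & x = \sum_(i <- B) h i]%classic.
have supE : has_sup E.
  split; first by exists 0; exists [::] => //; rewrite big_nil.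
  by case: hM => M hM; exists M => _ [B uB ->]; exact: hM.
exists (real_complex R (sup E)) => e e0.
have [_ [A uA ->] hA] := sup_adherent e0 supE.
exists A => B uB sB; rewrite -rmorph_sum -rmorphB /= nm_real.
have hB : \sum_(i <- B) h i <= sup E.
  by apply: ub_le_sup; [case: supE | exists B].
have : \sum_(i <- A) h i <= \sum_(i <- B) h i.
  rewrite [leRHS](bigID (mem A)) /= -[leLHS]addr0 lerD ?sumr_ge0 //.
  rewrite le_eqVlt; apply/orP; left; apply/eqP; rewrite -[RHS]big_filter.
  apply: perm_big; apply: uniq_perm => //; first exact: filter_uniq.
  by move=> i; rewrite mem_filter /= andb_idr // => /sB.
rewrite ler0_norm; lra.
Qed.

(** The positive and negative parts of the real and imaginary parts are nonnegative
    families with bounded partial sums, and these sum to the supremum of the latter. *)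
Lemma asum_has_sum f : asum f -> exists s, has_sum f s.
Proof.
move=> hf.
have part (k : R -> R) (p : C -> R) : (forall x, 0 <= k x) ->
   (forall x, k x <= `|x|) -> (forall z, `|p z| <= nm z) ->
   exists s, has_sum (fun i => real_complex R (k (p (f i)))) s.
  move=> k0 k1 p1; apply: bsum_has_sum => [i|]; first exact: k0.
  by apply: bsum_le hf => i; apply: le_trans (k1 _) (p1 _).
pose pos (x : R) := Num.max x 0; pose neg (x : R) := Num.max (- x) 0.
have pos0 x : 0 <= pos x by rewrite /pos le_max lexx orbT.
have neg0 x : 0 <= neg x by rewrite /neg le_max lexx orbT.
have pos1 x : pos x <= `|x| by rewrite /pos ge_max ler_norm normr_ge0.
have neg1 x : neg x <= `|x| by rewrite /neg ge_max -normrN ler_norm normr_ge0.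
have pn x : x = pos x - neg x.
  by rewrite /pos /neg; case: (ltrP x 0) => x0; case: (ltrP (- x) 0); lra.
have [a ha] := part pos _ pos0 pos1 (@abs_Re_le R).
have [b hb] := part neg _ neg0 neg1 (@abs_Re_le R).
have [c hc] := part pos _ pos0 pos1 (@abs_Im_le R).
have [d hd] := part neg _ neg0 neg1 (@abs_Im_le R).
exists (a - b + 'i%C * (c - d)).
apply: eq_has_sum (has_sumD (has_sumB ha hb) (has_sumZ 'i%C (has_sumB hc hd))).
by move=> i; rewrite -!rmorphB /= -!pn -complexE.
Qed.

Lemma has_sum_nm_le f s (M : R) :
  has_sum f s -> (forall B : seq I, uniq B -> \sum_(i <- B) nm (f i) <= M) ->
  nm s <= M.
Proof.
move=> hs hM; apply/ler_addgt0Pl => e e0.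
have [A hA] := hs _ e0.
have u := undup_uniq A.
have sA : {subset A <= undup A} by move=> i iA; rewrite mem_undup.
have := hA _ u sA.
have := le_trans (nm_sum _ _) (hM _ u).
set S := \sum_(i <- _) _ => h1 h2.
have := nmB S (S - s); have -> : S - (S - s) = s by ring.
lra.
Qed.

End Basic.
End Sums.

(** * Rearrangement of multiple series *)

Section Rearrangement.
Variable R : realType.
Local Notation C := R[i].

(** The map [h] need only be a bijection from [D] onto a set containing the support of
    [f]; this allows index sets to be enlarged or shrunk by zero terms. *)
Lemma has_sum_reindex (I J : choiceType) (D : pred J) (h : J -> I)
    (f : I -> C) s :
  {in D &, injective h} -> (forall i, f i != 0 -> exists2 j, D j & h j = i) ->
  has_sum f s -> has_sum (fun j => if D j then f (h j) else 0) s.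
Proof.
move=> injh surj hs e e0; have [A hA] := hs _ e0.
have /choice[g hg] : forall i, exists o : option J,
    f i != 0 -> exists2 j, o = Some j & D j /\ h j = i.
  move=> i; have [/surj[j Dj hj]|_] := boolP (f i != 0); last by exists None.
  by exists (Some j) => _; exists j.
exists (pmap g A) => B uB sB; rewrite -big_mkcond /= -big_filter.
set B' := [seq j <- B | D j]; rewrite -(big_map h predT f).
have uB' : uniq (map h B').
  rewrite map_inj_in_uniq ?filter_uniq // => x y.
  by rewrite !mem_filter => /andP[Dx _] /andP[Dy _]; exact: injh.
pose X := map h B' ++ [seq i <- undup A | i \notin map h B'].
have uX : uniq X.
  rewrite cat_uniq uB' filter_uniq ?undup_uniq // andbT /=.
  by apply/hasPn => i; rewrite mem_filter => /andP[].
have sX : {subset A <= X}.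
  move=> i iA; rewrite mem_cat mem_filter mem_undup iA andbT.
  by case: (i \in map h B').
have := hA X uX sX; rewrite big_cat /= [X in _ + X - _]big1_seq ?addr0 //.
move=> i /=; rewrite mem_filter mem_undup => /andP[iX iA].
apply/eqP; apply: contraNT iX => /hg[j gj [Dj hj]].
apply/mapP; exists j => //; rewrite mem_filter Dj /=; apply: sB.
by rewrite mem_pmap -gj map_f.
Qed.

Lemma bsum_reindex (I J : choiceType) (D : pred J) (h : J -> I) (f : I -> R) :
  {in D &, injective h} -> bsum f -> bsum (fun j => if D j then f (h j) else 0).
Proof.
move=> injh [M hM]; exists M => B uB; rewrite -big_mkcond /= -big_filter.
rewrite -(big_map h predT f); apply: hM.
rewrite map_inj_in_uniq ?filter_uniq // => x y.
by rewrite !mem_filter => /andP[Dx _] /andP[Dy _]; exact: injh.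
Qed.

Lemma asum_reindex (I J : choiceType) (D : pred J) (h : J -> I) (f : I -> C) :
  {in D &, injective h} -> asum f -> asum (fun j => if D j then f (h j) else 0).
Proof.
move=> injh /(bsum_reindex injh); apply: bsum_le => j.
by case: (D j); rewrite ?nm0.
Qed.

Lemma has_sum_bij (I J : choiceType) (h : J -> I) (f : I -> C) s :
  bijective h -> has_sum f s -> has_sum (fun j => f (h j)) s.
Proof.
move=> [g hg gh]; apply: (@has_sum_reindex I J predT) => [x y _ _|i _].
  exact: (can_inj hg).
by exists (g i).
Qed.

Lemma has_sum_succ (f : nat -> C) s :
  f 0%N = 0 -> has_sum f s -> has_sum (fun m => f m.+1) s.
Proof.
move=> f0 hs; have := @has_sum_reindex nat nat predT succn f s.
apply; last by [].
  by move=> m n _ _ [].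
by move=> [|m] h; [rewrite f0 eqxx in h | exists m].
Qed.

Lemma asum_inj (I J : choiceType) (h : J -> I) (f : I -> C) :
  injective h -> asum f -> asum (fun j => f (h j)).
Proof.
move=> ih; exact: (@asum_reindex I J predT h f (in2W ih)).
Qed.

(** A finite set of rows [G] is compared with a finite rectangle [G * H]: one half of the
    tolerance pays for the whole family on the rectangle, the other half is shared out
    equally among the rows in [G]. *)
Lemma has_sum_fubini (I J : choiceType) (f : I * J -> C) (g : I -> C) s :
  has_sum f s -> (forall i, has_sum (fun j => f (i, j)) (g i)) -> has_sum g s.
Proof.
move=> hs hg e e0; have e2 : 0 < e / 2 by lra.
have [F hF] := hs _ e2.
exists (map fst F) => G uG sG.
pose e' := e / 2 / ((size G)%:R + 1).
have e'0 : 0 < e' by rewrite divr_gt0 // ltr_wpDl.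
have /choice[a ha] := fun i => hg i _ e'0.
pose H := undup (map snd F ++ flatten (map a G)).
have uH : uniq H by exact: undup_uniq.
have sH i : i \in G -> {subset a i <= H}.
  move=> iG j ja; rewrite mem_undup mem_cat; apply/orP; right.
  by apply/flattenP; exists (a i) => //; exact: map_f.
pose P := [seq (i, j) | i <- G, j <- H].
have uP : uniq P by apply: allpairs_uniq => // -[? ?] [? ?].
have sP : {subset F <= P}.
  move=> [i j] ijF; apply/allpairsP; exists (i, j); split => //=.
    by apply: sG; apply/mapP; exists (i, j).
  by rewrite mem_undup mem_cat; apply/orP; left; apply/mapP; exists (i, j).
have := hF _ uP sP; rewrite big_allpairs /= => h1.
have h2 : nm (\sum_(i <- G) g i - \sum_(i <- G) \sum_(j <- H) f (i, j)) <= e / 2.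
  rewrite -sumrB; apply: le_trans (nm_sum _ _) _.
  apply: (@le_trans _ _ (\sum_(i <- G) e')).
    rewrite big_seq [leRHS]big_seq; apply: ler_sum => i iG.
    by rewrite nmBC ltW // ha //; exact: sH.
  rewrite big_const_seq count_predT iter_addr_0 /e' -[_ *+ size G]mulr_natr.
  have n0 : 0 < (size G)%:R + 1 :> R by rewrite ltr_wpDl.
  rewrite -mulrA ler_piMr //; first lra.
  by rewrite mulrC ler_pdivrMr // mul1r lerDl.
set S := \sum_(i <- G) \sum_(j <- H) _ in h1 h2.
have := nmD (\sum_(i <- G) g i - S) (S - s).
have -> : \sum_(i <- G) g i - S + (S - s) = \sum_(i <- G) g i - s by ring.
lra.
Qed.

(** Every finite set of pairs lies in a finite rectangle. *)
Lemma asum_tonelli (I J : choiceType) (f : I * J -> C) (G : I -> R) :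
  bsum G ->
  (forall i (B : seq J), uniq B -> \sum_(j <- B) nm (f (i, j)) <= G i) ->
  asum f.
Proof.
move=> [M hM] hG; exists M => F uF.
pose X := undup (map fst F); pose Y := undup (map snd F).
have uX : uniq X := undup_uniq _; have uY : uniq Y := undup_uniq _.
pose P := [seq (i, j) | i <- X, j <- Y].
have uP : uniq P by apply: allpairs_uniq => // -[? ?] [? ?].
apply: (@le_trans _ _ (\sum_(ij <- P) nm (f ij))).
  rewrite [leRHS](bigID (mem F)) /= -[leLHS]addr0 lerD ?sumr_ge0 //.
    rewrite le_eqVlt; apply/orP; left; apply/eqP; rewrite -[RHS]big_filter.
    apply: perm_big; apply: uniq_perm => //; first exact: filter_uniq.
    move=> [i j]; rewrite mem_filter /= andb_idr // => ijF.
    by apply/allpairsP; exists (i, j); split => //=; rewrite mem_undup;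
       apply/mapP; exists (i, j).
  by move=> ij _; exact: nm_ge0.
rewrite big_allpairs; apply: le_trans (hM _ uX).
by apply: ler_sum => i _; exact: hG.
Qed.

Lemma asum_prod (I J : choiceType) (f : I -> C) (g : J -> C) :
  asum f -> asum g -> asum (fun ij : I * J => f ij.1 * g ij.2).
Proof.
move=> [M hM] [N hN].
apply: (@asum_tonelli _ _ _ (fun i => nm (f i) * N)); last first.
  move=> i B uB; rewrite -(eq_bigr _ (fun j _ => esym (nmM (f i) (g j)))).
  by rewrite -big_distrr /= ler_wpM2l ?nm_ge0 // hN.
have N0 : 0 <= N by have := hN [::] isT; rewrite big_nil.
exists (M * N) => B uB.
by rewrite -big_distrl /= ler_wpM2r // hM.
Qed.

Lemma has_sum_prod (I J : choiceType) (f : I -> C) (g : J -> C) s t :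
  asum f -> asum g -> has_sum f s -> has_sum g t ->
  has_sum (fun ij : I * J => f ij.1 * g ij.2) (s * t).
Proof.
move=> af ag hs ht; have [u hu] := asum_has_sum (asum_prod af ag).
suff -> : s * t = u by [].
have := has_sum_fubini hu (fun i => has_sumZ (f i) ht).
apply: has_sum_unique; rewrite mulrC.
by apply: eq_has_sum (has_sumZ t hs) => i; rewrite mulrC.
Qed.

Lemma bsum_fin (T : finType) (g : T -> R) : (forall t, 0 <= g t) -> bsum g.
Proof.
move=> g0; exists (\sum_(t : T) g t) => B uB.
rewrite big_uniq //= [leRHS](bigID (mem B)) /=.
by rewrite -[leLHS]addr0 lerD ?sumr_ge0.
Qed.

Lemma has_sum_fin (T : finType) (f : T -> C) : has_sum f (\sum_t f t).
Proof.
have := @has_sum_supp R T (index_enum T) f (index_enum_uniq T).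
by apply=> t; rewrite mem_index_enum.
Qed.

Lemma asum_fin_prod (T : finType) (I : choiceType) (f : T * I -> C) :
  (forall t, asum (fun i => f (t, i))) -> asum f.
Proof.
move=> /choice[M hM]; apply: (@asum_tonelli _ _ _ M); last exact: hM.
apply: bsum_fin => t; have := hM t [::] isT.
by rewrite big_nil.
Qed.

(** Applied with [T] a set of residues and [I] the integers, this splits a bilateral
    series into residue classes. *)
Lemma has_sum_partition (T : finType) (I J : choiceType) (h : T * I -> J)
    (f : J -> C) (g : T -> C) s :
  bijective h -> has_sum f s ->
  (forall t, has_sum (fun i => f (h (t, i))) (g t)) -> s = \sum_t g t.
Proof.
move=> bh hs hg; have hs' := has_sum_bij bh hs.
exact: has_sum_unique (has_sum_fubini hs' hg) (has_sum_fin g).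
Qed.

(** Dominated convergence: off a finite set [A] the terms contribute at most the tail of
    [h], uniformly in [N]; on [A] there are finitely many limits. *)
Lemma tannery (I : choiceType) (h : I -> R) (F : nat -> I -> C) (f : I -> C)
    (S : nat -> C) s :
  bsum h -> (forall N i, nm (F N i) <= h i) ->
  (forall i, tends (F ^~ i) (f i)) ->
  (forall N, has_sum (F N) (S N)) -> has_sum f s -> tends S s.
Proof.
move=> hh hF hf hS hs e e0; have e5 : 0 < e / 5 by lra.
have h0 i : 0 <= h i := le_trans (nm_ge0 _) (hF 0%N i).
have [A0 hA0] := bsum_tail h0 hh e5; pose A := undup A0.
have uA : uniq A := undup_uniq _.
have hA (B : seq I) : uniq B -> {in B, forall i, i \notin A} ->
    \sum_(i <- B) h i <= e / 5.
  by move=> uB d; apply: hA0 => // i /d; rewrite mem_undup.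
have close (k : I -> C) t : (forall i, nm (k i) <= h i) -> has_sum k t ->
    nm (\sum_(i <- A) k i - t) <= 2 * (e / 5).
  move=> hk ht; have [B hB] := ht _ e5.
  pose D := [seq i <- undup B | i \notin A].
  have uD : uniq (A ++ D).
    rewrite cat_uniq uA filter_uniq ?undup_uniq // andbT /=.
    by apply/hasPn => i; rewrite mem_filter => /andP[].
  have sD : {subset B <= A ++ D}.
    by move=> i iB; rewrite mem_cat mem_filter mem_undup iB andbT; case: (i \in A).
  have := hB _ uD sD; rewrite big_cat /= => h1.
  have h2 : nm (\sum_(i <- D) k i) <= e / 5.
    apply: le_trans (nm_sum _ _) (le_trans (ler_sum _ (fun i _ => hk i)) _).
    apply: hA; first by rewrite filter_uniq ?undup_uniq.
    by move=> i; rewrite mem_filter => /andP[].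
  set X := \sum_(i <- A) _ in h1 *; set Y := \sum_(i <- D) _ in h1 h2.
  have := nmB (X + Y - t) Y; have -> : X + Y - t - Y = X - t by ring.
  lra.
have hfh i : nm (f i) <= h i.
  apply/ler_addgt0Pl => d d0; have [N hN] := hf i _ d0.
  have := hN N (leqnn N); have := hF N i; have := nmB (F N i) (F N i - f i).
  have -> : F N i - (F N i - f i) = f i by ring.
  lra.
have [N hN] := tends_sum A (P := predT) (fun i _ => hf i) e5.
exists N => n Nn; have := hN _ Nn.
(* [close] costs two shares of [e / 5] for each of the two sums, the finite set costs one *)
have := close _ _ (hF n) (hS n); have := close _ _ hfh hs.
set X := \sum_(i <- A) f i; set Y := \sum_(i <- A) F n i => h1 h2 h3.
have := nmD (S n - Y + (Y - X)) (X - s); have := nmD (S n - Y) (Y - X).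
have -> : S n - Y + (Y - X) + (X - s) = S n - s by ring.
rewrite (nmBC (S n)); lra.
Qed.

Lemma has_sum_partial_le (I : choiceType) (g : I -> R) (f : I -> C) s (B : seq I) :
  (forall i, 0 <= g i) -> (forall i, f i = real_complex R (g i)) ->
  has_sum f s -> uniq B -> \sum_(i <- B) g i <= nm s.
Proof.
move=> g0 hf hs uB; apply/ler_addgt0Pl => e e0.
have [A hA] := hs _ e0; pose D := B ++ [seq i <- undup A | i \notin B].
have uD : uniq D.
  rewrite cat_uniq uB filter_uniq ?undup_uniq // andbT /=.
  by apply/hasPn => i; rewrite mem_filter => /andP[].
have sD : {subset A <= D}.
  by move=> i iA; rewrite mem_cat mem_filter mem_undup iA andbT; case: (i \in B).
have h := hA _ uD sD.
have e1 : \sum_(i <- D) f i = real_complex R (\sum_(i <- D) g i).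
  by rewrite (eq_bigr _ (fun i _ => hf i)) rmorph_sum.
have g1 : 0 <= \sum_(i <- D) g i by apply: sumr_ge0.
have h2 : \sum_(i <- B) g i <= \sum_(i <- D) g i.
  by rewrite big_cat /= lerDl sumr_ge0.
have := nmD (\sum_(i <- D) f i - s) s; rewrite subrK {1}e1 nm_real ger0_norm //.
lra.
Qed.

Lemma has_sum_series (f : nat -> C) s :
  has_sum f s -> tends (fun N => \sum_(0 <= k < N) f k) s.
Proof.
move=> hs e /hs[A hA]; exists (\max_(i <- A) i.+1)%N => n hn.
apply: hA; first exact: iota_uniq.
move=> i iA; rewrite mem_index_iota /=; apply: leq_trans hn.
exact: (@leq_bigmax_seq _ A predT succn).
Qed.

(** By the ratio condition, the partial sum plus the geometric bound for the remainder
    does not increase from the index [N] on. *)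
Lemma asum_ratio (f : nat -> C) (rho : R) N :
  rho < 1 -> (forall n, (N <= n)%N -> nm (f n.+1) <= rho * nm (f n)) -> asum f.
Proof.
move=> r1 hf; have r10 : 0 < 1 - rho by lra.
pose M := \sum_(0 <= k < N) nm (f k) + nm (f N) / (1 - rho).
have part m : \sum_(0 <= k < N + m) nm (f k) + nm (f (N + m)%N) / (1 - rho) <= M.
  elim: m => [|m IH]; first by rewrite addn0.
  apply: le_trans IH; rewrite addnS big_nat_recr //= -addrA lerD2l.
  rewrite ler_pdivlMr // mulrDl divfK ?gt_eqF //.
  have := hf (N + m)%N (leq_addr _ _); lra.
exists M => B uB; pose m := (\max_(i <- B) i.+1)%N.
apply: (@le_trans _ _ (\sum_(0 <= k < N + m) nm (f k))); last first.
  by apply: le_trans (part m); rewrite lerDl divr_ge0 ?nm_ge0 // ltW.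
rewrite [leRHS](bigID (mem B)) /= -[leLHS]addr0 lerD ?sumr_ge0 //; last first.
  by move=> i _; exact: nm_ge0.
rewrite le_eqVlt; apply/orP; left; apply/eqP; rewrite -[RHS]big_filter.
apply: perm_big; apply: uniq_perm => //.
  by rewrite filter_uniq // iota_uniq.
move=> i; rewrite mem_filter /= andb_idr // => iB.
rewrite mem_index_iota /=; apply: (@leq_trans m); last exact: leq_addl.
exact: (@leq_bigmax_seq _ B predT succn).
Qed.

Definition int_of_sign (bk : bool * nat) : int :=
  if bk.1 then Posz bk.2 else Negz bk.2.

Lemma int_of_sign_bij : bijective int_of_sign.
Proof.
exists (fun n : int => match n with Posz k => (true, k) | Negz k => (false, k) end).
  by case=> [[] k].
by case.
Qed.

(** A series over the integers is a pair of series over the naturals, indexed by sign. *)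
Lemma asum_int (f : int -> C) :
  asum (fun k : nat => f (Posz k)) -> asum (fun k : nat => f (Negz k)) -> asum f.
Proof.
move=> hp hn; have [g gh hg] := int_of_sign_bij.
have : asum (fun bk => f (int_of_sign bk)) by apply: asum_fin_prod; case.
move=> /(asum_inj (can_inj hg)); congr asum; apply/funext => n.
by rewrite hg.
Qed.

Lemma bilateral_eq (f : int -> C) s : asum f -> has_sum f s ->
  @bilateral (R[i] : numFieldType) f = s.
Proof.
move=> hf hs.
have injp : injective Posz by move=> x y [].
have injn : injective Negz by move=> x y [].
have [a ha] := asum_has_sum (asum_inj injp hf).
have [b hb] := asum_has_sum (asum_inj injn hf).
have E t : has_sum (fun i => f (int_of_sign (t, i))) (if t then a else b).
  by case: t.
rewrite (has_sum_partition int_of_sign_bij hs E) big_bool /= /bilateral.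
by congr (_ + _); apply: limn_eq; apply: has_sum_series.
Qed.

Definition csum (I : choiceType) (f : I -> C) : C :=
  xget 0 [set s | has_sum f s]%classic.

Lemma csumP (I : choiceType) (f : I -> C) : asum f -> has_sum f (csum f).
Proof. by move=> /asum_has_sum[s hs]; exact: (xgetPex 0 (ex_intro _ s hs)). Qed.

Lemma csum_eq (I : choiceType) (f : I -> C) s : has_sum f s -> csum f = s.
Proof. move=> hs; exact: has_sum_unique (xgetPex 0 (ex_intro _ s hs)) hs. Qed.

End Rearrangement.

(** * q-Pochhammer products and theta functions *)

Section Pochhammer.
Variable R : realType.
Local Notation C := R[i].
Local Notation K := (R[i] : numFieldType).
Implicit Types (a p x y : C).

Lemma asum_small (f : nat -> C) : asum f ->
  forall e : R, 0 < e -> exists N, forall n, (N <= n)%N -> nm (f n) <= e.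
Proof.
move=> hf e /(asum_tail hf)[A hA]; exists (\max_(i <- A) i.+1)%N => n hn.
have := hA [:: n] isT; rewrite big_seq1; apply => i.
rewrite inE => /eqP ->; apply/negP => nA.
by have := leq_trans (@leq_bigmax_seq _ A predT succn n nA isT) hn; rewrite ltnn.
Qed.

Lemma asum_geometric a p : nm p < 1 -> asum (fun k : nat => a * p ^+ k).
Proof.
move=> p1; apply: (@asum_ratio _ _ (nm p) 0%N) => // n _.
by rewrite exprS mulrCA (nmM p).
Qed.

Lemma bsum_geometric p : nm p < 1 -> bsum (fun m : nat => nm p ^+ m).
Proof.
move=> p1; have := asum_geometric 1 p1; apply: bsum_le => m.
by rewrite mul1r nmX.
Qed.

(** The sum exists by absolute convergence, and removing the first term shows that it
    satisfies s - 1 = z s. *)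
Lemma has_sum_geometric (z : C) : nm z < 1 -> has_sum (fun m : nat => z ^+ m) (1 - z)^-1.
Proof.
move=> z1.
have [s hs] : exists s, has_sum (fun m : nat => z ^+ m) s.
  apply: asum_has_sum; apply: asum_le (asum_geometric 1 z1) => m.
  by rewrite mul1r.
pose g (m : nat) : C := if m == 0%N then 1 else 0.
have hg : has_sum g 1.
  have := @has_sum_supp R nat [:: 0%N] g isT; rewrite big_seq1 /g /=; apply.
  by move=> i; rewrite inE; case: eqP.
have := has_sum_succ _ (has_sumB hs hg); rewrite /g /= expr0 subrr => /(_ erefl) h.
have e : s - 1 = z * s.
  apply: has_sum_unique h _; apply: eq_has_sum (has_sumZ z hs) => m.
  by rewrite subr0 exprS.
have z10 : 1 - z != 0.
  rewrite subr_eq0; apply/eqP => h1; move: z1; rewrite -h1 nm1; lra.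
suff <- : s = (1 - z)^-1 by [].
apply: (mulfI z10); rewrite mulfV // mulrBl mul1r -e; ring.
Qed.

Lemma geometric_sum (r : R) N : r < 1 -> 0 <= r ->
  \sum_(0 <= k < N) r ^+ k <= (1 - r)^-1.
Proof.
move=> r1 r0; have r10 : 0 < 1 - r by lra.
rewrite -[leRHS]mul1r ler_pdivlMr //.
suff -> : (\sum_(0 <= k < N) r ^+ k) * (1 - r) = 1 - r ^+ N.
  by rewrite gerBl exprn_ge0.
elim: N => [|N IH]; first by rewrite big_nil mul0r expr0 subrr.
by rewrite big_nat_recr //= mulrDl IH exprS; ring.
Qed.

Definition poch a p N : C := \prod_(0 <= k < N) (1 - a * p ^+ k).

Lemma poch0 a p : poch a p 0 = 1. Proof. by rewrite /poch big_nil. Qed.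

Lemma pochS a p N : poch a p N.+1 = poch a p N * (1 - a * p ^+ N).
Proof. by rewrite /poch big_nat_recr. Qed.

Lemma poch_add a p M N : poch a p (M + N) = poch a p M * poch (a * p ^+ M) p N.
Proof.
elim: N => [|N IH]; first by rewrite addn0 poch0 mulr1.
by rewrite addnS !pochS IH exprD !mulrA.
Qed.

Lemma poch_recl a p N : poch a p N.+1 = (1 - a) * poch (a * p) p N.
Proof. by rewrite -(add1n N) poch_add pochS poch0 mul1r expr0 mulr1 expr1. Qed.

Lemma poch_neq0 a p N : (forall k, a * p ^+ k != 1) -> poch a p N != 0.
Proof.
move=> h; rewrite /poch prodf_seq_neq0; apply/allP => k _ /=.
by rewrite subr_eq0 eq_sym.
Qed.

(** The two bounds have to be proved together: the second one keeps the partial products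
    below 2, which is what the inductive step for the first one needs. *)
Lemma poch_near1 a p N : nm p < 1 -> nm a <= (1 - nm p) / 4 ->
  nm (poch a p N - 1) <= 1 / 2.
Proof.
move=> p1 ha.
suff h : nm (poch a p N - 1) <= 2 * nm a * \sum_(0 <= k < N) nm p ^+ k /\
         nm (poch a p N - 1) <= 1 / 2 by case: h.
elim: N => [|N [IH1 IH2]].
  by rewrite poch0 subrr nm0 big_nil mulr0; split => //; lra.
have E : nm (poch a p N.+1 - 1) <= 2 * nm a * \sum_(0 <= k < N.+1) nm p ^+ k.
  have -> : poch a p N.+1 - 1 = (poch a p N - 1) + - (poch a p N * (a * p ^+ N)).
    by rewrite pochS; ring.
  rewrite big_nat_recr //= mulrDr; apply: le_trans (nmD _ _) (lerD IH1 _).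
  rewrite nmN !nmM nmX mulrA ler_wpM2r ?exprn_ge0 ?nm_ge0 // ler_wpM2r ?nm_ge0 //.
  by have := nmD (poch a p N - 1) 1; rewrite subrK nm1; lra.
split => //; apply: le_trans E _.
have g := geometric_sum N.+1 p1 (nm_ge0 p).
have p10 : 0 < 1 - nm p by lra.
apply: (@le_trans _ _ (2 * nm a * (1 - nm p)^-1)).
  by rewrite ler_wpM2l // mulr_ge0 ?nm_ge0.
by rewrite ler_pdivrMr //; lra.
Qed.

Lemma tends_shift (u : nat -> C) l M : tends (fun n => u (M + n)%N) l -> tends u l.
Proof.
move=> h e /h[N hN]; exists (M + N)%N => n hn.
by rewrite -(subnKC (leq_trans (leq_addr _ _) hn)) hN // leq_subRL // (leq_trans _ hn) ?leq_addr.
Qed.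

(** The differences of consecutive partial products form an absolutely convergent series
    because the partial products are bounded.  From some index [M] on the remaining product
    stays within 1/2 of 1, so the limit can vanish only if one of the first [M] factors does. *)
Lemma poch_cvg a p : nm p < 1 -> exists2 l, tends (poch a p) l &
   ((forall k, a * p ^+ k != 1) -> l != 0).
Proof.
move=> p1; have p10 : 0 < (1 - nm p) / 4 by lra.
have [M /(_ M (leqnn M)) hM] := asum_small (asum_geometric a p1) p10.
set b := a * p ^+ M in hM.
have hb N := poch_near1 N p1 hM.
have hb2 N : nm (poch b p N) <= 2.
  by have := hb N; have := nmD (poch b p N - 1) 1; rewrite subrK nm1; lra.
have : asum (fun N => b * p ^+ N * - poch b p N).
  apply: (asumM_bounded (M := 2)) => // [N|]; first by rewrite nmN.
  exact: asum_geometric.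
move=> /asum_has_sum[s /has_sum_series hs].
have hl : tends (poch b p) (1 + s).
  apply: eq_tends (tendsD (tends_cst 1) hs) => N.
  elim: N => [|N IH]; first by rewrite big_nil poch0 addr0.
  by rewrite big_nat_recr //= addrA IH pochS; ring.
exists (poch a p M * (1 + s)).
  apply: (@tends_shift _ _ M).
  by apply: eq_tends (tendsZ (poch a p M) hl) => N; rewrite poch_add.
move=> h; rewrite mulf_neq0 ?poch_neq0 //; apply/negP => /eqP l0.
have e0 : 0 < 1 / 4 :> R by lra.
have [N /(_ N (leqnn N))] := hl _ e0; rewrite l0 subr0 => h2.
have := hb N; have := nmB (poch b p N) (poch b p N - 1).
have -> : poch b p N - (poch b p N - 1) = 1 by ring.
rewrite nm1; lra.
Qed.

Local Notation qp := (@qpoch K).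

Lemma poch_tends a p : nm p < 1 -> tends (poch a p) (qp a p).
Proof. by move=> /(poch_cvg a)[l hl _]; rewrite /qpoch (limn_eq hl). Qed.

Lemma qpoch_eq a p l : nm p < 1 -> tends (poch a p) l -> qp a p = l.
Proof. by move=> p1; exact: tends_unique (poch_tends a p1). Qed.

Lemma qpoch_neq0 a p : nm p < 1 -> (forall k, a * p ^+ k != 1) -> qp a p != 0.
Proof. by move=> p1 h; have [l /(qpoch_eq p1) -> /(_ h)] := poch_cvg a p1. Qed.

Lemma poch_bounded a p : nm p < 1 ->
  exists2 M, 0 < M & forall N, nm (poch a p N) <= M.
Proof. by move=> p1; exact: tends_bounded (poch_tends a p1). Qed.

Lemma poch_inv_bounded a p : nm p < 1 -> (forall k, a * p ^+ k != 1) ->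
  exists2 M, 0 < M & forall N, nm (poch a p N)^-1 <= M.
Proof.
move=> p1 h; apply: tends_bounded; apply: tendsV (poch_tends a p1).
exact: qpoch_neq0.
Qed.

Lemma qpoch_rec a p : nm p < 1 -> qp a p = (1 - a) * qp (a * p) p.
Proof.
move=> p1; apply: qpoch_eq => //; apply: (@tends_shift _ _ 1).
apply: eq_tends (tendsZ (1 - a) (poch_tends (a * p) p1)) => N.
by rewrite add1n poch_recl.
Qed.

Lemma nmX_lt1 p m : nm p < 1 -> (0 < m)%N -> nm (p ^+ m) < 1.
Proof. by move=> p1 m0; rewrite nmX exprn_ilt1 ?nm_ge0 // -lt0n. Qed.

Lemma nmX_le p m n : nm p < 1 -> (m <= n)%N -> nm p ^+ n <= nm p ^+ m.
Proof.
move=> p1 mn; rewrite -(subnKC mn) exprD ler_piMr ?exprn_ge0 ?nm_ge0 //.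
by rewrite exprn_ile1 ?nm_ge0 // ltW.
Qed.

Lemma poch_dissect a p m N :
  poch a p (m * N) = \prod_(i < m) poch (a * p ^+ i) (p ^+ m) N.
Proof.
elim: N => [|N IH].
  by rewrite muln0 poch0 big1 // => i _; rewrite poch0.
rewrite mulnS addnC poch_add IH -[RHS](eq_bigr _ (fun i _ => esym (pochS _ _ _))).
rewrite big_split /=; congr (_ * _); rewrite /poch big_mkord.
apply: eq_bigr => i _; rewrite exprM; congr (1 - _); ring.
Qed.

Lemma qpoch_dissect a p m : nm p < 1 -> (0 < m)%N ->
  qp a p = \prod_(i < m) qp (a * p ^+ i) (p ^+ m).
Proof.
move=> p1 m0; apply: (@tends_unique _ (fun N => poch a p (m * N))).
  apply: (tends_comp (u := poch a p)) (poch_tends a p1) => N; exists N => n h.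
  by apply: leq_trans h _; exact: leq_pmull.
apply: eq_tends; first by move=> N; rewrite poch_dissect.
by apply: tends_prod => i _; exact: poch_tends (nmX_lt1 p1 m0).
Qed.

Lemma qpoch_sqr a p : nm p < 1 -> qp (a ^+ 2) (p ^+ 2) = qp a p * qp (- a) p.
Proof.
move=> p1; apply: qpoch_eq; first exact: nmX_lt1.
apply: eq_tends (tendsM (poch_tends a p1) (poch_tends (- a) p1)) => N.
rewrite /poch -big_split /=; apply: eq_bigr => k _.
by rewrite -exprM mulnC exprM; ring.
Qed.

Lemma expf_neq1 p k : nm p < 1 -> (0 < k)%N -> p ^+ k != 1.
Proof.
move=> p1 k0; apply/negP => /eqP h.
by have := nmX_lt1 p1 k0; rewrite h nm1 ltxx.
Qed.

Lemma pp_neq1 p : nm p < 1 -> forall k, p * p ^+ k != 1.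
Proof. by move=> p1 k; rewrite -exprS expf_neq1. Qed.

Lemma poch_pp_neq0 p N : nm p < 1 -> poch p p N != 0.
Proof. by move=> p1; apply: poch_neq0; exact: pp_neq1. Qed.

Lemma poch_ppS p N : poch p p N.+1 = poch p p N * (1 - p ^+ N.+1).
Proof. by rewrite pochS -exprS. Qed.

Lemma qpoch_pp_neq0 p : nm p < 1 -> qp p p != 0.
Proof. by move=> p1; apply: qpoch_neq0 (pp_neq1 p1). Qed.

(** Jacobi's theta function in product form, [x; p]_oo in bracket notation. *)
Definition theta x p : C := qp x p * qp (p / x) p.
Definition fintheta x p N : C := poch x p N * poch (p / x) p N.

Lemma fintheta_tends x p : nm p < 1 -> tends (fintheta x p) (theta x p).
Proof. by move=> p1; apply: tendsM; apply: poch_tends. Qed.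

Section Theta.
Variable p : C.
Hypotheses (p0 : p != 0) (p1 : nm p < 1).

Lemma theta_flip x : x != 0 -> theta (p / x) p = theta x p.
Proof.
move=> x0; have e : p / (p / x) = x by rewrite invf_div mulrCA divff // mulr1.
by rewrite /theta e; exact: mulrC.
Qed.

(** The shift moves one factor from each product to the other. *)
Lemma theta_shift x : x != 0 -> theta (x * p) p = - x^-1 * theta x p.
Proof.
move=> x0; rewrite /theta (qpoch_rec x p1).
have -> : p / (x * p) = x^-1 by field; rewrite x0 p0.
rewrite (qpoch_rec x^-1 p1) [x^-1 * p]mulrC; field.
by rewrite x0.
Qed.

Lemma theta_inv x : x != 0 -> theta x^-1 p = - x^-1 * theta x p.
Proof.
move=> x0; have e : x^-1 = p / (x * p) by field; rewrite x0 p0.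
by rewrite {1}e (theta_flip (mulf_neq0 x0 p0)); exact: theta_shift.
Qed.

Lemma theta_neq0 x : x != 0 -> (forall n : int, x * p ^ n != 1) -> theta x p != 0.
Proof.
move=> x0 h; rewrite mulf_neq0 ?qpoch_neq0 // => k; first exact: (h k).
have := h (- (k.+1 : int)); rewrite -exprnN; apply: contra => /eqP e.
have : x * (p / x * p ^+ k) = x by rewrite e mulr1.
have -> : x * (p / x * p ^+ k) = p ^+ k.+1 by rewrite exprS; field.
by move=> ->; rewrite divff.
Qed.

Lemma theta_dissect x m : x != 0 -> (0 < m)%N ->
  theta x p = \prod_(i < m) theta (x * p ^+ i) (p ^+ m).
Proof.
move=> x0 m0; rewrite /theta !(qpoch_dissect _ p1 m0) big_split /=; congr (_ * _).
(* the factors of [p / x] with residue [i] are paired with those of [x] with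
   residue [m - 1 - i] *)
rewrite [LHS](reindex_inj rev_ord_inj); apply: eq_bigr => i _ /=.
have e : p ^+ m = p ^+ i * p ^+ (m - i.+1) * p.
  by rewrite -exprD -exprSr; congr (_ ^+ _); have := ltn_ord i; lia.
have -> // : p / x * p ^+ (m - i.+1) = p ^+ m / (x * p ^+ i).
by rewrite e; field; rewrite x0 expf_neq0.
Qed.

Lemma theta_sqr x : theta (x ^+ 2) (p ^+ 2) = theta x p * theta (- x) p.
Proof.
have e1 : p ^+ 2 / x ^+ 2 = (p / x) ^+ 2 by rewrite exprMn exprVn.
have e2 : p / - x = - (p / x) by rewrite invrN mulrN.
by rewrite /theta e1 e2 (qpoch_sqr x p1) (qpoch_sqr (p / x) p1); exact: mulrACA.
Qed.

End Theta.

End Pochhammer.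

(** * Appell-Lerch sums and theta series *)

Section Appell.
Variable R : realType.
Local Notation C := R[i].
Local Notation K := (R[i] : numFieldType).
Implicit Types (s w x u : C).

(** The quotient of consecutive terms is [w * s ^+ (2 * n + 1)], which tends to 0. *)
Lemma asum_gauss_nat s w : nm s < 1 -> asum (fun k : nat => s ^+ (k * k) * w ^+ k).
Proof.
move=> s1; have e0 : 0 < 1 / 2 :> R by lra.
have [N hN] := asum_small (asum_geometric w s1) e0.
apply: (@asum_ratio _ _ (1 / 2) N) => [|n Nn]; first lra.
have -> : s ^+ (n.+1 * n.+1) * w ^+ n.+1 =
          w * s ^+ (n.*2.+1) * (s ^+ (n * n) * w ^+ n).
  have -> : (n.+1 * n.+1 = n.*2.+1 + n * n)%N by lia.
  by rewrite exprD !exprS; ring.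
by rewrite nmM ler_wpM2r ?nm_ge0 //; apply: hN; lia.
Qed.

Lemma asum_gauss s w : nm s < 1 -> asum (fun n : int => s ^ (n * n) * w ^ n).
Proof.
move=> s1; apply: asum_int => /=.
  exact: asum_gauss_nat.
have := asum_inj succn_inj (asum_gauss_nat w^-1 s1); congr asum.
apply/funext => k; rewrite NegzE mulrNN -PoszM -exprnN exprVn.
by [].
Qed.

(** As n tends to infinity, [1 - x * u ^ n] tends to 1, and [u ^ n * (1 - x / u ^ n)]
    tends to [- x]; hence the reciprocals are bounded in both directions.  A vanishing
    denominator does no harm, since the inverse of 0 is 0. *)
Lemma inv_bounded x u : u != 0 -> nm u < 1 ->
  exists2 M, 0 < M & forall n : int, nm (1 - x * u ^ n)^-1 <= M.
Proof.
move=> u0 u1.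
have ut : tends (fun k => u ^+ k) 0.
  move=> e e0; have e2 : 0 < e / 2 by lra.
  have [N hN] := asum_small (asum_geometric 1 u1) e2.
  by exists N => n /hN; rewrite mul1r subr0; lra.
have [->|x0] := eqVneq x 0.
  by exists 1 => // n; rewrite mul0r subr0 invr1 nm1.
have [M M0 hM] : exists2 M, 0 < M & forall k, nm (1 + (- x) * u ^+ k)^-1 <= M.
  apply: (@tends_bounded _ _ 1^-1); apply: tendsV; first exact: oner_neq0.
  rewrite -[X in tends _ X]addr0 -[X in 1 + X](mulr0 (- x)).
  exact: tendsD (tends_cst 1) (tendsZ _ ut).
have [M' M'0 hM'] : exists2 M, 0 < M & forall k, nm (- x + u ^+ k)^-1 <= M.
  apply: (@tends_bounded _ _ (- x)^-1); apply: tendsV; first by rewrite oppr_eq0.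
  rewrite -[X in tends _ X]addr0.
  exact: tendsD (tends_cst _) ut.
exists (M + M') => [|[k|k]]; first exact: addr_gt0.
  by rewrite -mulNr; apply: le_trans (hM k) _; rewrite lerDl ltW.
rewrite NegzE -exprnN.
have -> : (1 - x / u ^+ k.+1)^-1 = u ^+ k.+1 * (- x + u ^+ k.+1)^-1.
  rewrite -[u ^+ _ in RHS]invrK -invfM; congr (_^-1).
  by field; rewrite expf_neq0.
rewrite nmM -[leRHS]mul1r ler_pM ?nm_ge0 //.
  by rewrite nmX exprn_ile1 ?nm_ge0 // ltW.
by apply: le_trans (hM' _) _; rewrite lerDr ltW.
Qed.

(** Terms of an Appell-Lerch sum.  Writing the quadratic exponent as [s ^ (n * n)],
    with [s] a square root of the base, avoids the halved exponents n(n+1)/2. *)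
Definition lamT s w x u (n : int) : C := s ^ (n * n) * w ^ n / (1 - x * u ^ n).
Definition lam s w x u : C := csum (lamT s w x u).
Definition theta_series s w : C := csum (fun n : int => s ^ (n * n) * w ^ n).

Lemma asum_lam s w x u : nm s < 1 -> u != 0 -> nm u < 1 -> asum (lamT s w x u).
Proof.
move=> s1 u0 u1; have [M M0 hM] := inv_bounded x u0 u1.
by apply: asumM_bounded (ltW M0) hM (asum_gauss w s1).
Qed.

Lemma lamP s w x u : nm s < 1 -> u != 0 -> nm u < 1 ->
  has_sum (lamT s w x u) (lam s w x u).
Proof. by move=> s1 u0 u1; apply: csumP; exact: asum_lam. Qed.

Lemma theta_seriesP s w : nm s < 1 -> has_sum (fun n : int => s ^ (n * n) * w ^ n) (theta_series
    s w).
Proof. by move=> s1; apply: csumP; exact: asum_gauss. Qed.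

(** Euclidean division, with the remainders taken in the window from [- c] to [k - c]. *)
Lemma divz_split_bij k (c : int) :
  bijective (fun jm : 'I_k.+1 * int => jm.2 * k.+1%:Z + (jm.1%:Z - c)).
Proof.
exists (fun n : int => (inord `|((n + c) %% k.+1)%Z|, ((n + c) %/ k.+1)%Z)).
  move=> [j m] /=; have -> : m * k.+1%:Z + (j%:Z - c) + c = m * k.+1%:Z + j%:Z by ring.
  have jk := ltn_ord j.
  have hj : (j%:Z %/ k.+1)%Z = 0 by rewrite divz_small //= ltz_nat.
  have hm : (j%:Z %% k.+1)%Z = j by rewrite modz_small //= ltz_nat.
  rewrite modzMDl hm divzMDl // hj addr0; congr (_, _).
  by apply: val_inj; rewrite /= inordK.
move=> n /=; set r := ((n + c) %% k.+1)%Z.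
have r0 : 0 <= r by exact: modz_ge0.
have rk : r < k.+1%:Z by exact: ltz_pmod.
rewrite inordK; last by rewrite -ltz_nat gez0_abs.
by rewrite gez0_abs // addrA -divz_eq addrK.
Qed.

(** Put n = (k+1) m + e with e = j - c.  The square of n has the cross term 2(k+1) e m,
    which goes into the second argument.  The offset [c] makes it possible to choose
    residues that are symmetric about 0. *)
Lemma lam_split k (c : int) s w x u :
  s != 0 -> nm s < 1 -> u != 0 -> nm u < 1 -> w != 0 ->
  lam s w x u = \sum_(j < k.+1) s ^ ((j%:Z - c) * (j%:Z - c)) * w ^ (j%:Z - c) *
    lam (s ^+ (k.+1 * k.+1)) (s ^ (2 * k.+1%:Z * (j%:Z - c)) * w ^+ k.+1)
        (x * u ^ (j%:Z - c)) (u ^+ k.+1).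
Proof.
move=> s0 s1 u0 u1 w0.
apply: (has_sum_partition (divz_split_bij k c) (lamP w x s1 u0 u1)) => j /=.
set e := j%:Z - c.
have s1' : nm (s ^+ (k.+1 * k.+1)) < 1 by exact: nmX_lt1.
have u1' : nm (u ^+ k.+1) < 1 by exact: nmX_lt1.
have u0' : u ^+ k.+1 != 0 by rewrite expf_neq0.
apply: eq_has_sum (has_sumZ _ (lamP _ _ s1' u0' u1')) => m.
rewrite /lamT.
have -> : x * u ^ e * (u ^+ k.+1) ^ m = x * u ^ (m * k.+1%:Z + e).
  rewrite exprnP exprz_exp -mulrA -expfzDr //; congr (_ * _ ^ _); ring.
rewrite mulrA; congr (_ / _).
rewrite expfzMl !exprnP !exprz_exp.
have -> : (m * k.+1%:Z + e) * (m * k.+1%:Z + e) =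
  e * e + (k.+1 * k.+1)%N%:Z * (m * m) + 2 * k.+1%:Z * e * m by rewrite PoszM; ring.
have -> : w ^ (m * k.+1%:Z + e) = w ^ e * w ^ (k.+1%:Z * m).
  by rewrite -expfzDr //; congr (_ ^ _); ring.
rewrite !expfzDr //; ring.
Qed.

(** With y = x u^n, this is 1/(1 - y) = (1 + y + ... + y^m)/(1 - y^(m+1)) in each term. *)
Lemma lam_geometric m s w x u :
  s != 0 -> nm s < 1 -> u != 0 -> nm u < 1 ->
  (forall n : int, x ^+ m.+1 * (u ^+ m.+1) ^ n != 1) ->
  lam s w x u = \sum_(i < m.+1) x ^+ i * lam s (w * u ^+ i) (x ^+ m.+1) (u ^+ m.+1).
Proof.
move=> s0 s1 u0 u1 hx.
have u1' : nm (u ^+ m.+1) < 1 by exact: nmX_lt1.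
have u0' : u ^+ m.+1 != 0 by rewrite expf_neq0.
apply: csum_eq.
have := has_sum_sum (index_enum 'I_m.+1)
  (fun i : 'I_m.+1 => has_sumZ (x ^+ i) (lamP (w * u ^+ i) (x ^+ m.+1) s1 u0' u1')).
apply: eq_has_sum => n; rewrite /lamT.
set y := x * u ^ n.
have hy : 1 - x ^+ m.+1 * (u ^+ m.+1) ^ n = (1 - y) * \sum_(i < m.+1) y ^+ i.
  rewrite -opprB -[in RHS]opprB mulNr -subrX1 /y exprMn; congr (- (_ * _ - _)).
  by rewrite !exprnP !exprz_exp mulrC.
have hn := hx n; rewrite eq_sym -subr_eq0 hy in hn.
move: (hn); rewrite mulf_eq0 negb_or => /andP[y1 y2].
transitivity (s ^ (n * n) * w ^ n * (\sum_(i < m.+1) y ^+ i) /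
              ((1 - y) * \sum_(i < m.+1) y ^+ i)).
  rewrite hy; set D := (1 - y) * _; move: D => D.
  rewrite big_distrr /= big_distrl /=; apply: eq_bigr => i _.
  have -> : (w * u ^+ i) ^ n = w ^ n * (u ^ n) ^+ i.
    by rewrite expfzMl !exprnP !exprz_exp [(i%:Z * n)]mulrC.
  by rewrite /y exprMn; ring.
by field; rewrite y1 y2.
Qed.

(** Replace n by - n and use 1/(1 - y) = - y^(-1)/(1 - y^(-1)). *)
Lemma lam_reflect s w x u : nm s < 1 -> u != 0 -> nm u < 1 -> x != 0 ->
  lam s w x u = - x^-1 * lam s (u / w) x^-1 u.
Proof.
move=> s1 u0 u1 x0; apply: csum_eq.
have ob : bijective (fun n : int => - n) by exists (fun n => - n) => n; rewrite opprK.
apply: eq_has_sum (has_sum_bij ob (has_sumZ (- x^-1) (lamP (u / w) x^-1 s1 u0 u1))).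
move=> n; rewrite /lamT mulrNN expfzMl.
have un0 : u ^ n != 0 by rewrite expfz_neq0.
have -> : w^-1 ^ (- n) = w ^ n by rewrite exprz_inv opprK.
rewrite -invr_expz.
have -> : 1 - x^-1 * (u ^ n)^-1 = (1 - x * u ^ n) * - (x^-1 * (u ^ n)^-1).
  by field; rewrite x0 un0.
rewrite invfM invrN invfM !invrK; move: (1 - x * u ^ n)^-1 => d; field.
by rewrite x0 un0.
Qed.

(** Replace n by n + 1. *)
Lemma lam_shift s w x u : s != 0 -> nm s < 1 -> u != 0 -> nm u < 1 -> w != 0 ->
  lam s w x u = s * w * lam s (s ^+ 2 * w) (x * u) u.
Proof.
move=> s0 s1 u0 u1 w0; apply/esym.
have ob : bijective (fun n : int => n + 1).
  by exists (fun n => n - 1) => n; [rewrite addrK | rewrite subrK].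
apply: has_sum_unique (has_sum_bij ob (lamP w x s1 u0 u1)).
apply: eq_has_sum (has_sumZ (s * w) (lamP (s ^+ 2 * w) (x * u) s1 u0 u1)) => n.
rewrite /lamT mulrA; congr (_ / _); last by rewrite expfzDr // expr1z; ring.
rewrite expfzMl exprnP exprz_exp.
have -> : (n + 1) * (n + 1) = n * n + 2 * n + 1 by ring.
rewrite !expfzDr // !expr1z; ring.
Qed.

(** The combination cancels all the denominators. *)
Lemma lam_diff s w x u : nm s < 1 -> u != 0 -> nm u < 1 ->
  (forall n : int, x * u ^ n != 1) ->
  lam s w x u - x * lam s (w * u) x u = theta_series s w.
Proof.
move=> s1 u0 u1 hx; apply/esym/csum_eq.
apply: eq_has_sum (has_sumB (lamP w x s1 u0 u1) (has_sumZ x (lamP (w * u) x s1 u0 u1))).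
move=> n; rewrite /lamT expfzMl; field.
by rewrite subr_eq0 eq_sym hx.
Qed.

Lemma theta_series_shift s w : s != 0 -> nm s < 1 -> w != 0 ->
  theta_series s w = s * w * theta_series s (s ^+ 2 * w).
Proof.
move=> s0 s1 w0; apply/esym.
have ob : bijective (fun n : int => n + 1).
  by exists (fun n => n - 1) => n; [rewrite addrK | rewrite subrK].
apply: has_sum_unique (has_sum_bij ob (theta_seriesP w s1)).
apply: eq_has_sum (has_sumZ (s * w) (theta_seriesP (s ^+ 2 * w) s1)) => n.
rewrite expfzMl exprnP exprz_exp.
have -> : (n + 1) * (n + 1) = n * n + 2 * n + 1 by ring.
rewrite !expfzDr // !expr1z; ring.
Qed.

Lemma theta_series_inv s w : nm s < 1 -> theta_series s w^-1 = theta_series s w.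
Proof.
move=> s1; apply: csum_eq.
have ob : bijective (fun n : int => - n) by exists (fun n => - n) => n; rewrite opprK.
apply: eq_has_sum (has_sum_bij ob (theta_seriesP w s1)) => n.
by rewrite mulrNN -exprz_inv.
Qed.

(** A theta series is an Appell-Lerch sum with [x = 0]. *)
Lemma theta_series_split k (c : int) s w : s != 0 -> nm s < 1 -> w != 0 ->
  theta_series s w = \sum_(j < k.+1) s ^ ((j%:Z - c) * (j%:Z - c)) * w ^ (j%:Z - c) *
    theta_series (s ^+ (k.+1 * k.+1)) (s ^ (2 * k.+1%:Z * (j%:Z - c)) * w ^+ k.+1).
Proof.
move=> s0 s1 w0.
have E s' w' : nm s' < 1 -> theta_series s' w' = lam s' w' 0 s.
  move=> s1'; apply: csum_eq; apply: eq_has_sum (lamP w' 0 s1' s0 s1) => n.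
  by rewrite /lamT mul0r subr0 divr1.
have E' s' w' : nm s' < 1 -> theta_series s' w' = lam s' w' 0 (s ^+ k.+1).
  move=> s1'; apply: csum_eq.
  have t1 : nm (s ^+ k.+1) < 1 by exact: nmX_lt1.
  have t0 : s ^+ k.+1 != 0 by rewrite expf_neq0.
  apply: eq_has_sum (lamP w' 0 s1' t0 t1) => n.
  by rewrite /lamT mul0r subr0 divr1.
rewrite E // (lam_split k c) //; apply: eq_bigr => j _.
by rewrite mul0r E' //; exact: nmX_lt1.
Qed.

End Appell.

(** * Finite forms and the triple product *)

Lemma abs_shift_ge (n : int) : forall N, exists M, forall m, (M <= m)%N ->
  (N <= absz (m%:Z + n)%R)%N.
Proof. by move=> N; exists (N + absz n)%N => m; lia. Qed.

Lemma abs_shift_sub (n : int) c : forall N, exists M, forall m, (M <= m)%N ->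
  (N <= 2 * m - c - absz (m%:Z + n)%R)%N.
Proof. by move=> N; exists (N + absz n + c)%N => m; lia. Qed.

Section FiniteForms.
Variable R : realType.
Local Notation C := R[i].
Local Notation K := (R[i] : numFieldType).
Local Notation qp := (@qpoch K).
Implicit Types (s w x y p : C).

(** The finite identities below are sums over a window of integers growing with [N], whose
    [n]-th term has a coefficient tending to a limit independent of [n].  The index [k]
    of the coefficients counts from the left end [- N] of the window. *)
Lemma window_sum (e : nat) (f : int -> C) (c : nat -> nat -> C) (M : R) L S :
  asum f -> has_sum f S -> (forall N k, nm (c N k) <= M) ->
  (forall n : int, tends (fun N => c N (absz (N%:Z + n)%R)) L) ->
  tends (fun N => \sum_(k < 2 * N + e) f (k%:Z - N%:Z) * c N k) (S * L).
Proof.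
move=> af hf hM hL.
have M0 : 0 <= M := le_trans (nm_ge0 _) (hM 0%N 0%N).
pose inw N (n : int) := (0 <= N%:Z + n) && (N%:Z + n < (2 * N + e)%:Z).
pose F N n := if inw N n then f n * c N (absz (N%:Z + n)%R) else 0.
apply: (@tannery _ _ (fun n => M * nm (f n)) F (fun n => f n * L)).
- exact: bsumZ.
- move=> N n; rewrite /F; case: ifP => _; last by rewrite nm0 mulr_ge0 ?nm_ge0.
  by rewrite nmM mulrC ler_wpM2r ?nm_ge0.
- move=> n; have h := tendsZ (f n) (hL n).
  apply: (@tends_shift _ _ _ ((absz n).+1)%N).
  have h' : tends (fun N => f n * c ((absz n).+1 + N)%N (absz (((absz n).+1 + N)%N%:Z + n)%R)) (f
      n * L).
    apply: (tends_comp (u := fun N => f n * c N (absz (N%:Z + n)%R))) h => N.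
    by exists N => m; lia.
  apply: eq_tends h' => N; rewrite /F /inw ifT //.
  by apply/andP; split; lia.
- move=> N.
  have := @has_sum_supp _ _ [seq k%:Z - N%:Z | k <- index_iota 0 (2 * N + e)] (F N).
  rewrite big_map big_mkord.
  have -> : \sum_(k < 2 * N + e) F N (k%:Z - N%:Z) =
            \sum_(k < 2 * N + e) f (k%:Z - N%:Z) * c N k.
    apply: eq_bigr => k _; rewrite /F /inw.
    have -> : N%:Z + (k%:Z - N%:Z) = k by ring.
    by rewrite lez_nat /= ltz_nat ltn_ord.
  apply.
    rewrite map_inj_uniq ?iota_uniq // => a b /addIr [].
    by [].
  move=> n hn; rewrite /F ifF //; apply: contraNF hn => /andP[h1 h2].
  apply/mapP; exists (absz (N%:Z + n)%R); last by rewrite gez0_abs //; ring.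
  by rewrite mem_index_iota; lia.
- rewrite mulrC; apply: eq_has_sum (has_sumZ L hf) => n; exact: mulrC.
Qed.

Section Base.
Variable s : C.
Hypotheses (s0 : s != 0) (s1 : nm s < 1).
Local Notation p := (s ^+ 2).

Let p0 : p != 0. Proof. by rewrite expf_neq0. Qed.
Let p1 : nm p < 1. Proof. exact: nmX_lt1. Qed.

(** Pull - x/p^k out of the factor 1 - x/p^k, for k = 1, ..., N. *)
Lemma poch_reflect x N : x != 0 ->
  poch (x / p ^+ N) p N = (- x) ^+ N * s ^- (N * N.+1) * poch (p / x) p N.
Proof.
move=> x0; elim: N => [|N IH]; first by rewrite !poch0 expr0 mul0n expr0 invr1 !mulr1.
rewrite poch_recl.
have -> : x / p ^+ N.+1 * p = x / p ^+ N by rewrite exprS; field; rewrite s0 expf_neq0.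
rewrite IH pochS.
have -> : (N.+1 * N.+2 = N * N.+1 + 2 * N.+1)%N by lia.
have -> : p / x * p ^+ N = p ^+ N.+1 / x by rewrite [p ^+ N.+1]exprS mulrAC.
rewrite exprD (exprM s 2) [(- x) ^+ N.+1]exprS.
have : p ^+ N.+1 != 0 by rewrite expf_neq0.
have : s ^+ (N * N.+1) != 0 by rewrite expf_neq0.
move: (p ^+ N.+1) (s ^+ (N * N.+1)) ((- x) ^+ N) => a b c a0 b0.
by field; rewrite x0 a0 b0.
Qed.

Lemma fintheta_poch x N : x != 0 ->
  fintheta x p N = (- x) ^- N * s ^+ (N * N.+1) * poch (x / p ^+ N) p (2 * N).
Proof.
move=> x0; rewrite mul2n -addnn poch_add divfK ?expf_neq0 // poch_reflect //.
rewrite /fintheta; field; rewrite !expf_neq0 ?oppr_eq0 //.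
Qed.

(** The coefficients of the partial fractions below are products over the zeros of one
    factor, evaluated at a zero of another; they have this shape. *)
Lemma prod_shifted y J M : y != 0 -> (J <= M)%N ->
  poch (y / p ^+ J) p M =
  (- y) ^+ J * s ^- (J * J.+1) * poch (p / y) p J * poch y p (M - J).
Proof.
move=> y0 JM; rewrite -{1}(subnKC JM) poch_add divfK ?expf_neq0 // poch_reflect //.
Qed.

(** The Gaussian binomial coefficient with base [p]. *)
Definition qbin M k : C :=
  if (k <= M)%N then poch p p M / (poch p p k * poch p p (M - k)) else 0.

Lemma qbin0 M : qbin M 0 = 1.
Proof. by rewrite /qbin /= subn0 poch0 mul1r divff ?(poch_pp_neq0 _ p1). Qed.

Lemma qbin_pascal M k :
  qbin M.+1 k.+1 = qbin M k.+1 + p ^+ (M - k) * qbin M k.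
Proof.
have nz N : 1 - p ^+ N.+1 != 0.
  by rewrite subr_eq0 eq_sym expf_neq1.
rewrite /qbin ltnS; case: (ltngtP k M) => [kM|kM|->].
- rewrite subSS -(subnSK kM) !poch_ppS; set d := (M - k.+1)%N.
  have -> : M.+1 = (d.+1 + k.+1)%N by rewrite /d; lia.
  rewrite exprD; have := nz d; have := nz k.
  move: (p ^+ d.+1) (p ^+ k.+1) => a b ha hb.
  by field; rewrite !(poch_pp_neq0 _ p1) ha hb.
- by rewrite mulr0 addr0.
- rewrite ?subSS !subnn expr0 add0r mul1r poch0 !mulr1.
  by rewrite !divff ?(poch_pp_neq0 _ p1).
Qed.

Lemma qbin_gt M k : (M < k)%N -> qbin M k = 0.
Proof. by move=> h; rewrite /qbin leqNgt h. Qed.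

(** Gauss's q-binomial theorem, by induction from the q-Pascal rule.  The exponent
    [k * k.-1] is the usual k(k-1)/2, since the base is [s ^+ 2]. *)
Lemma q_binomial z M :
  poch z p M = \sum_(0 <= k < M.+1) qbin M k * (- z) ^+ k * s ^+ (k * k.-1).
Proof.
elim: M => [|M IH].
  by rewrite poch0 big_nat1 qbin0 mul0n !expr0 !mulr1.
rewrite pochS mulrBr mulr1 [in RHS]big_nat_recl // qbin0.
under [in RHS]eq_big_nat => k /andP[_ kM].
  rewrite qbin_pascal !mulrDl; over.
rewrite big_split /= addrA; congr (_ + _).
  rewrite IH [in LHS]big_nat_recl // qbin0; congr (_ + _).
  by rewrite [in RHS]big_nat_recr //= qbin_gt // !mul0r addr0.
rewrite IH big_distrl /= -sumrN; apply: eq_big_nat => k /andP[_ kM].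
have -> : (k.+1 * k = k * k.-1 + 2 * k)%N by case: k kM => // k _; lia.
rewrite exprD (exprM s 2 k) [(- z) ^+ k.+1]exprS.
have -> : p ^+ M = p ^+ (M - k) * p ^+ k by rewrite -exprD subnK.
ring.
Qed.

(** The q-binomial theorem for 2N factors, recentred at N: a finite triple product. *)
Lemma fintheta_sum w N : w != 0 ->
  fintheta (- (s * w)) p N =
  \sum_(k < 2 * N + 1) s ^ ((k%:Z - N%:Z) * (k%:Z - N%:Z)) * w ^ (k%:Z - N%:Z) *
     qbin (2 * N) k.
Proof.
move=> w0; have x0 : - (s * w) != 0 by rewrite oppr_eq0 mulf_neq0.
rewrite fintheta_poch // q_binomial big_mkord addn1 big_distrr /=.
apply: eq_bigr => k _; rewrite opprK.
have -> : - (- (s * w) / p ^+ N) = s * w / p ^+ N by rewrite mulNr opprK.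
have -> : w ^ (k%:Z - N%:Z) = w ^+ k / w ^+ N by rewrite expfzDr // -exprnN.
have -> : s ^ ((k%:Z - N%:Z) * (k%:Z - N%:Z)) =
  s ^+ (N * N.+1 + k + k * k.-1) / s ^+ (N + 2 * (N * k)).
  rewrite exprnN exprnP -expfzDr //; congr (_ ^ _).
  by case: (nat_of_ord k) => [|j]; lia.
have -> : (s * w / p ^+ N) ^+ k = s ^+ k * w ^+ k / s ^+ (2 * (N * k)).
  by rewrite [LHS]exprMn [(s * w) ^+ k]exprMn exprVn -!exprM mulnA.
rewrite exprMn !exprD; field.
by rewrite !expf_neq0.
Qed.

Lemma qbin_bounded : exists2 M : R, 0 < M & forall m k, nm (qbin m k) <= M.
Proof.
have [A A0 hA] := poch_bounded p p1.
have [B B0 hB] := poch_inv_bounded p1 (pp_neq1 p1).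
exists (A * (B * B)) => [|m k]; first by rewrite !mulr_gt0.
rewrite /qbin; case: ifP => _; last by rewrite nm0 ltW // !mulr_gt0.
by rewrite invfM !nmM !ler_pM ?mulr_ge0 ?nm_ge0.
Qed.

(** Jacobi's triple product is the limit of [fintheta_sum], in which every q-binomial
    coefficient tends to the reciprocal of [qp p p]. *)
Lemma jacobi_triple w : w != 0 -> theta_series s w = theta (- (s * w)) p * qp p p.
Proof.
move=> w0; have [M M0 hM] := qbin_bounded.
have J0 : qp p p != 0 := qpoch_pp_neq0 p1.
have hL (n : int) : tends (fun N => qbin (2 * N) (absz (N%:Z + n)%R)) (qp p p)^-1.
  have t1 := poch_tends p p1.
  have t2 : tends (fun N => poch p p (2 * N)) (qp p p).
    by apply: (tends_comp (u := poch p p)) t1 => N; exists N => m; lia.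
  have t3 := tends_comp (abs_shift_ge n) t1.
  have t4 : tends (fun N => poch p p (2 * N - absz (N%:Z + n)%R)) (qp p p).
    apply: (tends_comp (u := poch p p)) t1 => N.
    have [m hm] := abs_shift_sub n 0 N; exists m => k /hm.
    by rewrite subn0.
  have -> : (qp p p)^-1 = qp p p * (qp p p * qp p p)^-1 by field.
  have t5 := tendsM t2 (tendsV (mulf_neq0 J0 J0) (tendsM t3 t4)).
  apply: (@tends_shift _ _ _ (absz n)).
  have t6 : tends (fun N => (fun N => poch p p (2 * N) * (poch p p (absz (N%:Z + n)%R) *
      poch p p (2 * N - absz (N%:Z + n)%R))^-1) (absz n + N)%N)
      (qp p p * (qp p p * qp p p)^-1).
    by apply: tends_comp t5 => N; exists N => m; lia.
  apply: eq_tends t6 => N /=; rewrite /qbin ifT //; lia.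
have := window_sum (c := fun N k => qbin (2 * N) k) 1 (asum_gauss w s1)
  (theta_seriesP w s1) (fun N k => hM (2 * N)%N k) hL.
move=> h; suff -> : theta (- (s * w)) p = theta_series s w / qp p p by rewrite divfK.
apply: tends_unique (fintheta_tends _ p1) _.
by apply: eq_tends h => N; rewrite fintheta_sum.
Qed.

End Base.
End FiniteForms.

(** * Partial fractions of reciprocal theta functions *)

(** Lagrange interpolation of 'X^m at the reciprocals of the [beta t]: both sides of the
    resulting polynomial identity have degree less than [#|T|] and agree at these points. *)
Lemma partial_fractions (F : fieldType) (T : finType) (beta : T -> F) (m : nat) (x : F) :
  injective beta -> (forall t, beta t != 0) -> (forall t, x * beta t != 1) ->
  (m < #|T|)%N ->
  x ^+ m / \prod_t (1 - x * beta t) =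
  \sum_t beta t ^- m / (\prod_(u | u != t) (1 - beta u / beta t)) / (1 - x * beta t).
Proof.
move=> ib b0 hx mT.
pose c t := beta t ^- m / (\prod_(u | u != t) (1 - beta u / beta t)).
pose L t : {poly F} := \prod_(u | u != t) (1 - beta u *: 'X).
have LE t y : (L t).[y] = \prod_(u | u != t) (1 - y * beta u).
  by rewrite horner_prod; apply: eq_bigr => u _; rewrite !hornerE mulrC.
have nz t u : u != t -> 1 - beta u / beta t != 0.
  move=> ut; rewrite subr_eq0 eq_sym; apply: contra ut => /eqP h.
  by apply/eqP/ib; rewrite -[RHS]mul1r -h divfK.
have sL t : (size (L t) <= #|T|)%N.
  apply: leq_trans (size_prod_leq _ _) _.
  have h : (\sum_(u | u != t) size (1 - beta u *: 'X)%R <= 2 * #|[pred u | u != t]|)%N.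
    rewrite mulnC -sum_nat_const; apply: leq_sum => u _.
    apply: leq_trans (size_polyD _ _) _; rewrite geq_max size_poly1 /= size_polyN.
    by apply: leq_trans (size_scale_leq _ _) _; rewrite size_polyX.
  have := cardC1 t; rewrite /predC1 => hc.
  have : (0 < #|T|)%N by apply/card_gt0P; exists t.
  move: h; rewrite (eq_card (B := [pred u | u != t])) // => h.
  have -> : #|(fun u => u != t)| = #|T|.-1 by rewrite -hc; apply: eq_card.
  move: h; have -> : #|[pred u | u != t]| = #|T|.-1 by rewrite -hc; apply: eq_card.
  set S := (\sum_(u | _) _)%N; move: S => S; lia.
pose P : {poly F} := 'X^m - \sum_t c t *: L t.
have P0 : P = 0.
  apply: (@roots_geq_poly_eq0 _ _ [seq (beta t)^-1 | t <- enum T]).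
  - apply/allP => _ /mapP[t _ ->]; rewrite rootE /P !hornerE horner_sum.
    rewrite (bigD1 t) //= [\sum_(i | i != t) _]big1 ?addr0; last first.
      move=> u ut; rewrite !hornerE LE (bigD1 t) 1?eq_sym //= mulVf // subrr.
      by rewrite mul0r mulr0.
    rewrite hornerZ LE exprVn.
    have -> : \prod_(u | u != t) (1 - (beta t)^-1 * beta u) =
              \prod_(u | u != t) (1 - beta u / beta t).
      by apply: eq_bigr => u _; rewrite mulrC.
    rewrite /c divfK ?subrr //; apply/prodf_neq0 => u; exact: nz.
  - by rewrite map_inj_uniq ?enum_uniq // => t u /invr_inj /ib.
  - rewrite size_map -cardE; apply: leq_trans (size_polyD _ _) _.
    rewrite geq_max size_polyXn mT size_polyN /=.
    apply: leq_trans (size_sum _ _ _) _; apply/bigmax_leqP => t _.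
    exact: leq_trans (size_scale_leq _ _) (sL t).
have nx t : 1 - x * beta t != 0 by rewrite subr_eq0 eq_sym.
have : P.[x] = 0 by rewrite P0 horner0.
rewrite /P !hornerE horner_sum => /eqP; rewrite subr_eq0 => /eqP ->.
rewrite big_distrl /=; apply: eq_bigr => t _; rewrite hornerZ LE.
rewrite [\prod_(u : T) (1 - x * beta u)](bigD1 t) //= -/(c t) invfM mulrA mulrAC; congr (_ / _).
rewrite mulfK //; apply/prodf_neq0 => u _; exact: nx.
Qed.

Section Reciprocal.
Variable R : realType.
Local Notation C := R[i].
Local Notation K := (R[i] : numFieldType).
Local Notation qp := (@qpoch K).
Variable s : C.
Hypotheses (s0 : s != 0) (s1 : nm s < 1).
Local Notation p := (s ^+ 2).

Let p0 : p != 0. Proof. by rewrite expf_neq0. Qed.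
Let p1 : nm p < 1. Proof. exact: nmX_lt1. Qed.

Lemma pochE x M : poch x p M = \prod_(k < M) (1 - x * p ^+ k).
Proof. by rewrite /poch big_mkord. Qed.

(** The analogue of [prod_shifted] at a zero of the product itself, whose vanishing factor
    is left out. *)
Lemma prod_shifted_diag (M : nat) (J : 'I_M) :
  \prod_(k < M | k != J) (1 - p ^+ k / p ^+ J) =
  (- 1) ^+ J * s ^- (J * J.+1) * poch p p J * poch p p (M.-1 - J).
Proof.
have JM := ltn_ord J.
rewrite (eq_bigl (fun k : 'I_M => (k : nat) != J)) //.
rewrite -(big_mkord (fun k => k != J) (fun k => 1 - p ^+ k / p ^+ J)).
rewrite (@big_cat_nat _ _ _ J) //= ?(ltnW JM) //.
rewrite (@big_ltn_cond _ _ _ J M) // eqxx /=; congr (_ * _).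
  have := poch_reflect s0 s1 J (oner_neq0 C); rewrite divr1 => <-.
  rewrite /poch [LHS]big_nat_cond [RHS]big_nat_cond.
  apply: eq_big => [k|k _]; first by case: ltngtP; rewrite /= ?andbF ?andbT.
  by rewrite mul1r mulrC.
rewrite -[in LHS](addn0 J.+1) -{1}(add0n J.+1) addn0.
have -> : (M.-1 - J = M - J.+1)%N by lia.
rewrite big_addn /poch [LHS]big_nat_cond [RHS]big_nat_cond.
apply: eq_big => [k|k _].
  rewrite andbT; apply: andb_idr => _.
  by lia.
rewrite addnS -addSn exprD mulfK ?expf_neq0 // exprS.
by [].
Qed.

Section Factors.
Variables (r : nat) (b : 'I_r -> C).
Hypothesis (b0 : forall i, b i != 0).
Hypothesis hb : forall i k, i != k -> forall n : int, b k / b i * p ^ n != 1.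

(** The reciprocals of the zeros of [fintheta (x * b i) p N] as a function of [x]. *)
Definition node (N : nat) (i : 'I_r) (J : nat) : C := b i / p ^+ N * p ^+ J.

(** The part of a partial fraction coefficient that converges as [N] grows; the remaining
    powers of [s] and of the [b k] are the numerators of an Appell-Lerch sum. *)
Definition pf_coef (i : 'I_r) (N J : nat) : C :=
  (poch p p J * poch p p ((2 * N).-1 - J) *
   \prod_(k < r | k != i) (poch (p / (b k / b i)) p J * poch (b k / b i) p (2 * N - J)))^-1.

Lemma nodeE N i J : node N i J = b i * p ^ (J%:Z - N%:Z).
Proof. by rewrite /node expfzDr // -exprnN -mulrA [p ^- N * _]mulrC. Qed.

(** [partial_fractions] for the [r * (2 * N)] nodes.  The numerator x^(rN) there makes up
    for the power of [x] by which [fintheta] differs from a product of [2 * N] consecutive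
    factors, see [fintheta_poch]. *)
Lemma fintheta_partial_fractions x N : x != 0 -> (0 < r)%N -> (0 < N)%N ->
  (forall i (n : int), x * b i * p ^ n != 1) ->
  \prod_i (fintheta (x * b i) p N)^-1 =
  \sum_i \sum_(J < 2 * N) pf_coef i N J *
    lamT (s ^+ r) ((- s) ^+ r * \prod_(k < r | k != i) (b i / b k)) (x * b i) p
      (J%:Z - N%:Z).
Proof.
move=> x0 r0 N0 hx.
have xb0 i : x * b i != 0 by rewrite mulf_neq0.
pose beta (t : 'I_r * 'I_(2 * N)) := node N t.1 t.2.
have bb0 t : beta t != 0 by rewrite /beta nodeE mulf_neq0 // expfz_neq0.
have ib : injective beta.
  move=> [i J] [k L]; rewrite /beta !nodeE /= => h.
  have [ik|ik] := eqVneq i k.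
    rewrite {}ik in h *; congr (_, _); apply/val_inj => /=; apply/eqP.
    have {h} h := mulfI (b0 k) h.
    have E (u v : nat) : p ^ (u%:Z - N%:Z) = p ^ (v%:Z - N%:Z) -> (u <= v)%N -> u = v.
      move=> /eqP; rewrite -(subr_eq0) => h1 uv; apply/eqP.
      apply: contraLR h1 => nuv; have {nuv}uv : (u < v)%N by rewrite ltn_neqAle nuv.
      have -> : p ^ (v%:Z - N%:Z) = p ^ (u%:Z - N%:Z) * p ^+ (v - u).
        by rewrite [p ^+ (v - u)]exprnP -expfzDr //; congr (_ ^ _); lia.
      rewrite -[X in X - _]mulr1 -mulrBr mulf_neq0 ?expfz_neq0 //.
      by rewrite subr_eq0 eq_sym expf_neq1 // subn_gt0.
    by case: (leqP J L) => [/(E _ _ h)->//|/ltnW /(E _ _ (esym h))->].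
  have := hb ik (L%:Z - J%:Z); case/negP; apply/eqP.
  have -> : L%:Z - J%:Z = (L%:Z - N%:Z) - (J%:Z - N%:Z) by ring.
  rewrite expfzDr // -invr_expz.
  have -> : b k / b i * (p ^ (L%:Z - N%:Z) * (p ^ (J%:Z - N%:Z))^-1) =
    (b k * p ^ (L%:Z - N%:Z)) / (b i * p ^ (J%:Z - N%:Z)).
    by field; rewrite b0 expfz_neq0.
  by rewrite -h divff // mulf_neq0 // expfz_neq0.
have bx t : x * beta t != 1 by rewrite /beta nodeE mulrA.
have cT : #|{: 'I_r * 'I_(2 * N)}| = (r * (2 * N))%N by rewrite card_prod !card_ord.
have := @partial_fractions _ _ beta (r * N) x ib bb0 bx.
rewrite cT => /(_ ltac:(by rewrite ltn_pmul2l //; lia)) pf.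
(* [A] collects the prefactors in [fintheta_poch] other than powers of [x] *)
pose A := \prod_i ((- b i) ^+ N * s ^- (N * N.+1)).
have -> : \prod_i (fintheta (x * b i) p N)^-1 =
          A * (x ^+ (r * N) / \prod_t (1 - x * beta t)).
  have -> : \prod_t (1 - x * beta t) = \prod_i poch (x * b i / p ^+ N) p (2 * N).
    rewrite -(pair_bigA _ (fun i (J : 'I_(2 * N)) => 1 - x * beta (i, J))) /=.
    apply: eq_bigr => i _; rewrite pochE; apply: eq_bigr => J _.
    by rewrite /beta /node !mulrA.
  have -> : x ^+ (r * N) = \prod_(i < r) x ^+ N.
    by rewrite prodr_const card_ord -exprM mulnC.
  rewrite /A -prodf_div -big_split /=; apply: eq_bigr => i _.
  rewrite fintheta_poch // !invfM !invrK mulrA; congr (_ / _).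
  by rewrite -mulrN exprMn; ring.
rewrite pf big_distrr /= -(pair_bigA _ (fun i (J : 'I_(2 * N)) =>
   A * (beta (i, J) ^- (r * N) /
     \prod_(u | u != (i, J)) (1 - beta u / beta (i, J)) / (1 - x * beta (i, J))))) /=.
apply: eq_bigr => i _; apply: eq_bigr => J _.
rewrite /lamT mulrA [in RHS]mulrA.
have -> : x * beta (i, J) = x * b i * p ^ (J%:Z - N%:Z) by rewrite /beta nodeE mulrA.
congr (_ / _).
have b'0 u v : b u / b v != 0 by rewrite mulf_neq0 ?invr_eq0.
pose e k := (- (b k / b i)) ^+ J * s ^- (J * J.+1).
have -> : \prod_(u | u != (i, J)) (1 - beta u / beta (i, J)) =
          \prod_k e k * (pf_coef i N J)^-1.
  rewrite /pf_coef invrK.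
  rewrite (eq_bigl (fun u : 'I_r * 'I_(2 * N) => true && ((u.1 != i) || (u.2 != J)))); last first.
    by move=> [k L] /=; rewrite xpair_eqE negb_and.
  rewrite -(pair_big_dep xpredT (fun k (L : 'I_(2 * N)) => (k != i) || (L != J))
     (fun k L => 1 - beta (k, L) / beta (i, J))) /=.
  have q L k : beta (k, L) / beta (i, J) = b k / b i * (p ^+ L / p ^+ J).
    by rewrite /beta /node /=; field; rewrite b0 !expf_neq0.
  rewrite (bigD1 i) //= [in RHS](bigD1 i) //=.
  rewrite (eq_bigl (fun L : 'I_(2 * N) => L != J)); last by move=> L; rewrite eqxx.
  rewrite (eq_bigr (fun L : 'I_(2 * N) => 1 - p ^+ L / p ^+ J)); last first.
    by move=> L _; rewrite q divff // mul1r.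
  rewrite prod_shifted_diag.
  have -> : \prod_(k < r | k != i) \prod_(L < 2 * N | (k != i) || (L != J))
       (1 - beta (k, L) / beta (i, J)) =
     \prod_(k < r | k != i) e k * \prod_(k < r | k != i)
        (poch (p / (b k / b i)) p J * poch (b k / b i) p (2 * N - J)).
    rewrite -big_split /=; apply: eq_bigr => k ki.
    have := prod_shifted s0 s1 (b'0 k i) (ltnW (ltn_ord J)); rewrite pochE mulrA /e => <-.
    by apply: eq_big => [L|L _]; rewrite ?ki // q; congr (1 - _); ring.
  rewrite /e divff //; ring.
rewrite invfM invrK.
have -> : A * (beta (i, J) ^- (r * N) * ((\prod_k e k)^-1 * pf_coef i N J)) =
  pf_coef i N J * (A * (beta (i, J) ^- (r * N)) * (\prod_k e k)^-1) by ring.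
congr (_ * _).
have -> : beta (i, J) ^- (r * N) = \prod_(k < r) beta (i, J) ^- N.
  by rewrite prodr_const card_ord -exprVn -exprVn -exprM (mulnC r N).
set n := J%:Z - N%:Z.
have -> : (s ^+ r) ^ (n * n) = \prod_(k < r) s ^ (n * n).
  by rewrite prodr_const card_ord !exprnP !exprz_exp mulrC.
have -> : ((- s) ^+ r * \prod_(k < r | k != i) (b i / b k)) ^ n =
          \prod_(k < r) ((- s) ^ n * (b i / b k) ^ n).
  have E : ((- s) ^+ r) ^ n = \prod_(k < r) (- s) ^ n.
    by rewrite prodr_const card_ord !exprnP !exprz_exp mulrC.
  rewrite expfzMl [RHS]big_split /= E.
  congr (_ * _); rewrite [RHS](bigD1 i) //= divff // exp1rz mul1r.
  exact: (big_morph (fun z => z ^ n) (fun u v => expfzMl u v n) (exp1rz _ n)).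
rewrite -prodfV /A -!big_split /=; apply: eq_bigr => k _.
rewrite /e /beta nodeE /= -/n.
have -> : s ^ (n * n) =
    s ^+ (J * J.+1) / s ^+ (N * N.+1) * (p ^ n) ^- N * s ^ (- n).
  rewrite !exprnN [s ^+ (J * J.+1)]exprnP [s ^+ 2]exprnP !exprz_exp -!expfzDr //.
  by congr (_ ^ _); rewrite /n; lia.
have -> : (- s) ^ n * (b i / b k) ^ n =
    s ^ n * ((- 1) ^+ N * ((- 1) ^+ J)^-1) * ((b i / b k) ^+ J / (b i / b k) ^+ N).
  have -> : (- s) ^ n = s ^ n * (- 1) ^ n by rewrite -[- s]mulN1r expfzMl mulrC.
  have -> : (b i / b k) ^ n = (b i / b k) ^+ J / (b i / b k) ^+ N.
    by rewrite /n expfzDr // -exprnN.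
  have -> : (- 1) ^ n = (- 1) ^+ N * ((- 1) ^+ J)^-1 :> C.
    by rewrite /n expfzDr ?oppr_eq0 ?oner_neq0 // -exprnN -exprnP !invr_sign mulrC.
  by [].
rewrite -invr_expz (exprNn (b k)) (exprNn (b k / b i)) !exprMn !exprVn.
have := expf_neq0 N (b0 i); have := expf_neq0 N (b0 k).
have := expf_neq0 J (b0 i); have := expf_neq0 J (b0 k).
have := expfz_neq0 n s0; have := expf_neq0 N (expfz_neq0 n p0).
have := expf_neq0 (J * J.+1) s0; have := expf_neq0 (N * N.+1) s0.
have := signr_eq0 C J.
move: (b i ^+ N) (b k ^+ N) (b i ^+ J) (b k ^+ J) (s ^ n) ((p ^ n) ^+ N).
move: (s ^+ (J * J.+1)) (s ^+ (N * N.+1)) ((- 1) ^+ J) ((-1) ^+ N).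
move=> c1 c2 c3 c4 c5 c6 c7 c8 c9 c10 h3 h2 h1 h10 h9 h8 h7 h6 h5.
field.
by rewrite h1 h2 h3 h10 h9 h8 h7 h6 h5.
Qed.

(** The limit of [fintheta_partial_fractions]: a Mittag-Leffler expansion of a product of
    reciprocals of theta functions, in which each factor contributes one Appell-Lerch sum. *)
Lemma recip_theta x : x != 0 -> (0 < r)%N ->
  (forall i (n : int), x * b i * p ^ n != 1) ->
  \prod_i (theta (x * b i) p)^-1 =
  \sum_i (qp p p ^+ 2 * \prod_(k < r | k != i) theta (b k / b i) p)^-1 *
    lam (s ^+ r) ((- s) ^+ r * \prod_(k < r | k != i) (b i / b k)) (x * b i) p.
Proof.
move=> x0 r0 hx.
have xb0 i : x * b i != 0 by rewrite mulf_neq0.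
have th0 i : theta (x * b i) p != 0 by apply: theta_neq0.
have L1 : tends (fun N => \prod_i (fintheta (x * b i) p N)^-1)
   (\prod_i (theta (x * b i) p)^-1).
  by apply: tends_prod => i _; apply: tendsV; last exact: fintheta_tends.
have sr1 : nm (s ^+ r) < 1 by exact: nmX_lt1.
have J0 : qp p p != 0 := qpoch_pp_neq0 p1.
have y1 i k : k != i -> forall m, b k / b i * p ^+ m != 1.
  by move=> ki m; rewrite exprnP; apply: hb; rewrite eq_sym.
have y2 i k : k != i -> forall m, p / (b k / b i) * p ^+ m != 1.
  move=> ki m; have -> : p / (b k / b i) * p ^+ m = b i / b k * p ^ (m.+1)%:Z.
    by rewrite -exprnP [p ^+ m.+1]exprS; field; rewrite !b0.
  exact: hb.
suff L2 i : tends (fun N => \sum_(J < 2 * N) pf_coef i N J *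
    lamT (s ^+ r) ((- s) ^+ r * \prod_(k < r | k != i) (b i / b k)) (x * b i) p
      (J%:Z - N%:Z))
   ((qp p p ^+ 2 * \prod_(k < r | k != i) theta (b k / b i) p)^-1 *
    lam (s ^+ r) ((- s) ^+ r * \prod_(k < r | k != i) (b i / b k)) (x * b i) p).
  have := tends_sum (index_enum 'I_r) (P := xpredT) (fun i _ => L2 i).
  move=> L3; apply: tends_unique L1 _; apply: (@tends_shift _ _ _ 1).
  have L4 := tends_comp (f := fun n => (1 + n)%N) _ L3.
  apply: eq_tends (L4 _) => [N|N]; first by rewrite fintheta_partial_fractions.
  by exists N => m; lia.
have [B B0 hB] := poch_inv_bounded p1 (pp_neq1 p1).
have /choice[D hD] : forall k, exists M, 0 < M /\ (k != i -> forall N J,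
   nm (poch (p / (b k / b i)) p J * poch (b k / b i) p (2 * N - J))^-1 <= M).
  move=> k; have [ki|ki] := boolP (k != i); last by exists 1.
  have [M1 M10 h1] := poch_inv_bounded p1 (y1 _ _ ki).
  have [M2 M20 h2] := poch_inv_bounded p1 (y2 _ _ ki).
  exists (M2 * M1); split; first exact: mulr_gt0.
  by move=> _ N J; rewrite invfM nmM ler_pM ?nm_ge0.
pose M := B * B * \prod_(k < r | k != i) D k.
have hM N J : nm (pf_coef i N J) <= M.
  rewrite /pf_coef invfM nmM /M ler_pM ?nm_ge0 //.
    by rewrite invfM nmM ler_pM ?nm_ge0.
  rewrite -[X in nm X]prodfV nm_prod; apply: ler_prod => k ki.
  by rewrite nm_ge0 /=; have [_ ->] := hD k.
have hL (n : int) : tends (fun N => pf_coef i N (absz (N%:Z + n)%R))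
   (qp p p ^+ 2 * \prod_(k < r | k != i) theta (b k / b i) p)^-1.
  rewrite /pf_coef; apply: tendsV.
    rewrite mulf_neq0 ?expf_neq0 //; apply/prodf_neq0 => k ki.
    apply: theta_neq0 => //; first by rewrite mulf_neq0 // invr_eq0.
    by apply: hb; rewrite eq_sym.
  have P1 a : tends (fun N => poch a p (absz (N%:Z + n)%R)) (qp a p).
    apply: (tends_comp (u := poch a p)) (poch_tends a p1) => N.
    by have [m hm] := abs_shift_ge n N; exists m.
  have P2 a c : tends (fun N => poch a p (2 * N - c - absz (N%:Z + n)%R)) (qp a p).
    apply: (tends_comp (u := poch a p)) (poch_tends a p1) => N.
    by have [m hm] := abs_shift_sub n c N; exists m.
  apply: tendsM.
    by rewrite expr2; apply: tendsM (P1 p) _; apply: eq_tends (P2 p 1%N) => N; rewrite subn1.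
  apply: tends_prod => k _; rewrite /theta [X in tends _ X]mulrC.
  apply: tendsM (P1 (p / (b k / b i))) _.
  by apply: eq_tends (P2 (b k / b i) 0%N) => N; rewrite subn0.
have := window_sum 0 (asum_lam _ _ sr1 p0 p1) (lamP _ _ sr1 p0 p1) hM hL.
move=> h; rewrite [X in tends _ X]mulrC.
apply: eq_tends (h _ _) => N; rewrite addn0.
by apply: eq_bigr => J _; rewrite mulrC.
Qed.

End Factors.
End Reciprocal.

(** * Weierstrass' relation and the quintuple product *)

Lemma thetaE (R : realType) (x p : R[i]) :
  theta x p = @qpoch (R[i] : numFieldType) x p * @qpoch (R[i] : numFieldType) (p / x) p.
Proof. by []. Qed.

#[local] Opaque theta_series lam csum poch qpoch theta.

Section ThetaProducts.
Variable R : realType.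
Local Notation C := R[i].
Local Notation K := (R[i] : numFieldType).
Local Notation qp := (@qpoch K).
Variable s : C.
Hypotheses (s0 : s != 0) (s1 : nm s < 1).
Local Notation p := (s ^+ 2).

Let p0 : p != 0. Proof. by rewrite expf_neq0. Qed.
Let p1 : nm p < 1. Proof. exact: nmX_lt1. Qed.

Definition theta_series_term (t1 t2 a b : C) (mn : int * int) : C :=
  (t1 ^ (mn.1 * mn.1) * a ^ mn.1) * (t2 ^ (mn.2 * mn.2) * b ^ mn.2).

Lemma theta_seriesM (t1 t2 : C) a b : nm t1 < 1 -> nm t2 < 1 ->
  has_sum (theta_series_term t1 t2 a b) (theta_series t1 a * theta_series t2 b).
Proof.
move=> h1 h2.
exact: has_sum_prod (asum_gauss a h1) (asum_gauss b h2) (theta_seriesP a h1) (theta_seriesP b h2).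
Qed.

(** Pairs (m, n) according to the parity of m + n. *)
Definition sum_diff (t : 'I_2 * (int * int)) : int * int :=
  (t.2.1 + t.2.2 + t.1%:Z, t.2.1 - t.2.2).

Lemma sum_diff_bij : bijective sum_diff.
Proof.
have [g gh hg] := divz_split_bij 1 0.
exists (fun mn : int * int => let rM := g (mn.1 + mn.2) in (rM.1, (rM.2, rM.2 - mn.2))).
  move=> [r [M N]]; rewrite /sum_diff /=.
  have -> : M + N + r%:Z + (M - N) = (fun jm : 'I_2 * int => jm.2 * 2 + (jm.1%:Z - 0)) (r, M).
    by rewrite /=; ring.
  by rewrite gh /= subKr.
move=> [m n]; rewrite /sum_diff /=; have := hg (m + n); case: (g (m + n)) => r M /= h.
by congr (_, _); [rewrite -[m](addrK n) -h; ring | ring].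
Qed.

(** Pairs (m, n) according to the residue of m + 2n modulo 3. *)
Definition sum_twice (t : 'I_3 * (int * int)) : int * int :=
  (t.2.1 + t.1%:Z - 2 * t.2.2, t.2.1 + t.2.2).

Lemma sum_twice_bij : bijective sum_twice.
Proof.
have [g gh hg] := divz_split_bij 2 0.
exists (fun mn : int * int =>
  let rM := g (mn.1 + 2 * mn.2) in (rM.1, (rM.2, mn.2 - rM.2))).
  move=> [r [M N]]; rewrite /sum_twice /=.
  have -> : M + r%:Z - 2 * N + 2 * (M + N) =
            (fun jm : 'I_3 * int => jm.2 * 3 + (jm.1%:Z - 0)) (r, M).
    by rewrite /=; ring.
  rewrite gh /=; congr (_, (_, _)); ring.
move=> [m n]; rewrite /sum_twice /=; have := hg (m + 2 * n); case: (g _) => r M /= h.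
by congr (_, _); [rewrite -[m](addrK (2 * n)) -h; ring | ring].
Qed.

(** In the coordinates [sum_diff] the form m^2 + n^2 becomes 2 M^2 + 2 N^2 up to linear
    terms, so the double series is again a product in each of the two parity classes. *)
Lemma theta_series_bilinear t a b : t = p -> a != 0 -> b != 0 ->
  theta_series s a * theta_series s b =
  theta_series t (a * b) * theta_series t (a / b) +
  s * a * (theta_series t (t * (a * b)) * theta_series t (t * (a / b))).
Proof.
move=> tE a0 b0.
have t1 : nm t < 1 by rewrite tE.
have t0 : t != 0 by rewrite tE.
have tz e : t ^ e = s ^ (2 * e) by rewrite tE [p]exprnP exprz_exp.
pose G (r : 'I_2) := s ^ r%:Z * a ^ r%:Z *
  (theta_series t (t ^ r%:Z * (a * b)) * theta_series t (t ^ r%:Z * (a / b))).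
have h r : has_sum (fun MN => theta_series_term s s a b (sum_diff (r, MN))) (G r).
  apply: eq_has_sum (has_sumZ _ (theta_seriesM _ _ t1 t1)) => -[M N].
  rewrite /sum_diff /theta_series_term /=.
  have sE : s ^ ((M + N + r%:Z) * (M + N + r%:Z)) * s ^ ((M - N) * (M - N)) =
    s ^ r%:Z * (t ^ (M * M) * t ^ (r%:Z * M)) * (t ^ (N * N) * t ^ (r%:Z * N)).
    rewrite !tz -!expfzDr //; congr (_ ^ _).
    by case: r => [[|[|]]] //= _; ring.
  have -> : (t ^ r%:Z * (a * b)) ^ M = t ^ (r%:Z * M) * (a ^ M * b ^ M).
    by rewrite !expfzMl exprz_exp.
  have -> : (t ^ r%:Z * (a / b)) ^ N = t ^ (r%:Z * N) * (a ^ N * b ^ (- N)).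
    by rewrite !expfzMl exprz_exp exprz_inv.
  rewrite !(expfzDr _ _ a0) (expfzDr _ _ b0).
  have E u1 u2 v1 v2 v3 w1 w2 : u1 * (v1 * v2 * v3) * (u2 * (w1 * w2)) =
     u1 * u2 * (v1 * v2 * v3) * (w1 * w2) :> C by ring.
  rewrite E sE; move: (s ^ r%:Z) (t ^ (M * M)) (t ^ (N * N)) => u1 u2 u3.
  by move: (t ^ (r%:Z * M)) (t ^ (r%:Z * N)) => u4 u5; ring.
have X1 := has_sum_partition sum_diff_bij (theta_seriesM a b s1 s1).
apply: etrans (X1 _ h) _.
by rewrite big_ord_recl big_ord1 /G /= !expr0z !expr1z !mul1r.
Qed.

Definition wphi x : C := theta_series p (x ^+ 2 / p) / x.
Definition wgam x : C := theta_series p (x ^+ 2).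

(** By [theta_series_bilinear], a product of two theta functions is an alternating bilinear form
    of rank two in the vectors ([wphi], [wgam]) at [x] and at [y]. *)
Lemma theta_pair x y : x != 0 -> y != 0 ->
  theta (x * y) p * theta (x / y) p * qp p p ^+ 2 =
  x * (wphi x * wgam y - wgam x * wphi y).
Proof.
move=> x0 y0.
have JT z : z != 0 -> theta z p * qp p p = theta_series s (- z / s).
  move=> z0; have w0 : - z / s != 0 by rewrite mulf_neq0 ?invr_eq0 ?oppr_eq0.
  rewrite (jacobi_triple s0 s1 w0).
  have -> : - (s * (- z / s)) = z by field.
  by [].
have xy0 : x * y != 0 by rewrite mulf_neq0.
have xV0 : x / y != 0 by rewrite mulf_neq0 ?invr_eq0.
transitivity (theta_series s (- (x * y) / s) * theta_series s (- (x / y) / s)).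
  rewrite -(JT _ xy0) -(JT _ xV0).
  by move: (theta _ _) (theta _ _) (qp _ _) => u v w; ring.
have a0 : - (x * y) / s != 0 by rewrite mulf_neq0 ?invr_eq0 ?oppr_eq0.
have b0 : - (x / y) / s != 0 by rewrite mulf_neq0 ?invr_eq0 ?oppr_eq0.
apply: (etrans (theta_series_bilinear (erefl p) a0 b0)).
have -> : - (x * y) / s * (- (x / y) / s) = x ^+ 2 / p by field; rewrite s0 y0.
have -> : - (x * y) / s / (- (x / y) / s) = y ^+ 2 by field; rewrite s0 y0 x0.
have -> : p * (x ^+ 2 / p) = x ^+ 2 by field.
have hy : y ^+ 2 / p != 0 by rewrite mulf_neq0 ?invr_eq0 ?expf_neq0.
have E := theta_series_shift p0 p1 hy.
have E1 : p * (y ^+ 2 / p) = y ^+ 2 by field.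
have E2 : p ^+ 2 * (y ^+ 2 / p) = p * y ^+ 2 by field.
rewrite E1 E2 in E.
rewrite /wphi /wgam E.
move: (theta_series _ _) (theta_series _ _) (theta_series _ _) (theta_series _ _) => u1 u2 u3 u4.
by field; rewrite s0 x0 y0.
Qed.

(** By [theta_pair], this is the Pluecker relation between the 2 x 2 minors of the matrix
    whose columns are the vectors ([wphi], [wgam]) at [x], [y], [u], [v]. *)
Lemma weierstrass x y u v : x != 0 -> y != 0 -> u != 0 -> v != 0 ->
  y / u * (theta (x * y) p * theta (x / y) p * (theta (u * v) p * theta (u / v) p)) =
  theta (x * u) p * theta (x / u) p * (theta (y * v) p * theta (y / v) p) -
  theta (x * v) p * theta (x / v) p * (theta (y * u) p * theta (y / u) p).
Proof.
move=> x0 y0 u0 v0; have J0 : qp p p ^+ 4 != 0 by rewrite expf_neq0 // qpoch_pp_neq0.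
apply: (mulIf J0).
have P a b : a != 0 -> b != 0 ->
  theta (a * b) p * theta (a / b) p = a * (wphi a * wgam b - wgam a * wphi b) / qp p p ^+ 2.
  move=> a0 b0; rewrite -theta_pair // mulfK //.
  by rewrite expf_neq0 // qpoch_pp_neq0.
move: (P _ _ x0 y0) (P _ _ u0 v0) (P _ _ x0 u0) (P _ _ y0 v0) (P _ _ x0 v0) (P _ _ y0 u0).
move: (theta (x * y) p) (theta (x / y) p) (theta (u * v) p) (theta (u / v) p).
move: (theta (x * u) p) (theta (x / u) p) (theta (y * v) p) (theta (y / v) p).
move: (theta (x * v) p) (theta (x / v) p) (theta (y * u) p) (theta (y / u) p).
move=> t1 t2 t3 t4 t5 t6 t7 t8 t9 t10 t11 t12.
have := qpoch_pp_neq0 p1; move: (qp p p) => J hJ.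
move: (wphi x) (wphi y) (wphi u) (wphi v) (wgam x) (wgam y) (wgam u) (wgam v).
move=> a1 a2 a3 a4 a5 a6 a7 a8 -> -> -> -> -> ->.
by field; rewrite u0 hJ.
Qed.

End ThetaProducts.

Section Quintuple.
Variable R : realType.
Local Notation C := R[i].
Local Notation K := (R[i] : numFieldType).
Local Notation qp := (@qpoch K).
Implicit Types (s x : C).

(** Euler's pentagonal number theorem: by the triple product at base s^6, the series is the
    product of the three residue classes modulo 3 of the factors of [qp (s ^+ 2) (s ^+ 2)]. *)
Lemma pentagonal s : s != 0 -> nm s < 1 -> theta_series (s ^+ 3) (- s) = qp (s ^+ 2) (s ^+ 2).
Proof.
move=> s0 s1.
have p1 : nm (s ^+ 2) < 1 by exact: nmX_lt1.
have s30 : s ^+ 3 != 0 by rewrite expf_neq0.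
have s31 : nm (s ^+ 3) < 1 by exact: nmX_lt1.
have sN0 : - s != 0 by rewrite oppr_eq0.
rewrite (jacobi_triple s30 s31 sN0) (qpoch_dissect (s ^+ 2) p1 (isT : 0 < 3)%N).
rewrite !big_ord_recl big_ord0 thetaE /= /bump /=.
have -> : - (s ^+ 3 * - s) = s ^+ 4 by ring.
have -> : (s ^+ 3) ^+ 2 = s ^+ 6 by rewrite -exprM.
have -> : (s ^+ 2) ^+ 3 = s ^+ 6 by rewrite -exprM.
have -> : s ^+ 6 / s ^+ 4 = s ^+ 2 by field.
have -> : s ^+ 2 * (s ^+ 2) ^+ 0 = s ^+ 2 by rewrite expr0 mulr1.
have -> : s ^+ 2 * (s ^+ 2) ^+ 1 = s ^+ 4 by ring.
have -> : s ^+ 2 * (s ^+ 2) ^+ (1 + 1) = s ^+ 6 by ring.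
by move: (qp (s ^+ 2) _) (qp (s ^+ 4) _) (qp (s ^+ 6) _) => a b c; ring.
Qed.

(** The term of index n is the opposite of the term of index - 1 - n. *)
Lemma theta_series_neg s : s != 0 -> nm s < 1 -> theta_series s (- s) = 0.
Proof.
move=> s0 s1.
have h : theta_series s (- s) = - theta_series s (- s).
  rewrite -{1}(theta_series_inv _ s1) theta_series_shift ?invr_eq0 ?oppr_eq0 //.
  have -> : s * (- s)^-1 = -1 by field.
  have -> : s ^+ 2 * (- s)^-1 = - s by field.
  by rewrite mulN1r.
apply/eqP; move/eqP: h; rewrite -addr_eq0 -mulr2n mulrn_eq0 //.
Qed.

(** The quintuple product identity.  By the triple product, [theta_series s (x / s)] and
    [theta_series (s ^+ 2) (- x ^+ 2)] supply the factors by which theta of x^2 differs from theta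
    of x.  In the coordinates [sum_twice] the form m^2 + 2 n^2 becomes 3 M^2 + 6 k^2, so
    each residue class is a product of two theta series.  The series in k is Euler's product
    for the residues 0 and 1, and vanishes by [theta_series_neg] for the residue 2. *)
Lemma quintuple s x : s != 0 -> nm s < 1 -> x != 0 ->
  qp (s ^+ 2) (s ^+ 2) * theta (x ^+ 2) (s ^+ 2) =
  theta x (s ^+ 2) * (theta_series (s ^+ 3) (- x ^+ 3 / s) + x * theta_series (s ^+ 3) (- (s * x
      ^+ 3))).
Proof.
move=> s0 s1 x0.
have p1 : nm (s ^+ 2) < 1 by exact: nmX_lt1.
have p0 : s ^+ 2 != 0 by rewrite expf_neq0.
have s31 : nm (s ^+ 3) < 1 by exact: nmX_lt1.
have s61 : nm (s ^+ 6) < 1 by exact: nmX_lt1.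
have s60 : s ^+ 6 != 0 by rewrite expf_neq0.
have xs0 : x / s != 0 by rewrite mulf_neq0 ?invr_eq0.
have x20 : - x ^+ 2 != 0 by rewrite oppr_eq0 expf_neq0.
have pz k e : (s ^+ k) ^ e = s ^ (k%:Z * e) by rewrite [s ^+ k]exprnP exprz_exp.
pose z := (x / s) * - x ^+ 2; pose y := - x ^+ 2 * (x / s) ^ (- 2).
pose G (r : 'I_3) := s ^ (r%:Z * r%:Z) * (x / s) ^ r%:Z *
    (theta_series (s ^+ 3) (s ^ (2 * r%:Z) * z) * theta_series (s ^+ 6) (s ^ (- 4 * r%:Z) * y)).
have h r : has_sum (fun Mk => theta_series_term s (s ^+ 2) (x / s) (- x ^+ 2) (sum_twice (r,
    Mk))) (G r).
  apply: eq_has_sum (has_sumZ _ (theta_seriesM _ _ s31 s61)) => -[M k].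
  rewrite /sum_twice /theta_series_term /fst /snd.
  rewrite (expfzMl _ z) (exprz_exp s) (expfzMl _ y) (exprz_exp s).
  rewrite /z /y (expfzMl (x / s) (- x ^+ 2) M) (expfzMl (- x ^+ 2) _ k).
  rewrite (exprz_exp (x / s)) !pz.
  have sE : s ^ ((M + r%:Z - 2 * k) * (M + r%:Z - 2 * k)) * s ^ (2%:Z * ((M + k) * (M + k))) =
    s ^ (r%:Z * r%:Z) * (s ^ (3%:Z * (M * M)) * s ^ (2 * r%:Z * M)) *
      (s ^ (6%:Z * (k * k)) * s ^ (- 4 * r%:Z * k)).
    by rewrite -!expfzDr //; congr (_ ^ _); ring.
  have xE : (x / s) ^ (M + r%:Z - 2 * k) = (x / s) ^ M * (x / s) ^ r%:Z * (x / s) ^ (- 2 * k).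
    by rewrite -!expfzDr //; congr (_ ^ _); ring.
  rewrite xE (expfzDr _ _ x20).
  move: sE.
  move: (s ^ ((M + r%:Z - 2 * k) * (M + r%:Z - 2 * k))) (s ^ (2%:Z * ((M + k) * (M + k)))).
  move: (s ^ (r%:Z * r%:Z)) (s ^ (3%:Z * (M * M))) (s ^ (2 * r%:Z * M)).
  move: (s ^ (6%:Z * (k * k))) (s ^ (- 4 * r%:Z * k)) => u1 u2 u3 u4 u5 u6 u7 sE.
  move: ((x / s) ^ M) ((x / s) ^ r%:Z) ((x / s) ^ (-2 * k)) => v1 v2 v3.
  move: ((- x ^+ 2) ^ M) ((- x ^+ 2) ^ k) => w1 w2.
  transitivity (u6 * u7 * (v1 * v2 * v3 * w1 * w2)); first by rewrite sE; ring.
  ring.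
have yE : y = - s ^+ 2.
  by rewrite /y -exprz_inv invf_div -exprnP; field.
have zE : z = - x ^+ 3 / s by rewrite /z; field.
have := has_sum_partition (g := G) sum_twice_bij (theta_seriesM (x / s) (- x ^+ 2) s1 p1) h.
rewrite !big_ord_recl big_ord0 /G /bump yE zE /=.
have p40 : (s ^+ 2) ^+ 2 = s ^+ 4 by rewrite -exprM.
have cE : theta_series (s ^+ 6) (- s ^+ 2) = qp (s ^+ 4) (s ^+ 4).
  by rewrite -p40 -(pentagonal p0 p1) -exprM.
have -> : s ^ (0%:Z * 0%:Z) * (x / s) ^ 0%:Z = 1 by rewrite mulr0 !expr0z mulr1.
have -> : s ^ (2 * 0%:Z) * (- x ^+ 3 / s) = - x ^+ 3 / s by rewrite mulr0 expr0z mul1r.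
have -> : s ^ (- 4 * 0%:Z) * - s ^+ 2 = - s ^+ 2 by rewrite mulr0 expr0z mul1r.
have -> : s ^ ((1 + 0)%N%:Z * (1 + 0)%N%:Z) * (x / s) ^ (1 + 0)%N%:Z = x.
  by rewrite !expr1z; field.
have -> : s ^ (2 * (1 + 0)%N%:Z) * (- x ^+ 3 / s) = - (s * x ^+ 3).
  by rewrite mulr1 -exprnP; field.
have -> : s ^ (- 4 * (1 + 0)%N%:Z) * - s ^+ 2 = (- s ^+ 2)^-1.
  by rewrite mulr1 -[- 4]/(- (4%N%:Z)) -exprnN; field.
have -> : s ^ (- 4 * (1 + (1 + 0))%N%:Z) * - s ^+ 2 = (- s ^+ 6)^-1.
  by rewrite -[- 4 * _]/(- (8%N%:Z)) -exprnN; field.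
rewrite (theta_series_inv (- s ^+ 2) s61) (theta_series_inv (- s ^+ 6) s61) cE (theta_series_neg
    s60 s61).
rewrite (jacobi_triple s0 s1 xs0) (jacobi_triple p0 p1 x20).
have -> : - (s * (x / s)) = - x by field.
have -> : - (s ^+ 2 * - x ^+ 2) = x ^+ 2 * s ^+ 2 by ring.
have x2 : x ^+ 2 != 0 by rewrite expf_neq0.
have D : theta (x ^+ 2) (s ^+ 2) =
    theta x (s ^+ 2) * theta (- x) (s ^+ 2) * theta (x ^+ 2 * s ^+ 2) (s ^+ 4).
  rewrite (theta_dissect p0 p1 x2 (isT : 0 < 2)%N) big_ord_recl big_ord1 /= /bump /=.
  by rewrite expr0 mulr1 (theta_sqr p1) expr1 p40.
rewrite D p40.
have : qp (s ^+ 4) (s ^+ 4) != 0 by apply: qpoch_pp_neq0; exact: nmX_lt1.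
move: (qp (s ^+ 4) _) (qp (s ^+ 2) _) (theta (- x) _) (theta (x ^+ 2 * _) _) (theta x _).
move: (theta_series _ (- x ^+ 3 / s)) (theta_series _ (- (s * x ^+ 3))) (_ * (x / s) ^ _).
move=> t1 t2 t7 J4 J t3 t4 t5 J40 E.
apply: (mulIf J40); transitivity (t5 * (t3 * J * (t4 * J4))); first by ring.
by rewrite E; ring.
Qed.

End Quintuple.

(** * The three-term relation for Appell-Lerch sums *)

Section Lambert.
Variable R : realType.
Local Notation C := R[i].
Local Notation K := (R[i] : numFieldType).
Local Notation qp := (@qpoch K).
Variable s : C.
Hypotheses (s0 : s != 0) (s1 : nm s < 1).
Local Notation p := (s ^+ 2).

Let p0 : p != 0. Proof. by rewrite expf_neq0. Qed.
Let p1 : nm p < 1. Proof. exact: nmX_lt1. Qed.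

Lemma expz_inv_neq1 (z : C) : z != 0 -> (forall n : int, z * p ^ n != 1) ->
  forall n : int, z^-1 * p ^ n != 1.
Proof.
move=> z0 h n; have := h (- n); apply: contra => /eqP e.
by rewrite -invr_expz -invr_eq1 invfM invrK; apply/eqP.
Qed.

Lemma recip_theta1 x : x != 0 -> (forall n : int, x * p ^ n != 1) ->
  lam s (- s) x p = qp p p ^+ 2 / theta x p.
Proof.
move=> x0 hx.
have b0 (i : 'I_1) : (1 : C) != 0 by exact: oner_neq0.
have hb (i k : 'I_1) : i != k -> forall n : int, (1 : C) / 1 * p ^ n != 1.
  by rewrite !ord1 eqxx.
have hx' (i : 'I_1) (n : int) : x * 1 * p ^ n != 1 by rewrite mulr1.
have := recip_theta s0 s1 b0 hb x0 isT hx'.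
rewrite !big_ord1 (big_pred0 _ _ _ (P := fun k : 'I_1 => k != ord0)); last first.
  by move=> k; rewrite ord1 eqxx.
rewrite (big_pred0 _ _ _ (P := fun k : 'I_1 => k != ord0)); last first.
  by move=> k; rewrite ord1 eqxx.
rewrite !mulr1 !expr1 => ->.
have J0 := qpoch_pp_neq0 p1; move: (qp p p) (lam _ _ _ _) J0 => J l J0.
by field.
Qed.

(** The relation of Atkin and Swinnerton-Dyer: [recip_theta] for the three factors at
    x, xz and x/z. *)
Lemma three_term x z : x != 0 -> z != 0 ->
  (forall n : int, x * p ^ n != 1) -> (forall n : int, x * z * p ^ n != 1) ->
  (forall n : int, x / z * p ^ n != 1) ->
  (forall n : int, z * p ^ n != 1) -> (forall n : int, z ^+ 2 * p ^ n != 1) ->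
  z ^+ 3 * lam (s ^+ 3) (- s ^+ 3 * z ^+ 3) (x * z) p +
  lam (s ^+ 3) (- s ^+ 3 / z ^+ 3) (x / z) p =
  qp p p ^+ 2 * theta z p * theta (z ^+ 2) p /
     (theta x p * theta (x * z) p * theta (x / z) p) +
  z * theta (z ^+ 2) p / theta z p * lam (s ^+ 3) (- s ^+ 3) x p.
Proof.
move=> x0 z0 hx hxz hxV hz hz2.
have zV0 : z^-1 != 0 by rewrite invr_eq0.
have z20 : z ^+ 2 != 0 by rewrite expf_neq0.
pose b (i : 'I_3) : C := [:: 1; z; z^-1]`_i.
have b0 i : b i != 0.
  by case: i => [[|[|[|//]]] hi]; rewrite /b /= ?oner_neq0.
have hzV := expz_inv_neq1 z0 hz; have hz2V := expz_inv_neq1 z20 hz2.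
have hb i k : i != k -> forall n : int, b k / b i * p ^ n != 1.
  have e1 : 1 / z = z^-1 by rewrite mul1r.
  have e2 : 1 / z^-1 = z by rewrite mul1r invrK.
  have e3 : z / 1 = z by rewrite divr1.
  have e4 : z / z^-1 = z ^+ 2 by rewrite invrK.
  have e5 : z^-1 / 1 = z^-1 by rewrite divr1.
  have e6 : z^-1 / z = (z ^+ 2)^-1 by field.
  by case: i => [[|[|[|//]]] hi]; case: k => [[|[|[|//]]] hk] //= _ n;
    rewrite /b /= ?e1 ?e2 ?e3 ?e4 ?e5 ?e6.
have hx' i (n : int) : x * b i * p ^ n != 1.
  by case: i => [[|[|[|//]]] hi]; rewrite /b /= ?mulr1.
have := recip_theta s0 s1 b0 hb x0 isT hx'.
pose i0 : 'I_3 := ord0; pose i1 : 'I_3 := lift ord0 ord0.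
pose i2 : 'I_3 := lift ord0 (lift ord0 ord0).
have pr0 (F : 'I_3 -> C) : \prod_(k < 3 | k != i0) F k = F i1 * F i2.
  by rewrite big_mkcond !big_ord_recl big_ord0 /= mul1r mulr1.
have pr1 (F : 'I_3 -> C) : \prod_(k < 3 | k != i1) F k = F i0 * F i2.
  by rewrite big_mkcond !big_ord_recl big_ord0 /= mul1r mulr1.
have pr2 (F : 'I_3 -> C) : \prod_(k < 3 | k != i2) F k = F i0 * F i1.
  by rewrite big_mkcond !big_ord_recl big_ord0 /= mulr1 mulrA mulr1.
rewrite !big_ord_recl !big_ord0 -/i1 -/i2 -/i0 !pr0 !pr1 !pr2.
have -> : b i0 = 1 by []. have -> : b i1 = z by []. have -> : b i2 = z^-1 by [].
have -> : x * 1 = x by rewrite mulr1.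
have -> : z / 1 = z by rewrite divr1.
have -> : z^-1 / 1 = z^-1 by rewrite divr1.
have -> : 1 / z = z^-1 by rewrite div1r.
have -> : z^-1 / z = (z ^+ 2)^-1 by field.
have -> : 1 / z^-1 = z by rewrite div1r invrK.
have -> : z / z^-1 = z ^+ 2 by rewrite invrK.
have -> : (- s) ^+ 3 * (z^-1 * z) = - s ^+ 3 by field.
have -> : (- s) ^+ 3 * (z * z ^+ 2) = - s ^+ 3 * z ^+ 3 by ring.
have -> : (- s) ^+ 3 * (z^-1 * (z ^+ 2)^-1) = - s ^+ 3 / z ^+ 3 by field.
rewrite (theta_inv p0 p1 z0) (theta_inv p0 p1 z20).
have := theta_neq0 p1 x0 hx; have := theta_neq0 p1 (mulf_neq0 x0 z0) hxz.
have := theta_neq0 p1 (mulf_neq0 x0 zV0) hxV.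
have := theta_neq0 p1 z0 hz; have := theta_neq0 p1 z20 hz2.
have := qpoch_pp_neq0 p1.
move: (qp p p) (theta x p) (theta (x * z) p) (theta (x / z) p) => J a1 a2 a3.
move: (theta z p) (theta (z ^+ 2) p) => a4 a5 hJ h5 h4 h3 h2 h1.
move: (lam _ _ _ _) (lam _ _ _ _) (lam _ _ _ _) => l1 l2 l3 E.
transitivity (J ^+ 2 * a4 * a5 * (a1^-1 * (a2^-1 * (a3^-1 * 1))) + z * a5 / a4 * l3).
  by rewrite E; field; rewrite hJ h4 h5 z0.
by field; rewrite h1 h2 h3 h4.
Qed.

End Lambert.

(** * Theta functions of level ten *)

Section LevelTen.
Variable R : realType.
Local Notation C := R[i].
Variable Q : C.
Hypotheses (Q0 : Q != 0) (Q1 : nm Q < 1).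

(** Used for Q = q^5, when these are the theta functions of the multiples of 5 modulo 50. *)
Definition th (k : nat) : C := theta (Q ^+ k) (Q ^+ 10).

Lemma expz_neq1 (m : int) : m != 0 -> Q ^ m != 1.
Proof.
have nat_case (k : nat) : (0 < k)%N -> Q ^+ k != 1 by exact: expf_neq1.
case: m => [k|k] m0; first by rewrite -exprnP nat_case // lt0n.
by rewrite NegzE -exprnN invr_eq1 nat_case.
Qed.

Let p1 : nm (Q ^+ 10) < 1. Proof. exact: nmX_lt1. Qed.
Let s0 : Q ^+ 5 != 0. Proof. by rewrite expf_neq0. Qed.
Let s1 : nm (Q ^+ 5) < 1. Proof. exact: nmX_lt1. Qed.

Lemma th_flip k : (k <= 10)%N -> th (10 - k) = th k.
Proof.
move=> k10; have e : Q ^+ (10 - k) = Q ^+ 10 / Q ^+ k.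
  by apply: (canRL (mulfK _)); rewrite ?expf_neq0 // -exprD subnK.
rewrite /th e; apply: theta_flip; exact: expf_neq0.
Qed.

Lemma th_weierstrass a b c d : (d < c)%N -> (c < b)%N -> (b < a)%N ->
  Q ^+ (b - c) * (th (a + b) * th (a - b) * (th (c + d) * th (c - d))) =
  th (a + c) * th (a - c) * (th (b + d) * th (b - d)) -
  th (a + d) * th (a - d) * (th (b + c) * th (b - c)).
Proof.
move=> dc cb ba.
have E : (Q ^+ 5) ^+ 2 = Q ^+ 10 by rewrite -exprM.
have D m n : (n <= m)%N -> Q ^+ m / Q ^+ n = Q ^+ (m - n).
  by move=> nm; apply: (canLR (mulfK _)); rewrite ?expf_neq0 // -exprD subnK.
have n0 k : Q ^+ k != 0 by rewrite expf_neq0.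
have := weierstrass s0 s1 (n0 a) (n0 b) (n0 c) (n0 d).
rewrite E -!exprD !D /th; try lia.
by [].
Qed.

Lemma th_neq0 k : (0 < k < 10)%N -> th k != 0.
Proof.
move=> /andP[k0 k10]; apply: theta_neq0 => //; first by rewrite expf_neq0.
move=> n; rewrite !exprnP exprz_exp -expfzDr // expz_neq1 //; lia.
Qed.

Local Notation t1 := (th 1). Local Notation t2 := (th 2).
Local Notation t3 := (th 3). Local Notation t4 := (th 4).
Local Notation t5 := (th 5).

Let t6 : th 6 = t4 := th_flip (isT : 4 <= 10)%N.
Let t7 : th 7 = t3 := th_flip (isT : 3 <= 10)%N.
Let t9 : th 9 = t1 := th_flip (isT : 1 <= 10)%N.

(** The lemmas [th_relabcd] are Weierstrass' relation at Q^a, Q^b, Q^c, Q^d, reduced to the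
    indices 1 to 5 by [th_flip]. *)
Lemma th_rel3210 : Q * (t1 ^+ 3 * t5) = t2 ^+ 3 * t4 - t1 * t3 ^+ 3.
Proof.
have : Q ^+ 1 * (th 5 * th 1 * (th 1 * th 1)) =
  th 4 * th 2 * (th 2 * th 2) - th 3 * th 3 * (th 3 * th 1)
  := @th_weierstrass 3 2 1 0 isT isT isT.
move: t1 t2 t3 t4 t5 => a1 a2 a3 a4 a5 E.
by rewrite [RHS](_ : _ = a4 * a2 * (a2 * a2) - a3 * a3 * (a3 * a1)); [rewrite -E; ring | ring].
Qed.

Lemma th_rel4210 : Q * (t1 ^+ 2 * t2 * t4) = t2 ^+ 2 * t3 * t5 - t1 * t3 * t4 ^+ 2.
Proof.
have : Q ^+ 1 * (th 6 * th 2 * (th 1 * th 1)) =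
  th 5 * th 3 * (th 2 * th 2) - th 4 * th 4 * (th 3 * th 1)
  := @th_weierstrass 4 2 1 0 isT isT isT.
rewrite t6; move: t1 t2 t3 t4 t5 => a1 a2 a3 a4 a5 E.
by rewrite [RHS](_ : _ = a5 * a3 * (a2 * a2) - a4 * a4 * (a3 * a1)); [rewrite -E; ring | ring].
Qed.

Lemma th_rel5210 : Q * (t1 ^+ 2 * t3 ^+ 2) = t2 ^+ 2 * t4 ^+ 2 - t1 * t3 * t5 ^+ 2.
Proof.
have : Q ^+ 1 * (th 7 * th 3 * (th 1 * th 1)) =
  th 6 * th 4 * (th 2 * th 2) - th 5 * th 5 * (th 3 * th 1)
  := @th_weierstrass 5 2 1 0 isT isT isT.
rewrite t6 t7; move: t1 t2 t3 t4 t5 => a1 a2 a3 a4 a5 E.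
by rewrite [RHS](_ : _ = a4 * a4 * (a2 * a2) - a5 * a5 * (a3 * a1)); [rewrite -E; ring | ring].
Qed.

Lemma th_rel4310 : Q ^+ 2 * (t1 ^+ 3 * t3) = t3 ^+ 3 * t5 - t2 * t4 ^+ 3.
Proof.
have : Q ^+ 2 * (th 7 * th 1 * (th 1 * th 1)) =
  th 5 * th 3 * (th 3 * th 3) - th 4 * th 4 * (th 4 * th 2)
  := @th_weierstrass 4 3 1 0 isT isT isT.
rewrite t7; move: t1 t2 t3 t4 t5 => a1 a2 a3 a4 a5 E.
by rewrite [RHS](_ : _ = a5 * a3 * (a3 * a3) - a4 * a4 * (a4 * a2)); [rewrite -E; ring | ring].
Qed.

Lemma th_rel5420 : Q ^+ 2 * (t1 ^+ 2 * t2 ^+ 2) = t3 ^+ 2 * t4 ^+ 2 - t2 * t4 * t5 ^+ 2.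
Proof.
have : Q ^+ 2 * (th 9 * th 1 * (th 2 * th 2)) =
  th 7 * th 3 * (th 4 * th 4) - th 5 * th 5 * (th 6 * th 2)
  := @th_weierstrass 5 4 2 0 isT isT isT.
rewrite t6 t7 t9; move: t1 t2 t3 t4 t5 => a1 a2 a3 a4 a5 E.
by rewrite [RHS](_ : _ = a3 * a3 * (a4 * a4) - a5 * a5 * (a4 * a2)); [rewrite -E; ring | ring].
Qed.

Lemma th_rel4320 : Q * (t1 * t2 ^+ 2 * t3) = t2 * t3 ^+ 2 * t4 - t1 * t4 ^+ 2 * t5.
Proof.
have : Q ^+ 1 * (th 7 * th 1 * (th 2 * th 2)) =
  th 6 * th 2 * (th 3 * th 3) - th 4 * th 4 * (th 5 * th 1)
  := @th_weierstrass 4 3 2 0 isT isT isT.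
rewrite t6 t7; move: t1 t2 t3 t4 t5 => a1 a2 a3 a4 a5 E.
by rewrite [RHS](_ : _ = a4 * a2 * (a3 * a3) - a4 * a4 * (a5 * a1)); [rewrite -E; ring | ring].
Qed.

End LevelTen.

(** * Two identities for the division by Euler's product *)

Section ThetaIdentities.
Variable F : fieldType.
Variables (q t1 t2 t3 t4 t5 : F).
Hypotheses (n1 : t1 != 0) (n2 : t2 != 0) (n3 : t3 != 0) (n4 : t4 != 0) (n5 : t5 != 0).
Local Notation Q := (q ^+ 5).
Hypothesis rel3210 : Q * (t1 ^+ 3 * t5) = t2 ^+ 3 * t4 - t1 * t3 ^+ 3.
Hypothesis rel4210 : Q * (t1 ^+ 2 * t2 * t4) = t2 ^+ 2 * t3 * t5 - t1 * t3 * t4 ^+ 2.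
Hypothesis rel5210 : Q * (t1 ^+ 2 * t3 ^+ 2) = t2 ^+ 2 * t4 ^+ 2 - t1 * t3 * t5 ^+ 2.
Hypothesis rel4310 : Q ^+ 2 * (t1 ^+ 3 * t3) = t3 ^+ 3 * t5 - t2 * t4 ^+ 3.
Hypothesis rel5420 : Q ^+ 2 * (t1 ^+ 2 * t2 ^+ 2) = t3 ^+ 2 * t4 ^+ 2 - t2 * t4 * t5 ^+ 2.
Hypothesis rel4320 : Q * (t1 * t2 ^+ 2 * t3) = t2 * t3 ^+ 2 * t4 - t1 * t4 ^+ 2 * t5.

Local Notation W3210 := (t1 * t3 ^+ 3 - t2 ^+ 3 * t4 + Q * t1 ^+ 3 * t5).
Local Notation W4210 := (t2 ^+ 2 * t3 * t5 - Q * t1 ^+ 2 * t2 * t4 - t1 * t3 * t4 ^+ 2).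
Local Notation W5210 := (t2 ^+ 2 * t4 ^+ 2 - Q * t1 ^+ 2 * t3 ^+ 2 - t1 * t3 * t5 ^+ 2).
Local Notation W4310 := (t3 ^+ 3 * t5 - Q ^+ 2 * t1 ^+ 3 * t3 - t2 * t4 ^+ 3).
Local Notation W5420 := (t3 ^+ 2 * t4 ^+ 2 - Q ^+ 2 * t1 ^+ 2 * t2 ^+ 2 - t2 * t4 * t5 ^+ 2).
Local Notation W4320 := (t2 * t3 ^+ 2 * t4 - Q * t1 * t2 ^+ 2 * t3 - t1 * t4 ^+ 2 * t5).

Let moved a b c : a = b -> c = a - b -> c = 0 :> F.
Proof. by move=> -> ->; rewrite subrr. Qed.

Let movedN a b c : a = b -> c = - (a - b) -> c = 0 :> F.
Proof. by move=> -> ->; rewrite subrr oppr0. Qed.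

Let w3210 : W3210 = 0.
Proof. by apply: (moved rel3210); ring. Qed.

Let w4210 : W4210 = 0.
Proof. by apply: (movedN rel4210); ring. Qed.

Let w5210 : W5210 = 0.
Proof. by apply: (movedN rel5210); ring. Qed.

Let w4310 : W4310 = 0.
Proof. by apply: (movedN rel4310); ring. Qed.

Let w5420 : W5420 = 0.
Proof. by apply: (movedN rel5420); ring. Qed.

Let w4320 : W4320 = 0.
Proof. by apply: (movedN rel4320); ring. Qed.

(** Sorted by the exponents of q modulo 5, [theta_identity_A] and
    [theta_identity_B] each split into five identities in Q and the t_k alone.  Cleared of
    denominators, each of these is a combination of the instances of Weierstrass' relation
    with the cofactors displayed in its proof. *)
Lemma residue_A0 : - t4 * t5 / t2 ^+ 3 - Q * t1 * t5 / (t2 ^+ 2 * t3) - Q * t3 / (t2 * t4) + t2 *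
    t4 / (t1 ^+ 2 * t3) = 0.
Proof.
rewrite [LHS](_ : _ = (t2 ^+ 2 * W5210 + t1 * t5 * W4210) / (t1 ^+ 2 * t2 ^+ 3 * t3 * t4)); last
    first.
  by field; rewrite ?n1 ?n2 ?n3 ?n4 ?n5.
by rewrite w4210 w5210; ring.
Qed.

Lemma residue_A1 : t3 * t4 / t2 ^+ 3 + Q * t1 / t2 ^+ 2 + (Q * t3 ^+ 2) / (t2 * t4 * t5) - t2 *
    t4 / (t1 ^+ 2 * t5) = 0.
Proof.
rewrite [LHS](_ : _ = (- t2 ^+ 2 * W5210 - t1 * t5 * W4210) / (t1 ^+ 2 * t2 ^+ 3 * t4 * t5));
    last first.
  by field; rewrite ?n1 ?n2 ?n3 ?n4 ?n5.
by rewrite w4210 w5210; ring.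
Qed.

Lemma residue_A2 : - (t3 ^+ 2 * t4) / (t2 ^+ 3 * t5) + t5 / t2 ^+ 2 - Q * t1 * t5 / (t2 * t3 *
    t4) + Q * t2 * t4 / (t3 ^+ 2 * t5) = 0.
Proof.
rewrite [LHS](_ : _ = (- t3 ^+ 2 * W5420 + Q * t2 ^+ 2 * W5210) / (t2 ^+ 3 * t3 ^+ 2 * t4 * t5));
    last first.
  by field; rewrite ?n1 ?n2 ?n3 ?n4 ?n5.
by rewrite w5210 w5420; ring.
Qed.

Lemma residue_A3 : t1 * t4 * t5 / (t2 ^+ 3 * t3) - t3 / t2 ^+ 2 + Q * t1 / (t2 * t4) = 0.
Proof.
rewrite [LHS](_ : _ = - W4320 / (t2 ^+ 3 * t3 * t4)); last first.
  by field; rewrite ?n1 ?n2 ?n3 ?n4 ?n5.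
by rewrite w4320; ring.
Qed.

Lemma residue_A4 : - t1 * t4 / t2 ^+ 3 + t3 ^+ 2 / (t2 ^+ 2 * t5) + t5 / (t2 * t4) - t2 * t4 /
    (t1 * t3 * t5) = 0.
Proof.
rewrite [LHS](_ : _ = (t1 * t5 * W4210 + t2 * t4 * W3210) / (t1 * t2 ^+ 3 * t3 * t4 * t5)); last
    first.
  by field; rewrite ?n1 ?n2 ?n3 ?n4 ?n5.
by rewrite w3210 w4210; ring.
Qed.

Lemma residue_B0 : - t3 ^+ 2 / (t1 * t2 ^+ 2) - Q * t3 / (t2 * t4) + (Q ^+ 2 * t1) / t4 ^+ 2 + t2
    * t4 / (t1 ^+ 2 * t3) = 0.
Proof.
rewrite [LHS](_ : _ = (- t2 ^+ 2 * W4310 + t3 ^+ 2 * W4210) / (t1 ^+ 2 * t2 ^+ 2 * t3 * t4 ^+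
    2)); last first.
  by field; rewrite ?n1 ?n2 ?n3 ?n4 ?n5.
by rewrite w4210 w4310; ring.
Qed.

Lemma residue_B1 : - Q * t1 / t2 ^+ 2 - (Q ^+ 2 * t1 ^+ 2) / (t2 * t3 * t4) + Q * t5 / t4 ^+ 2 =
    0.
Proof.
rewrite [LHS](_ : _ = Q * W4210 / (t2 ^+ 2 * t3 * t4 ^+ 2)); last first.
  by field; rewrite ?n1 ?n2 ?n3 ?n4 ?n5.
by rewrite w4210; ring.
Qed.

Lemma residue_B2 : - t5 / t2 ^+ 2 + t3 ^+ 2 / (t1 * t2 * t4) - Q * t3 / t4 ^+ 2 = 0.
Proof.
rewrite [LHS](_ : _ = W4320 / (t1 * t2 ^+ 2 * t4 ^+ 2)); last first.
  by field; rewrite ?n1 ?n2 ?n3 ?n4 ?n5.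
by rewrite w4320; ring.
Qed.

Lemma residue_B3 : t3 / t2 ^+ 2 + Q * t1 / (t2 * t4) - (Q ^+ 2 * t1 ^+ 2) / (t3 * t4 ^+ 2) - t2 *
    t4 / (t1 * t3 ^+ 2) = 0.
Proof.
rewrite [LHS](_ : _ = (t2 ^+ 2 * W4310 - t3 ^+ 2 * W4210) / (t1 * t2 ^+ 2 * t3 ^+ 2 * t4 ^+ 2));
    last first.
  by field; rewrite ?n1 ?n2 ?n3 ?n4 ?n5.
by rewrite w4210 w4310; ring.
Qed.

Lemma residue_B4 : (Q * t1 ^+ 2) / (t2 ^+ 2 * t3) + t5 / (t2 * t4) + t3 ^+ 2 / (t1 * t4 ^+ 2) - 2
    * (t2 * t4) / (t1 * t3 * t5) = 0.
Proof.
rewrite [LHS](_ : _ = (- t2 * t4 * W5210 + t3 ^+ 2 * W4210 + t4 ^+ 2 * W3210) / (t1 * t2 ^+ 2 *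
    t3 * t4 ^+ 2 * t5)); last first.
  by field; rewrite ?n1 ?n2 ?n3 ?n4 ?n5.
by rewrite w3210 w4210 w5210; ring.
Qed.

Lemma theta_identity_A :
  (- t5 + q * t3 - q ^+ 2 * t3 ^+ 2 / t5 + q ^+ 3 * t1 * t5 / t3 - q ^+ 4 * t1) / t2 ^+ 2 *
    (t4 / t2 - q ^+ 2 - q ^+ 4 * t2 / t4) =
  t2 * t4 * (- q ^+ 7 / (t5 * t3 ^+ 2) + q / (t5 * t1 ^+ 2)
             - 1 / (t1 ^+ 2 * t3) + q ^+ 4 / (t1 * t3 * t5)).
Proof.
apply/eqP; rewrite -subr_eq0; apply/eqP.
transitivity (0 + q * 0 + q ^+ 2 * 0 + q ^+ 3 * 0 + q ^+ 4 * 0 : F); last by ring.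
rewrite -{1}residue_A0 -{1}residue_A1 -{1}residue_A2 -{1}residue_A3 -{1}residue_A4.
by field; rewrite n1 n2 n3 n4 n5.
Qed.

Lemma theta_identity_B :
  (- t3 ^+ 2 / t1 - q ^+ 6 * t1 - q ^+ 2 * t5 + q ^+ 3 * t3 + q ^+ 9 * t1 ^+ 2 / t3)
    / (t2 * t4) * (t4 / t2 - q ^+ 2 - q ^+ 4 * t2 / t4) =
  t2 * t4 * (2 * q ^+ 4 / (t1 * t3 * t5) + q ^+ 3 / (t1 * t3 ^+ 2) - 1 / (t1 ^+ 2 * t3)).
Proof.
apply/eqP; rewrite -subr_eq0; apply/eqP.
transitivity (0 + q * 0 + q ^+ 2 * 0 + q ^+ 3 * 0 + q ^+ 4 * 0 : F); last by ring.
rewrite -{1}residue_B0 -{1}residue_B1 -{1}residue_B2 -{1}residue_B3 -{1}residue_B4.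
by field; rewrite n1 n2 n3 n4 n5.
Qed.

End ThetaIdentities.

(** * Dissections modulo five *)

#[local] Opaque theta_series lam csum poch qpoch theta GRing.exp exprz.

Section Dissection.
Variable R : realType.
Local Notation C := R[i].
Local Notation K := (R[i] : numFieldType).
Local Notation qp := (@qpoch K).
Variable q : C.
Hypotheses (q0 : q != 0) (q1 : nm q < 1).

Local Notation Q := (q ^+ 5).
Local Notation J2 := (qp (q ^+ 2) (q ^+ 2)).
Local Notation J50 := (qp (q ^+ 50) (q ^+ 50)).

Lemma qX0 k : q ^+ k != 0. Proof. by rewrite expf_neq0. Qed.
Lemma qX1 k : nm (q ^+ k.+1) < 1. Proof. exact: nmX_lt1. Qed.

Lemma qpow (k : nat) (e : int) : (q ^+ k) ^ e = q ^ (k%:Z * e).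
Proof. by rewrite [q ^+ k]exprnP exprz_exp. Qed.

Lemma sqrt50 : (q ^+ 25) ^+ 2 = q ^+ 50. Proof. by rewrite -exprM. Qed.

Lemma thE k : th Q k = theta (q ^+ (5 * k)) (q ^+ 50).
Proof. by rewrite /th -!exprM. Qed.

Lemma sum_window5 (F : int -> C) :
  \sum_(j < 5) F (j%:Z - 2) = F (- 2%:Z) + F (- 1%:Z) + F 0 + F 1%:Z + F 2%:Z.
Proof. by rewrite !big_ord_recl big_ord0 /bump /= addr0 !addrA. Qed.

(** The residue classes modulo 5 of the pentagonal series, and also the two series in the
    quintuple product at base q^50, have this form. *)
Definition pent_series (c : int) : C := theta_series (q ^+ 75) (- q ^ c).

Lemma pent_series_inv c : pent_series (- c) = pent_series c.
Proof.
rewrite /pent_series -invr_expz -invrN; apply: theta_series_inv; exact: qX1.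
Qed.

Lemma pent_series_shift c : pent_series c = - q ^ (75%:Z + c) * pent_series (c + 150%:Z).
Proof.
have h : - q ^ c != 0 by rewrite oppr_eq0 expfz_neq0.
apply: (etrans (theta_series_shift (qX0 75) (qX1 74) h)).
have -> : q ^+ 75 * - q ^ c = - q ^ (75%:Z + c).
  by rewrite [q ^+ 75]exprnP mulrN -expfzDr.
have -> : (q ^+ 75) ^+ 2 * - q ^ c = - q ^ (c + 150%:Z).
  by rewrite -exprM [q ^+ _]exprnP mulrN mulrC -expfzDr.
by [].
Qed.

Lemma pent_series_pentagonal : pent_series 25%:Z = J50.
Proof.
rewrite -sqrt50; apply: etrans (pentagonal (qX0 25) (qX1 24)).
by rewrite /pent_series -exprM.
Qed.

Lemma pent_series_quintuple (k m : nat) (c d : int) :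
  m = (2 * k)%N -> c = 3 * k%:Z - 25%:Z -> d = 3 * k%:Z + 25%:Z ->
  J50 * theta (q ^+ m) (q ^+ 50) =
  theta (q ^+ k) (q ^+ 50) * (pent_series c + q ^+ k * pent_series d).
Proof.
move=> -> -> ->; have := quintuple (qX0 25) (qX1 24) (qX0 k).
have -> : (q ^+ k) ^+ 2 = q ^+ (2 * k) by rewrite -exprM mulnC.
have e3 : (q ^+ k) ^+ 3 = q ^ (3 * k%:Z) by rewrite exprnP qpow mulrC.
have -> : - (q ^+ k) ^+ 3 / q ^+ 25 = - q ^ (3 * k%:Z - 25%:Z).
  by rewrite mulNr e3 exprnN expfzDr.
have -> : - (q ^+ 25 * (q ^+ k) ^+ 3) = - q ^ (3 * k%:Z + 25%:Z).
  by rewrite e3 mulrC exprnP expfzDr.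
have -> : (q ^+ 25) ^+ 3 = q ^+ 75 by rewrite -exprM.
by rewrite sqrt50.
Qed.

Lemma th_q_neq0 k : (0 < k < 10)%N -> th Q k != 0.
Proof. by apply: th_neq0; [exact: qX0 | exact: qX1]. Qed.

(** Ramanujan's five-dissection.  Of the five residue classes of the pentagonal series, one
    is the pentagonal series for q^25; the other four form two pairs, and each pair is a
    quintuple product. *)
Lemma euler_dissection :
  J2 = J50 * (th Q 4 / th Q 2 - q ^+ 2 - q ^+ 4 * th Q 2 / th Q 4).
Proof.
have h2 := th_q_neq0 (isT : 0 < 2 < 10)%N; have h4 := th_q_neq0 (isT : 0 < 4 < 10)%N.
have h8 : theta (q ^+ 40) (q ^+ 50) = th Q 2.
  by rewrite -[RHS](th_flip (qX0 5) (isT : 2 <= 10)%N) thE.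
have QK1 := @pent_series_quintuple 10 20 5%:Z 55%:Z erefl erefl erefl.
have QK2 := @pent_series_quintuple 20 40 35%:Z 85%:Z erefl erefl erefl.
rewrite h8 -(thE 4) in QK2; rewrite -(thE 4) -(thE 2) in QK1.
have e1 : J50 * (th Q 4 / th Q 2) = pent_series 5%:Z + q ^+ 10 * pent_series 55%:Z.
  by rewrite mulrA; apply: (canLR (mulfK h2)); rewrite [RHS]mulrC; exact: QK1.
have e2 : J50 * (th Q 2 / th Q 4) = pent_series 35%:Z + q ^+ 20 * pent_series 85%:Z.
  by rewrite mulrA; apply: (canLR (mulfK h4)); rewrite [RHS]mulrC; exact: QK2.
have h : - q != 0 by rewrite oppr_eq0.
have := theta_series_split 4 2 (qX0 3) (qX1 2) h.
rewrite (pentagonal q0 q1) => ->.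
have E (e : int) : (q ^+ 3) ^ (e * e) * (- q) ^ e *
   theta_series ((q ^+ 3) ^+ (5 * 5)) ((q ^+ 3) ^ (2 * 5%:Z * e) * (- q) ^+ 5) =
   (- 1) ^ e * q ^ (3%:Z * (e * e) + e) * pent_series (30%:Z * e + 5%:Z).
  have -> : (- q) ^ e = (- 1) ^ e * q ^ e by rewrite -[- q]mulN1r expfzMl.
  have -> : (q ^+ 3) ^ (2 * 5%:Z * e) * (- q) ^+ 5 = - q ^ (30%:Z * e + 5%:Z).
    have -> : (- q) ^+ 5 = - q ^ 5%:Z by rewrite -exprnP; ring.
    rewrite mulrN qpow -expfzDr //; congr (- (_ ^ _)); ring.
  have -> : (q ^+ 3) ^+ (5 * 5) = q ^+ 75 by rewrite -exprM.
  by rewrite /pent_series qpow (expfzDr (3%:Z * (e * e)) e q0); move: (theta_series _ _) => u;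
      ring.
rewrite (eq_bigr _ (fun (j : 'I_5) _ => E (j%:Z - 2))).
rewrite (sum_window5 (fun e => (- 1) ^ e * q ^ (3%:Z * (e * e) + e) * pent_series (30%:Z * e +
    5%:Z))).
have -> : 3%:Z * (- 2%:Z * - 2%:Z) + - 2%:Z = 10%:Z by [].
have -> : 3%:Z * (- 1%:Z * - 1%:Z) + - 1%:Z = 2%:Z by [].
have -> : 3%:Z * (0 * 0) + 0 = 0 by [].
have -> : 3%:Z * (1%:Z * 1%:Z) + 1%:Z = 4%:Z by [].
have -> : 3%:Z * (2%:Z * 2%:Z) + 2%:Z = 14%:Z by [].
have -> : 30%:Z * - 2%:Z + 5%:Z = - 55%:Z by [].
have -> : 30%:Z * - 1%:Z + 5%:Z = - 25%:Z by [].
have -> : 30%:Z * 0 + 5%:Z = 5%:Z by [].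
have -> : 30%:Z * 1%:Z + 5%:Z = 35%:Z by [].
have -> : 30%:Z * 2%:Z + 5%:Z = - - 65%:Z by [].
rewrite !(pent_series_inv 55%:Z) (pent_series_inv 25%:Z) (pent_series_inv (- 65%:Z))
    (pent_series_shift (- 65%:Z)).
have -> : 75%:Z - 65%:Z = 10%:Z by [].
have -> : - 65%:Z + 150%:Z = 85%:Z by [].
rewrite pent_series_pentagonal -!exprnP.
have -> : (- 1) ^ (- 2%:Z) = 1 :> C by rewrite -exprnN sqrrN expr1n invr1.
have -> : (- 1) ^ (- 1%:Z) = - 1 :> C by rewrite -exprnN expr1 invrN invr1.
rewrite !expr0.
move: e1 e2; move: J50 (th Q 4) (th Q 2) => J a b.
move: (pent_series 5%:Z) (pent_series 35%:Z) (pent_series 55%:Z) (pent_series 85%:Z) => u1 u2 u3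
    u4 e1 e2.
have -> : J * (a / b - q ^+ 2 - q ^+ 4 * b / a) =
  J * (a / b) - q ^+ 2 * J - q ^+ 4 * (J * (b / a)) by ring.
by rewrite e1 e2; ring.
Qed.

Local Notation J := J50.
Local Notation t2 := (th Q 2).
Local Notation t4 := (th Q 4).

(** The sum over n of (-1)^n q^(3n^2+3n+1+k(2n+1)) / (1 - q^(10n+5)). *)
Definition lerch_part (k : int) : C :=
  q ^ (k + 1) * lam (q ^+ 3) (- q ^ (3%:Z + 2%:Z * k)) (q ^+ 5) (q ^+ 10).

(** The sum over n of (-1)^n q^(75n^2+75n) / (1 - x q^(50n)). *)
Definition appell (x : C) : C := lam (q ^+ 75) (- q ^+ 75) x (q ^+ 50).

(** Of the five residue classes of the summation index, [L 0] is the central one, and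
    the relation of Atkin and Swinnerton-Dyer with z = q^10 and z = q^20 eliminates the
    pairs [L 1], [L (- 1)] and [L 2], [L (- 2)].  The resulting coefficient of [L 0] is the
    five-dissection of [J2 / J]. *)
Lemma lerch_part_dissection (k : int) : let X := q ^ (25%:Z - 10%:Z * k) in
  lerch_part (3%:Z * k) =
  (- 1) ^ (k + 1) * q ^ (17%:Z - 3%:Z * k * k) * (J2 / J) * appell X +
  (- 1) ^ k * q ^ (19%:Z - 3%:Z * k * k) * (J ^+ 2 * t2 * t4 *
    (- q ^- 12 / (theta X (q ^+ 50) * theta (X * q ^+ 10) (q ^+ 50) * theta (X / q ^+ 10) (q ^+
        50)) +
     q ^- 18 / (theta X (q ^+ 50) * theta (X * q ^+ 20) (q ^+ 50) * theta (X / q ^+ 20) (q ^+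
         50)))).
Proof.
move=> X.
have w0 (e : int) : - q ^ e != 0 by rewrite oppr_eq0 expfz_neq0.
pose L (i : int) := lam (q ^+ 75) (- q ^ (75%:Z + 30%:Z * i)) (X * q ^ (10%:Z * i)) (q ^+ 50).
have nz (e : int) : e != 0 -> q ^ e != 1 by exact: expz_neq1.
have n50 (e : int) : (forall n, e + 50%:Z * n != 0) -> forall n, q ^ e * (q ^+ 50) ^ n != 1.
  by move=> he n; rewrite qpow -expfzDr // nz.
have three (m : nat) : (0 < m < 5)%N ->
   q ^ (30%:Z * m%:Z) * L m%:Z + L (- m%:Z) =
   J ^+ 2 * theta (q ^+ (10 * m)) (q ^+ 50) * theta (q ^+ (20 * m)) (q ^+ 50) /
    (theta X (q ^+ 50) * theta (X * q ^+ (10 * m)) (q ^+ 50) * theta (X / q ^+ (10 * m)) (q ^+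
        50)) +
   q ^+ (10 * m) * theta (q ^+ (20 * m)) (q ^+ 50) / theta (q ^+ (10 * m)) (q ^+ 50) * L 0.
  move=> m5.
  have X0 : X != 0 by rewrite expfz_neq0.
  have := @three_term _ _ (qX0 25) (qX1 24) X (q ^+ (10 * m)) X0 (qX0 _).
  rewrite sqrt50.
  have -> : (q ^+ (10 * m)) ^+ 2 = q ^+ (20 * m) by rewrite -exprM; congr (_ ^+ _); lia.
  have -> : (q ^+ 25) ^+ 3 = q ^+ 75 by rewrite -exprM.
  have e3 : (q ^+ (10 * m)) ^+ 3 = q ^ (30%:Z * m%:Z).
    by rewrite -exprM exprnP; congr (_ ^ _); lia.
  rewrite e3.
  have -> : - q ^+ 75 * q ^ (30%:Z * m%:Z) = - q ^ (75%:Z + 30%:Z * m%:Z).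
    by rewrite [q ^+ 75]exprnP mulNr -expfzDr.
  have -> : - q ^+ 75 / q ^ (30%:Z * m%:Z) = - q ^ (75%:Z + 30%:Z * - m%:Z).
    by rewrite [q ^+ 75]exprnP mulNr invr_expz -expfzDr // mulrN.
  have -> : lam (q ^+ 75) (- q ^+ 75) X (q ^+ 50) = L 0.
    rewrite /L; have -> : 75%:Z + 30%:Z * 0 = 75%:Z by [].
    have -> : 10%:Z * 0 = 0 by [].
    by rewrite expr0z [X * 1]mulr1 -exprnP.
  have -> : lam (q ^+ 75) (- q ^ (75%:Z + 30%:Z * m%:Z)) (X * q ^+ (10 * m)) (q ^+ 50) = L m%:Z.
    by rewrite /L [q ^+ (10 * m)]exprnP PoszM.
  have -> : lam (q ^+ 75) (- q ^ (75%:Z + 30%:Z * - m%:Z)) (X / q ^+ (10 * m)) (q ^+ 50) = L (-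
      m%:Z).
    rewrite /L exprnN PoszM.
    by have -> : 10%:Z * - m%:Z = - (10%:Z * m%:Z) by rewrite mulrN.
  apply.
  - by apply: n50 => n; lia.
  - by rewrite exprnP /X -expfzDr //; apply: n50 => n; lia.
  - by rewrite exprnN /X -expfzDr //; apply: n50 => n; lia.
  - by rewrite exprnP; apply: n50 => n; lia.
  - by rewrite exprnP; apply: n50 => n; lia.
(* with the offset [k] the classes depend on [k] only through [X] and a common factor *)
rewrite /lerch_part (lam_split 4 k (q ^+ 5) (qX0 3) (qX1 2) (qX0 10) (qX1 9) (w0 _)).
have E (j : 'I_5) : (q ^+ 3) ^ ((j%:Z - k) * (j%:Z - k)) * (- q ^ (3%:Z + 2%:Z * (3%:Z * k))) ^
    (j%:Z - k) *
   lam ((q ^+ 3) ^+ (5 * 5)) ((q ^+ 3) ^ (2 * 5%:Z * (j%:Z - k)) *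
      (- q ^ (3%:Z + 2%:Z * (3%:Z * k))) ^+ 5) (q ^+ 5 * (q ^+ 10) ^ (j%:Z - k)) ((q ^+ 10) ^+ 5)
          =
   (- 1) ^ k * (- 1) ^ (j%:Z - 2%:Z) * q ^ (18%:Z - 3%:Z * k * k - 3%:Z * k + 
     (3%:Z * (j%:Z - 2%:Z) * (j%:Z - 2%:Z) + 15%:Z * (j%:Z - 2%:Z))) * L (j%:Z - 2%:Z).
  set e := j%:Z - k; set i := j%:Z - 2%:Z.
  have sg (b c : int) : (- q ^ b) ^ c = (- 1) ^ c * q ^ (b * c).
    by rewrite -[- (q ^ b)]mulN1r expfzMl exprz_exp.
  have -> : (- q ^ (3%:Z + 2%:Z * (3%:Z * k))) ^ e =
     (- 1) ^ k * (- 1) ^ i * q ^ ((3%:Z + 2%:Z * (3%:Z * k)) * e).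
    rewrite sg; congr (_ * _); rewrite -expfzDr ?oppr_eq0 ?oner_neq0 //.
    have -> : k + i = e + 2%:Z * (k - 1%:Z) by rewrite /e /i; lia.
    have m1 : (- 1) ^ 2%:Z = 1 :> C by rewrite -exprnP sqrrN expr1n.
    by rewrite expfzDr ?oppr_eq0 ?oner_neq0 // -exprz_exp m1 exp1rz mulr1.
  have -> : (q ^+ 3) ^+ (5 * 5) = q ^+ 75 by rewrite -exprM.
  have -> : (q ^+ 10) ^+ 5 = q ^+ 50 by rewrite -exprM.
  have -> : (q ^+ 3) ^ (2 * 5%:Z * e) * (- q ^ (3%:Z + 2%:Z * (3%:Z * k))) ^+ 5 =
      - q ^ (75%:Z + 30%:Z * i).
    have m5 : (- 1) ^ 5%:Z = - 1 :> C by rewrite -exprnP; ring.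
    rewrite [(- _) ^+ 5]exprnP sg m5 qpow mulN1r mulrN -expfzDr //.
    by congr (- (_ ^ _)); rewrite /e /i; lia.
  have -> : q ^+ 5 * (q ^+ 10) ^ e = X * q ^ (10%:Z * i).
    rewrite qpow [q ^+ 5]exprnP /X -!expfzDr //.
    by congr (_ ^ _); rewrite /e /i; lia.
  rewrite -/(L i) qpow.
  have -> : q ^ (18%:Z - 3%:Z * k * k - 3%:Z * k + (3%:Z * i * i + 15%:Z * i)) =
     q ^ (3%:Z * (e * e)) * q ^ ((3%:Z + 2%:Z * (3%:Z * k)) * e).
    by rewrite -expfzDr //; congr (_ ^ _); rewrite /e /i; lia.
  move: ((- 1) ^ k) ((- 1) ^ i) (L i) => u1 u2 u3.
  move: (q ^ (3%:Z * (e * e))) (q ^ (_ * e)) => u4 u5; ring.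
rewrite (eq_bigr _ (fun j _ => E j)).
rewrite (sum_window5 (fun i => (- 1) ^ k * (- 1) ^ i * q ^ (18%:Z - 3%:Z * k * k - 3%:Z * k +
     (3%:Z * i * i + 15%:Z * i)) * L i)).
have -> : 3%:Z * - 2%:Z * - 2%:Z + 15%:Z * - 2%:Z = - 18%:Z by [].
have -> : 3%:Z * - 1%:Z * - 1%:Z + 15%:Z * - 1%:Z = - 12%:Z by [].
have -> : 3%:Z * 0 * 0 + 15%:Z * 0 = 0 by [].
have -> : 3%:Z * 1%:Z * 1%:Z + 15%:Z * 1%:Z = 30%:Z * 1%:Z - 12%:Z by [].
have -> : 3%:Z * 2%:Z * 2%:Z + 15%:Z * 2%:Z = 30%:Z * 2%:Z - 18%:Z by [].
have sN2 : (- 1) ^ (- 2%:Z) = 1 :> C by rewrite -exprnN sqrrN expr1n invr1.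
have sN1 : (- 1) ^ (- 1%:Z) = - 1 :> C by rewrite -exprnN expr1 invrN invr1.
have s10 : (- 1) ^ (0 : int) = 1 :> C by rewrite expr0z.
have s11 : (- 1) ^ 1%:Z = - 1 :> C by rewrite expr1z.
have s12 : (- 1) ^ 2%:Z = 1 :> C by rewrite -exprnP sqrrN expr1n.
rewrite sN2 sN1 s10 s11 s12.
have sk : (- 1) ^ (k + 1) = - (- 1) ^ k :> C.
  by rewrite expfzDr ?oppr_eq0 ?oner_neq0 // expr1z mulrN1.
rewrite sk.
have T1 := three 1%N isT; have T2 := three 2%N isT.
have h8 : theta (q ^+ 40) (q ^+ 50) = th Q 2.
  by rewrite -(@th_flip _ Q (qX0 5) 2 isT) thE.
have L0 : L 0 = appell X.
  rewrite /L /appell; have -> : 75%:Z + 30%:Z * 0 = 75%:Z by [].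
  have -> : 10%:Z * 0 = 0 by [].
  by rewrite expr0z [X * 1]mulr1 -exprnP.
rewrite -[(10 * 1)%N]/10%N -[(20 * 1)%N]/20%N -(thE 2) -(thE 4) in T1.
rewrite -[(10 * 2)%N]/20%N -[(20 * 2)%N]/40%N h8 -(thE 4) in T2.
rewrite L0 in T1 T2 *.
have P : q ^ (19%:Z - 3%:Z * k * k) = q ^ (3%:Z * k + 1) * q ^ (18%:Z - 3%:Z * k * k - 3%:Z * k).
  by rewrite -expfzDr //; congr (_ ^ _); lia.
have P' : q ^ (17%:Z - 3%:Z * k * k) = q ^ (19%:Z - 3%:Z * k * k) * q ^- 2.
  by rewrite exprnN -expfzDr //; congr (_ ^ _); lia.
rewrite P' P euler_dissection.
have W (e : int) : q ^ (18%:Z - 3%:Z * k * k - 3%:Z * k + e) =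
   q ^ (18%:Z - 3%:Z * k * k - 3%:Z * k) * q ^ e by rewrite expfzDr.
rewrite !W expr0z (expfzDr (30%:Z * 1%:Z) (- 12%:Z) q0).
rewrite (expfzDr (30%:Z * 2%:Z) (- 18%:Z) q0) -!exprnN.
have := th_q_neq0 (isT : 0 < 2 < 10)%N; have := th_q_neq0 (isT : 0 < 4 < 10)%N.
have := qpoch_pp_neq0 (qX1 49); move: T1 T2.
move: (theta X (q ^+ 50)) (theta (X * q ^+ 10) (q ^+ 50)) (theta (X / q ^+ 10) (q ^+ 50)).
move: (theta (X * q ^+ 20) (q ^+ 50)) (theta (X / q ^+ 20) (q ^+ 50)) => x4 x5 x1 x2 x3.
move: (x1 * x2 * x3)^-1 (x1 * x4 * x5)^-1.
move: t2 t4 J (appell X) (L (- 2%:Z)) (L (- 1%:Z)) (L 1%:Z) (L 2%:Z).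
move: (q ^ (18%:Z - 3%:Z * k * k - 3%:Z * k)) (q ^ (3%:Z * k + 1)) ((- 1) ^ k).
move: (q ^ (30%:Z * 1%:Z)) (q ^ (30%:Z * 2%:Z)) => v1 v2 r f g a b c A l1 l2 l3 l4 d1 d2.
move=> T1 T2 c0 b0 a0.
transitivity (f * r * g * ((v2 * l4 + l1) * q ^- 18 - (v1 * l3 + l2) * q ^- 12 + A)).
  by ring.
by rewrite T1 T2; field; rewrite a0 b0 c0 q0.
Qed.

End Dissection.

(** * The Lerch sum at a fifth root of unity *)

Section FifthRoot.
Variable R : realType.
Local Notation C := R[i].
Local Notation K := (R[i] : numFieldType).
Local Notation qp := (@qpoch K).
Variable q : C.
Hypotheses (q0 : q != 0) (q1 : nm q < 1).

Local Notation J2 := (qp (q ^+ 2) (q ^+ 2)).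
Let qX0 k : q ^+ k != 0. Proof. exact: qX0. Qed.
Let qX1 k : nm (q ^+ k.+1) < 1. Proof. exact: qX1. Qed.
Let qz0 (e : int) : - q ^ e != 0. Proof. by rewrite oppr_eq0 expfz_neq0. Qed.

Definition qlam (a : nat) (b c : int) (d : nat) : C :=
  lam (q ^+ a) (- q ^ b) (q ^ c) (q ^+ d).

(** Replace n by - 1 - n. *)
Lemma qlam_reflect a b c d : (0 < a)%N -> (0 < d)%N ->
  qlam a b c d = q ^ (a%:Z + d%:Z - b - c) * qlam a (2%:Z * a%:Z + d%:Z - b) (d%:Z - c) d.
Proof.
case: a d => [//|a] [//|d] _ _.
have c0 : q ^ c != 0 by rewrite expfz_neq0.
rewrite /qlam (lam_reflect (- q ^ b) (qX1 a) (qX0 d.+1) (qX1 d) c0).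
have -> : q ^+ d.+1 / - q ^ b = - q ^ (d.+1%:Z - b).
  by rewrite invrN mulrN invr_expz exprnP -expfzDr.
rewrite (lam_shift _ (qX0 a.+1) (qX1 a) (qX0 d.+1) (qX1 d) (qz0 _)).
have -> : q ^+ a.+1 * - q ^ (d.+1%:Z - b) = - q ^ (a.+1%:Z + (d.+1%:Z - b)).
  by rewrite mulrN exprnP -expfzDr.
have -> : (q ^+ a.+1) ^+ 2 * - q ^ (d.+1%:Z - b) = - q ^ (2%:Z * a.+1%:Z + d.+1%:Z - b).
  by rewrite mulrN -exprM exprnP -expfzDr //; congr (- (_ ^ _)); lia.
have -> : (q ^ c)^-1 * q ^+ d.+1 = q ^ (d.+1%:Z - c).
  by rewrite invr_expz exprnP -expfzDr //; congr (_ ^ _); lia.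
rewrite mulrA mulrNN; congr (_ * _).
by rewrite invr_expz -expfzDr //; congr (_ ^ _); lia.
Qed.

Lemma qlam_diff a b c d : (0 < a)%N -> (0 < d)%N ->
  (forall n, c + d%:Z * n != 0) ->
  qlam a b c d - q ^ c * qlam a (b + d%:Z) c d = theta_series (q ^+ a) (- q ^ b).
Proof.
case: a d => [//|a] [//|d] _ _ h.
have hx (n : int) : q ^ c * (q ^+ d.+1) ^ n != 1.
  by rewrite qpow -expfzDr //; apply: expz_neq1.
rewrite -(lam_diff (- q ^ b) (qX1 a) (qX0 d.+1) (qX1 d) hx) /qlam.
have -> : - q ^ b * q ^+ d.+1 = - q ^ (b + d.+1%:Z).
  by rewrite mulNr exprnP -expfzDr.
by [].
Qed.

Lemma lerch_partE k : lerch_part q k = q ^ (k + 1) * qlam 3 (3%:Z + 2%:Z * k) 5%:Z 10.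
Proof. by rewrite /lerch_part /qlam -exprnP. Qed.

Lemma lerch_part_reflect k : lerch_part q (5%:Z - k) = lerch_part q k.
Proof.
rewrite !lerch_partE (@qlam_reflect 3 (3%:Z + 2%:Z * k) 5%:Z 10 isT isT).
have -> : 2%:Z * 3%:Z + 10%:Z - (3%:Z + 2%:Z * k) = 3%:Z + 2%:Z * (5%:Z - k) by lia.
have -> : 10%:Z - 5%:Z = 5%:Z by [].
have -> : 5%:Z - k + 1 = k + 1 + (3%:Z + 10%:Z - (3%:Z + 2%:Z * k) - 5%:Z) by lia.
by rewrite (expfzDr (k + 1) _ q0) mulrA.
Qed.

(** By [qlam_diff] the two sums differ by a theta series, which is Euler's product by
    the pentagonal number theorem. *)
Lemma lerch_part1 : lerch_part q 1 = lerch_part q 6%:Z - J2.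
Proof.
have := @qlam_diff 3 5%:Z 5%:Z 10 isT isT (fun n => ltac:(lia)).
have -> : theta_series (q ^+ 3) (- q ^ 5%:Z) = - J2 / q ^+ 2.
  rewrite -(pentagonal q0 q1) -(theta_series_inv (- q) (qX1 2)).
  have h : (- q)^-1 != 0 by rewrite invr_eq0 oppr_eq0.
  rewrite (theta_series_shift (qX0 3) (qX1 2) h).
  have -> : (q ^+ 3) ^+ 2 * (- q)^-1 = - q ^ 5%:Z by rewrite -exprnP; field.
  by move: (theta_series _ _) => u; field.
rewrite !lerch_partE -[6%:Z + 1]/(7%:Z) -[1 + 1]/(2%:Z) => E.
have -> : 3%:Z + 2%:Z * 1 = 5%:Z by [].
have -> : 3%:Z + 2%:Z * 6%:Z = 5%:Z + 10%:Z by [].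
move: E; rewrite -[7%:Z]/(2%:Z + 5%:Z) (expfzDr 2%:Z 5%:Z q0) -[q ^ 2%:Z]exprnP.
move: (qlam _ _ _ _) (qlam _ _ _ _) J2 (q ^ 5%:Z) => v u w x E.
transitivity (q ^+ 2 * (u - x * v) + q ^+ 2 * x * v); first by ring.
by rewrite E; field.
Qed.

(** In the five terms of [lam_geometric] the root of unity disappears from the denominators.
    The indices are then brought to 0, 3 and 6, because [lerch_part_dissection] applies to
    multiples of 3. *)
Lemma lerch_fifth z : z ^+ 5 = 1 ->
  q * lam (q ^+ 3) (- q ^+ 3) (z * q) (q ^+ 2) =
  lerch_part q 0 + (z + z ^+ 4) * (lerch_part q 6%:Z - J2) + (z ^+ 2 + z ^+ 3) * lerch_part q
      3%:Z.
Proof.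
move=> z5; have e1 := lerch_part1.
have e4 : lerch_part q 4%:Z = lerch_part q 1.
  have h : 5%:Z - 1 = 4%:Z by [].
  by rewrite -h; exact: lerch_part_reflect.
have e3 : lerch_part q 2%:Z = lerch_part q 3%:Z.
  have h : 5%:Z - 3%:Z = 2%:Z by [].
  by rewrite -h; exact: lerch_part_reflect.
have zq5 : (z * q) ^+ 5 = q ^+ 5 by rewrite exprMn z5 mul1r.
have hx (n : int) : (z * q) ^+ 5 * ((q ^+ 2) ^+ 5) ^ n != 1.
  rewrite zq5 -(exprM q) qpow [q ^+ 5]exprnP -(expfzDr _ _ q0).
  by apply: (expz_neq1 q1); lia.
rewrite (lam_geometric (- q ^+ 3) (qX0 3) (qX1 2) (qX0 2) (qX1 1) hx).
have E (i : 'I_5) : (z * q) ^+ i * lam (q ^+ 3) (- q ^+ 3 * (q ^+ 2) ^+ i) ((z * q) ^+ 5)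
    ((q ^+ 2) ^+ 5) = z ^+ i * (lerch_part q i%:Z / q).
  have -> : (q ^+ 2) ^+ 5 = q ^+ 10 by rewrite -(exprM q).
  rewrite zq5.
  have -> : - q ^+ 3 * (q ^+ 2) ^+ i = - q ^ (3%:Z + 2%:Z * i%:Z).
    by rewrite mulNr -(exprM q) -exprD exprnP.
  rewrite /lerch_part (expfzDr i%:Z 1 q0) expr1z -exprnP exprMn.
  by move: (lam _ _ _ _) => u; field.
rewrite (eq_bigr _ (fun i _ => E i)) !big_ord_recl big_ord0 /bump /=.
rewrite -[Posz (1 + 0)]/(1 : int) -[Posz (1 + (1 + 0))]/2%:Z -[Posz (1 + (1 + (1 + 0)))]/3%:Z.
rewrite -[Posz (1 + (1 + (1 + (1 + 0))))]/4%:Z -[Posz 0]/(0 : int) e3 e4.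
move: e1; move: J2 (lerch_part q 6%:Z) (lerch_part q 0) (lerch_part q 1) (lerch_part q 3%:Z).
by move=> j d a b c ->; field.
Qed.

End FifthRoot.

(** * Appearance of the sums S(r, 5) *)

Section Assembly.
Variable R : realType.
Local Notation C := R[i].
Local Notation K := (R[i] : numFieldType).
Local Notation qp := (@qpoch K).
Variable q : C.
Hypotheses (q0 : q != 0) (q1 : nm q < 1).

Local Notation Q := (q ^+ 5).
Local Notation J2 := (qp (q ^+ 2) (q ^+ 2)).
Local Notation J := (qp (q ^+ 50) (q ^+ 50)).
Local Notation J150 := (qp (q ^+ 150) (q ^+ 150)).
Let qX0 k : q ^+ k != 0. Proof. exact: qX0. Qed.
Let qX1 k : nm (q ^+ k.+1) < 1. Proof. exact: qX1. Qed.
Local Notation qlam := (qlam q).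

(** S(r, 5) as a function of q. *)
Definition S5 (r : int) : C :=
  q ^ (5%:Z * (6%:Z * r - 3%:Z) - 3%:Z * (r * r) - 2%:Z * r) / J *
  qlam 75 125%:Z (30%:Z * r - 15%:Z) 150.

(** The first of the three terms of [lam_geometric] has the numerators of [recip_theta1],
    whence the reciprocal of a theta function; the other two are kept. *)
Lemma appell_split (c : int) : (forall n, 3%:Z * c + 150%:Z * n != 0) ->
  appell q (q ^ c) = J150 ^+ 2 / theta (q ^ (3%:Z * c)) (q ^+ 150) +
    q ^ c * qlam 75 125%:Z (3%:Z * c) 150 +
    q ^ (2%:Z * c) * qlam 75 175%:Z (3%:Z * c) 150.
Proof.
move=> hc.
have x3 : (q ^ c) ^+ 3 = q ^ (3%:Z * c) by rewrite exprnP exprz_exp mulrC.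
have u3 : (q ^+ 50) ^+ 3 = q ^+ 150 by rewrite -(exprM q).
have hx (n : int) : (q ^ c) ^+ 3 * ((q ^+ 50) ^+ 3) ^ n != 1.
  by rewrite x3 u3 qpow -(expfzDr _ _ q0); apply: (expz_neq1 q1).
rewrite /appell (lam_geometric (- q ^+ 75) (qX0 75) (qX1 74) (qX0 50) (qX1 49) hx).
rewrite !big_ord_recl big_ord0 /bump /= x3 u3.
have s2 : (q ^+ 75) ^+ 2 = q ^+ 150 by rewrite -(exprM q).
have x0 : q ^ (3%:Z * c) != 0 by rewrite expfz_neq0.
have hx0 (n : int) : q ^ (3%:Z * c) * ((q ^+ 75) ^+ 2) ^ n != 1 by rewrite -x3 s2 -u3.
have T0 := recip_theta1 (qX0 75) (qX1 74) x0 hx0; rewrite s2 in T0.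
have w0 : - q ^+ 75 * (q ^+ 50) ^+ 0 = - q ^+ 75 by rewrite expr0 mulr1.
have w1 : - q ^+ 75 * (q ^+ 50) ^+ (1 + 0) = - q ^ 125%:Z.
  by rewrite mulNr -(exprM q) -exprD exprnP.
have w2 : - q ^+ 75 * (q ^+ 50) ^+ (1 + (1 + 0)) = - q ^ 175%:Z.
  by rewrite mulNr -(exprM q) -exprD exprnP.
have x2 : (q ^ c) ^+ (1 + (1 + 0)) = q ^ (2%:Z * c) by rewrite exprnP exprz_exp mulrC.
have x1 : (q ^ c) ^+ (1 + 0) = q ^ c by rewrite expr1.
rewrite w0 w1 w2 T0 x2 x1 expr0 -/(qlam 75 125%:Z (3%:Z * c) 150) -/(qlam 75 175%:Z (3%:Z * c)
    150).
move: (qlam _ _ _ _) (qlam _ _ _ _) (theta _ _) J150 => u v w x.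
by rewrite mul1r addr0 addrA.
Qed.

(** Reflection maps the second Lerch sum of [appell_split] to the first, whence the factor 2. *)
Lemma appell25 : q ^+ 17 / J * appell q (q ^ 25%:Z) =
  q ^+ 17 * (J150 ^+ 2 / theta (q ^+ 75) (q ^+ 150) / J) + 2 * S5 3%:Z.
Proof.
rewrite appell_split; last by move=> n; lia.
have -> : 3%:Z * 25%:Z = 75%:Z by [].
have -> : 2%:Z * 25%:Z = 50%:Z by [].
rewrite /S5; have -> : 30%:Z * 3%:Z - 15%:Z = 75%:Z by [].
have -> : 5%:Z * (6%:Z * 3%:Z - 3%:Z) - 3%:Z * (3%:Z * 3%:Z) - 2%:Z * 3%:Z = 42%:Z by [].
have := @qlam_reflect _ q q0 q1 75 175%:Z 75%:Z 150 isT isT.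
have -> : 75%:Z + 150%:Z - 175%:Z - 75%:Z = - 25%:Z by [].
have -> : 2%:Z * 75%:Z + 150%:Z - 175%:Z = 125%:Z by [].
have -> : 150%:Z - 75%:Z = 75%:Z by [].
rewrite -exprnN -!exprnP.
have := qpoch_pp_neq0 (qX1 49).
move: (theta _ _)^-1 (qlam 75 175%:Z _ _) (qlam 75 125%:Z _ _) J J150 => t u v j j' j0 ->.
by field; rewrite q0 j0.
Qed.

(** Reflection maps the Lerch sum of S(4, 5) to the second one of [appell_split]. *)
Lemma appell15 : q ^+ 14 / J * appell q (q ^ 15%:Z) =
  q ^+ 14 * (J150 ^+ 2 / theta (q ^+ 45) (q ^+ 150) / J) + (S5 2%:Z + S5 4%:Z).
Proof.
rewrite appell_split; last by move=> n; lia.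
have -> : 3%:Z * 15%:Z = 45%:Z by [].
have -> : 2%:Z * 15%:Z = 30%:Z by [].
rewrite /S5; have -> : 30%:Z * 2%:Z - 15%:Z = 45%:Z by [].
have -> : 30%:Z * 4%:Z - 15%:Z = 105%:Z by [].
have -> : 5%:Z * (6%:Z * 2%:Z - 3%:Z) - 3%:Z * (2%:Z * 2%:Z) - 2%:Z * 2%:Z = 29%:Z by [].
have -> : 5%:Z * (6%:Z * 4%:Z - 3%:Z) - 3%:Z * (4%:Z * 4%:Z) - 2%:Z * 4%:Z = 49%:Z by [].
have := @qlam_reflect _ q q0 q1 75 125%:Z 105%:Z 150 isT isT.
have -> : 75%:Z + 150%:Z - 125%:Z - 105%:Z = - 5%:Z by [].
have -> : 2%:Z * 75%:Z + 150%:Z - 125%:Z = 175%:Z by [].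
have -> : 150%:Z - 105%:Z = 45%:Z by [].
rewrite -exprnN -!exprnP.
have := qpoch_pp_neq0 (qX1 49).
move: (qlam 75 125%:Z 105%:Z _) (qlam 75 175%:Z _ _) (qlam 75 125%:Z 45%:Z _) => u1 u2 u3.
move: (theta _ _)^-1 J J150 => t j j' j0 ->.
by field; rewrite q0 j0.
Qed.

(** The second Lerch sum of [appell_split] belongs to S(0, 5), but after reflection only up to
    the difference equation [qlam_diff]; the theta series appearing there is J50 by the
    pentagonal number theorem, and gives the constant - 1. *)
Lemma appell5 : q ^+ 5 / J * appell q (q ^ 5%:Z) =
  q ^+ 5 * (J150 ^+ 2 / theta (q ^+ 15) (q ^+ 150) / J) + (S5 1 - S5 0 - 1).
Proof.
rewrite appell_split; last by move=> n; lia.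
have -> : 3%:Z * 5%:Z = 15%:Z by [].
have -> : 2%:Z * 5%:Z = 10%:Z by [].
rewrite /S5; have -> : 30%:Z * 1 - 15%:Z = 15%:Z by [].
have -> : 30%:Z * 0 - 15%:Z = - 15%:Z by [].
have -> : 5%:Z * (6%:Z * 1 - 3%:Z) - 3%:Z * (1 * 1) - 2%:Z * 1 = 10%:Z by [].
have -> : 5%:Z * (6%:Z * 0 - 3%:Z) - 3%:Z * (0 * 0) - 2%:Z * 0 = - 15%:Z by [].
have c0 : q ^ (- 15%:Z) != 0 by rewrite expfz_neq0.
have E1 : qlam 75 125%:Z (- 15%:Z) 150 = - q ^+ 15 * qlam 75 25%:Z 15%:Z 150.
  rewrite /qlam (lam_reflect (- q ^ 125%:Z) (qX1 74) (qX0 150) (qX1 149) c0).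
  have -> : q ^+ 150 / - q ^ 125%:Z = - q ^ 25%:Z.
    by rewrite invrN mulrN invr_expz exprnP -(expfzDr _ _ q0).
  by rewrite !invr_expz opprK -exprnP.
have E2 := @qlam_diff _ q q0 q1 75 25%:Z 15%:Z 150 isT isT (fun n => ltac:(lia)).
have e3 : 25%:Z + 150%:Z = 175%:Z by [].
rewrite e3 -/(pent_series q 25%:Z) (pent_series_pentagonal q0 q1) in E2.
move: E1 E2; rewrite -exprnN -!exprnP.
have := qpoch_pp_neq0 (qX1 49).
move: (qlam 75 25%:Z _ _) (qlam 75 175%:Z _ _) (qlam 75 125%:Z 15%:Z _) (qlam 75 125%:Z (- 15%:Z)
    _).
move: (theta _ _)^-1 J J150 => t j j' u1 u2 u3 u4 j0 -> E2.
have -> : j^-1 = (u1 - q ^+ 15 * u2)^-1 by rewrite E2.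
have h : u1 - q ^+ 15 * u2 != 0 by rewrite E2.
by field; rewrite q0 h.
Qed.

Local Notation t1 := (th Q 1).
Local Notation t2 := (th Q 2).
Local Notation t3 := (th Q 3).
Local Notation t4 := (th Q 4).
Local Notation t5 := (th Q 5).
Local Notation t150 k := (theta (q ^+ k) (q ^+ 150)).

Let n1 : t1 != 0 := th_q_neq0 q0 q1 (isT : 0 < 1 < 10)%N.
Let n2 : t2 != 0 := th_q_neq0 q0 q1 (isT : 0 < 2 < 10)%N.
Let n3 : t3 != 0 := th_q_neq0 q0 q1 (isT : 0 < 3 < 10)%N.
Let n4 : t4 != 0 := th_q_neq0 q0 q1 (isT : 0 < 4 < 10)%N.
Let n5 : t5 != 0 := th_q_neq0 q0 q1 (isT : 0 < 5 < 10)%N.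

Lemma theta_thQ (e : int) (k : nat) : e = (5 * k)%N%:Z ->
  theta (q ^ e) (q ^+ 50) = th Q k.
Proof. by move=> ->; rewrite -exprnP -thE. Qed.

Lemma theta_thQ_neg (e : int) (k : nat) : e = - (5 * k)%N%:Z ->
  theta (q ^ e) (q ^+ 50) = - q ^- (5 * k) * th Q k.
Proof.
by move=> ->; rewrite -exprnN (theta_inv (qX0 50) (qX1 49) (qX0 (5 * k))) thE.
Qed.

Let th7 : th Q 7 = t3 := th_flip (qX0 5) (isT : 3 <= 10)%N.
Let th9 : th Q 9 = t1 := th_flip (qX0 5) (isT : 1 <= 10)%N.

(** [lerch_part_dissection] for one value of [k], with the powers and theta functions replaced
    by their normal forms. *)
Lemma lerch_part_eval (k m c : int) (e T0 T1 T2 T3 T4 : C) :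
  (- 1) ^ k = e -> 17%:Z - 3%:Z * k * k = m -> 25%:Z - 10%:Z * k = c ->
  theta (q ^ c) (q ^+ 50) = T0 ->
  theta (q ^ (c + 10%:Z)) (q ^+ 50) = T1 -> theta (q ^ (c - 10%:Z)) (q ^+ 50) = T2 ->
  theta (q ^ (c + 20%:Z)) (q ^+ 50) = T3 -> theta (q ^ (c - 20%:Z)) (q ^+ 50) = T4 ->
  lerch_part q (3%:Z * k) = - (e * q ^ m / J * appell q (q ^ c)) * J2 +
   J ^+ 2 * t2 * t4 * (- (e * q ^ (m - 10%:Z)) / (T0 * T1 * T2) +
      e * q ^ (m - 16%:Z) / (T0 * T3 * T4)).
Proof.
move=> <- <- <- <- <- <- <- <-.
have := lerch_part_dissection q0 q1 k; cbv zeta => ->.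
have -> : (- 1) ^ (k + 1) = - (- 1) ^ k :> C.
  by rewrite expfzDr ?oppr_eq0 ?oner_neq0 // expr1z mulrN1.
set c0 := 25%:Z - 10%:Z * k; set m0 := 17%:Z - 3%:Z * k * k.
have -> : 19%:Z - 3%:Z * k * k = m0 + 2%:Z by rewrite /m0; lia.
rewrite !(expfzDr c0 _ q0) !(expfzDr m0 _ q0) -!exprnN -!exprnP.
move: (theta _ _) (theta (q ^ c0 * q ^+ 10) _) (theta (q ^ c0 / q ^+ 10) _).
move: (theta (q ^ c0 * q ^+ 20) _) (theta (q ^ c0 / q ^+ 20) _) => x4 x5 x1 x2 x3.
rewrite !invfM; move: x1^-1 x2^-1 x3^-1 x4^-1 x5^-1 => y1 y2 y3 y4 y5.
have := qpoch_pp_neq0 (qX1 49); move: J J2 (appell _ _) ((- 1) ^ k) (q ^ m0) t2 t4.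
by move=> j j2 p u v a2 a4 hj; field; rewrite q0 hj.
Qed.

Lemma lerch_part0_eval : lerch_part q 0 =
  - (q ^+ 17 / J * appell q (q ^ 25%:Z)) * J2 +
  J ^+ 2 * t2 * t4 * (- q ^+ 7 / (t5 * t3 ^+ 2) + q / (t5 * t1 ^+ 2)).
Proof.
have := @lerch_part_eval 0 17%:Z 25%:Z 1 t5 t3 t3 t1 t1 erefl erefl erefl
  (@theta_thQ 25%:Z 5 erefl) (etrans (@theta_thQ (25%:Z + 10%:Z) 7 erefl) th7)
  (@theta_thQ (25%:Z - 10%:Z) 3 erefl) (etrans (@theta_thQ (25%:Z + 20%:Z) 9 erefl) th9)
  (@theta_thQ (25%:Z - 20%:Z) 1 erefl).
have -> : 3%:Z * 0 = 0 by [].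
have -> : 17%:Z - 10%:Z = 7%:Z by [].
have -> : 17%:Z - 16%:Z = 1%:Z by [].
move=> ->.
rewrite -(exprnP q 17) -(exprnP q 7) expr1z.
move: n1 n2 n3 n4 n5; have := qpoch_pp_neq0 (qX1 49).
move: t1 t2 t3 t4 t5 J (appell _ _) J2 => a1 a2 a3 a4 a5 j p j2 hj h1 h2 h3 h4 h5.
by field; rewrite h1 h3 h5 hj.
Qed.

Lemma lerch_part3_eval : lerch_part q 3%:Z =
  q ^+ 14 / J * appell q (q ^ 15%:Z) * J2 +
  J ^+ 2 * t2 * t4 * (q ^+ 4 / (t1 * t3 * t5) + q ^+ 3 / (t1 * t3 ^+ 2)).
Proof.
have := @lerch_part_eval 1 14%:Z 15%:Z (- 1) t3 t5 t1 t3 (- q ^- 5 * t1) erefl erefl erefl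
  (@theta_thQ 15%:Z 3 erefl) (@theta_thQ (15%:Z + 10%:Z) 5 erefl)
  (@theta_thQ (15%:Z - 10%:Z) 1 erefl) (etrans (@theta_thQ (15%:Z + 20%:Z) 7 erefl) th7)
  (@theta_thQ_neg (15%:Z - 20%:Z) 1 erefl).
have -> : 3%:Z * 1 = 3%:Z by [].
have -> : 14%:Z - 10%:Z = 4%:Z by [].
have -> : 14%:Z - 16%:Z = - 2%:Z by [].
move=> ->.
rewrite -(exprnP q 14) -(exprnP q 4) -(exprnN q 2).
move: n1 n2 n3 n4 n5; have := qpoch_pp_neq0 (qX1 49).
move: t1 t2 t3 t4 t5 J (appell _ _) J2 => a1 a2 a3 a4 a5 j p j2 hj h1 h2 h3 h4 h5.
by field; rewrite q0 h1 h3 h5 hj.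
Qed.

Lemma lerch_part6_eval : lerch_part q 6%:Z =
  - (q ^+ 5 / J * appell q (q ^ 5%:Z)) * J2 +
  J ^+ 2 * t2 * t4 * (1 / (t1 ^+ 2 * t3) - q ^+ 4 / (t1 * t3 * t5)).
Proof.
have e2 : (- 1) ^ 2%:Z = 1 :> C by rewrite -exprnP sqrrN expr1n.
have := @lerch_part_eval 2%:Z 5%:Z 5%:Z 1 t1 t3 (- q ^- 5 * t1) t5 (- q ^- 15 * t3) e2 erefl erefl
  (@theta_thQ 5%:Z 1 erefl) (@theta_thQ (5%:Z + 10%:Z) 3 erefl)
  (@theta_thQ_neg (5%:Z - 10%:Z) 1 erefl) (@theta_thQ (5%:Z + 20%:Z) 5 erefl)
  (@theta_thQ_neg (5%:Z - 20%:Z) 3 erefl).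
have -> : 3%:Z * 2%:Z = 6%:Z by [].
have -> : 5%:Z - 10%:Z = - 5%:Z by [].
have -> : 5%:Z - 16%:Z = - 11%:Z by [].
move=> ->.
rewrite -(exprnP q 5) -(exprnN q 5) -(exprnN q 11).
move: n1 n2 n3 n4 n5; have := qpoch_pp_neq0 (qX1 49).
move: t1 t2 t3 t4 t5 J (appell _ _) J2 => a1 a2 a3 a4 a5 j p j2 hj h1 h2 h3 h4 h5.
by field; rewrite q0 h1 h3 h5 hj.
Qed.

(** The constant in [appell5] cancels the [- J2] in [lerch_fifth].  With 1 + z + ... + z^4 = 0
    everything is expressed by 1 and z^2 + z^3; the theta quotients in the two components
    are written as multiples of [J2] by [theta_identity_A] and [theta_identity_B]. *)
Lemma main_identity z : z ^+ 5 = 1 -> 1 + z + z ^+ 2 + z ^+ 3 + z ^+ 4 = 0 ->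
  q * lam (q ^+ 3) (- q ^+ 3) (z * q) (q ^+ 2) / J2 =
  - 2 * S5 3%:Z + (z + z ^+ 4) * (S5 0 - S5 1)
  + (z ^+ 2 + z ^+ 3) * (S5 2%:Z + S5 4%:Z)
  + q ^+ 5 * (J150 ^+ 2 / t150 15 / J)
  - J * t5 / t2 ^+ 2 + q * J * t3 / t2 ^+ 2
  - q ^+ 2 * J * t3 ^+ 2 / (t2 ^+ 2 * t5)
  - q ^+ 17 * (J150 ^+ 2 / t150 75 / J)
  + q ^+ 3 * J * (t1 * t5) / (t2 ^+ 2 * t3)
  - q ^+ 4 * J * t1 / t2 ^+ 2
  + (z ^+ 2 + z ^+ 3) *
    (q ^+ 5 * (J150 ^+ 2 / t150 15 / J)
     - J * t3 ^+ 2 / (t1 * t2 * t4) - q ^+ 6 * (J * t1 / (t2 * t4))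
     - q ^+ 2 * (J * t5 / (t2 * t4)) + q ^+ 3 * (J * t3 / (t2 * t4))
     + q ^+ 9 * (J * t1 ^+ 2 / (t2 * t3 * t4))
     + q ^+ 14 * (J150 ^+ 2 / t150 45 / J)).
Proof.
move=> z5 z1.
have r1 := th_rel3210 (qX0 5) (qX1 4); have r2 := th_rel4210 (qX0 5) (qX1 4).
have r3 := th_rel5210 (qX0 5) (qX1 4); have r4 := th_rel4310 (qX0 5) (qX1 4).
have r5 := th_rel5420 (qX0 5) (qX1 4); have r6 := th_rel4320 (qX0 5) (qX1 4).
have A := theta_identity_A n1 n2 n3 n4 n5 r1 r2 r3 r5 r6.
have B := theta_identity_B n1 n2 n3 n4 n5 r1 r2 r3 r4 r6.
apply: (etrans (congr1 (fun x => x / J2) (lerch_fifth q0 q1 z5))).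
have j20 : J2 != 0 by exact: (qpoch_pp_neq0 (qX1 1)).
have j0 : J != 0 := qpoch_pp_neq0 (qX1 49).
move: j0 j20 (euler_dissection q0 q1) lerch_part0_eval lerch_part3_eval lerch_part6_eval appell25
    appell15 appell5 A B.
move: (lerch_part q 0) (lerch_part q 3%:Z) (lerch_part q 6%:Z) (appell q (q ^ 25%:Z)) (appell q
    (q ^ 15%:Z)).
move: (appell q (q ^ 5%:Z)) => p5 g0 g3 g6 p25 p15.
move: (S5 0) (S5 1) (S5 2%:Z) (S5 3%:Z) (S5 4%:Z) => s0 s1 s2 s3 s4.
move: (t150 15) (t150 45) (t150 75) J150 J2 => w15 w45 w75 j150 j2.
have := n1; have := n2; have := n3; have := n4; have := n5.
move: J t1 t2 t3 t4 t5 => j a1 a2 a3 a4 a5 h5 h4 h3 h2 h1 j0 j20 jE -> -> -> -> -> ->.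
clear r1 r2 r3 r4 r5 r6.
move: (j150 ^+ 2 / w15 / j) (j150 ^+ 2 / w45 / j) (j150 ^+ 2 / w75 / j) => y15 y45 y75.
set D := a4 / a2 - q ^+ 2 - q ^+ 4 * a2 / a4 in jE *.
set F0 := - q ^+ 7 / (a5 * a3 ^+ 2) + q / (a5 * a1 ^+ 2).
set F6 := 1 / (a1 ^+ 2 * a3) - q ^+ 4 / (a1 * a3 * a5).
set F3 := q ^+ 4 / (a1 * a3 * a5) + q ^+ 3 / (a1 * a3 ^+ 2).
set uA := (- a5 + _ - _ + _ - _) / _; set uB := (- a3 ^+ 2 / a1 - _ - _ + _ + _) / _ => A B.
have eA : a2 * a4 * F0 = a2 * a4 * F6 + uA * D.
  by rewrite A /F0 /F6; move: (D) => d; field; rewrite h1 h3 h5.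
have eB : a2 * a4 * F3 = a2 * a4 * F6 + uB * D.
  by rewrite B /F3 /F6; move: (D) => d; field; rewrite h1 h3 h5.
have D0 : D != 0 by move: j20; rewrite jE mulf_eq0 negb_or => /andP[].
have zE : z + z ^+ 4 = - 1 - (z ^+ 2 + z ^+ 3).
  by apply/eqP; rewrite -subr_eq0; apply/eqP; rewrite -[RHS]z1; ring.
rewrite zE jE -![j ^+ 2 * a2 * a4 * _](mulrA (j ^+ 2 * a2)).
transitivity (- (q ^+ 17 * y75 + 2 * s3) + (q ^+ 5 * y15 + (s1 - s0)) + j * uA +
  (z ^+ 2 + z ^+ 3) * ((q ^+ 5 * y15 + (s1 - s0)) + (q ^+ 14 * y45 + (s2 + s4)) + j * uB)).
  transitivity ((- (q ^+ 17 * y75 + 2 * s3) * (j * D) + j ^+ 2 * (a2 * a4 * F0) +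
     (- 1 - (z ^+ 2 + z ^+ 3)) * (- (q ^+ 5 * y15 + (s1 - s0 - 1)) * (j * D) +
        j ^+ 2 * (a2 * a4 * F6) - j * D) +
     (z ^+ 2 + z ^+ 3) * ((q ^+ 14 * y45 + (s2 + s4)) * (j * D) + j ^+ 2 * (a2 * a4 * F3)))
     / (j * D)).
    by congr (_ / _); move: (F0) (F6) (F3) (D) => f0 f6 f3 d; ring.
  by rewrite eA eB; move: D0; move: (uA) (uB) (D) (F6) => u v d f6 d0; field; rewrite j0 d0.
by rewrite /uA /uB; field; rewrite h1 h2 h3 h4 h5.
Qed.

End Assembly.

(** * Cauchy's identity and the Lerch sum *)

Section Cauchy.
Variable R : realType.
Local Notation C := R[i].
Local Notation K := (R[i] : numFieldType).
Local Notation qp := (@qpoch K).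
Variable p : C.
Hypothesis (p1 : nm p < 1).

Definition cauchyT (r m : nat) : C :=
  p ^+ (m * m + m * r) / (poch p p m * poch p p (m + r)).

Lemma cauchyT_bounded : exists2 B, 0 < B &
  forall r m, nm (cauchyT r m) <= B * nm p ^+ (m * m + m * r).
Proof.
have [B B0 hB] := poch_inv_bounded p1 (pp_neq1 p1).
exists (B * B) => [|r m]; first exact: mulr_gt0.
rewrite /cauchyT nmM nmX mulrC ler_wpM2r ?exprn_ge0 ?nm_ge0 //.
by rewrite invfM nmM ler_pM ?nm_ge0.
Qed.

Lemma asum_cauchyT r : asum (cauchyT r).
Proof.
have [B B0 hB] := cauchyT_bounded.
apply: asum_le (bsumZ (ltW B0) (bsum_geometric p1)) => m.
apply: le_trans (hB r m) _; rewrite ler_wpM2l ?(ltW B0) //.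
by apply: (nmX_le p1); case: m => // m; rewrite mulSn; lia.
Qed.

Let F r := csum (cauchyT r).

Let FP r : has_sum (cauchyT r) (F r).
Proof. exact: csumP (asum_cauchyT r). Qed.

(** The difference of the terms for r and r + 1 has the factor
    (1 - p^(m+r+1)) - p^m = (1 - p^m) - p^(m+r+1).  In the part with 1 - p^m this cancels
    the last factor of (p)_m, and shifting m gives the terms for r + 2. *)
Lemma cauchy_rec r : F r - F r.+1 = p ^+ r.+1 * (F r.+2 - F r.+1).
Proof.
have h1 := has_sumD (has_sumB (FP r) (FP r.+1)) (has_sumZ (p ^+ r.+1) (FP r.+1)).
have h2 := has_sum_succ _ h1; rewrite /= in h2.
have e : F r - F r.+1 + p ^+ r.+1 * F r.+1 = p ^+ r.+1 * F r.+2.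
  apply: has_sum_unique (h2 _) _.
    rewrite /cauchyT !mul0n !add0n poch0 expr0 poch_ppS.
    have := poch_pp_neq0 r p1; have := poch_pp_neq0 r.+1 p1; rewrite poch_ppS mulf_eq0 negb_or.
    move: (poch p p r) (p ^+ r.+1) => a b /andP[_ b0] a0; field.
    by rewrite b0 a0.
  apply: eq_has_sum (has_sumZ _ (FP r.+2)) => m.
  rewrite /cauchyT.
  rewrite (_ : m.+1 + r = (m + r).+1)%N // (_ : m.+1 + r.+1 = (m + r).+2)%N; last by lia.
  rewrite (_ : m + r.+2 = (m + r).+2)%N; last by lia.
  rewrite (_ : m.+1 * m.+1 + m.+1 * r = m * m + m * r + m + m + 1 + r)%N; last by lia.
  rewrite (_ : m.+1 * m.+1 + m.+1 * r.+1 = m * m + m * r + m + m + 1 + r + m + 1)%N; last by lia.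
  rewrite (_ : m * m + m * r.+2 = m * m + m * r + m + m)%N; last by lia.
  have := poch_pp_neq0 (m + r).+2 p1; have := poch_pp_neq0 m.+1 p1; rewrite !poch_ppS.
  rewrite !mulf_eq0 !negb_or => /andP[a b] /andP[/andP[c d] e].
  have e1 : p ^+ m.+1 = p * p ^+ m by rewrite exprS.
  have e2 : p ^+ (m + r).+1 = p * p ^+ m * p ^+ r by rewrite exprS (exprD p) mulrA.
  have e3 : p ^+ (m + r).+2 = p * p * p ^+ m * p ^+ r.
    by rewrite exprS e2 !mulrA.
  have e4 : p ^+ r.+1 = p * p ^+ r by rewrite exprS.
  move: b d e; rewrite !(exprD p) e1 e2 e3 e4 expr1.
  move: (p ^+ m) (p ^+ r) (p ^+ (m * m)) (p ^+ (m * r)) (poch p p m) (poch p p (m + r)) a c.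
  move=> u v w y P1 P2 a c b d e.
  by field; rewrite a b c d e.
have -> : F r - F r.+1 = p ^+ r.+1 * F r.+2 - p ^+ r.+1 * F r.+1 by rewrite -e; ring.
by rewrite mulrBr.
Qed.

(** By [cauchy_rec] the differences satisfy d_r = - p^(r+1) d_(r+1); being bounded, they are
    at most a constant times |p|^n for every n, hence 0. *)
Lemma cauchy_const r : F r = F r.+1.
Proof.
pose d r := F r - F r.+1.
have dS k : d k = - p ^+ k.+1 * d k.+1.
  by rewrite /d cauchy_rec; ring.
have [B B0 hB] := cauchyT_bounded.
have [M hM] := bsum_geometric p1.
have bF k : nm (F k) <= B * M.
  apply: has_sum_nm_le (FP k) _ => A uA.
  apply: le_trans (ler_sum _ (fun m _ => hB k m)) _.
  rewrite -big_distrr ler_wpM2l ?(ltW B0) //=; apply: le_trans (hM A uA).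
  by apply: ler_sum => m _; apply: (nmX_le p1); case: m => // m; rewrite mulSn; lia.
have step k n : nm (d k) <= nm p ^+ n * nm (d (k + n)%N).
  elim: n k => [|n IH] k; first by rewrite mul1r addn0.
  rewrite dS nmM nmN nmX -addSnnS (exprS (nm p) n) -mulrA.
  apply: ler_pM; rewrite ?mulr_ge0 ?exprn_ge0 ?nm_ge0 //.
  by have := @nmX_le _ p 1 k.+1 p1 isT; rewrite expr1.
apply/eqP; rewrite -subr_eq0; apply/eqP; apply: nm_le0_eq => e e0.
have M0 : 0 <= M by have := hM [::] isT; rewrite big_nil.
pose c := 2 * (B * M) + 1.
have c0 : 0 < c by rewrite /c; have := mulr_ge0 (ltW B0) M0; lra.
have ec : 0 < e / c by rewrite divr_gt0.
have [N hN] := asum_small (asum_geometric 1 p1) ec.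
have := hN N (leqnn N); rewrite mul1r nmX => h.
apply: le_trans (step r N) _.
have -> : e = e / c * c by rewrite divfK // gt_eqF.
rewrite ler_pM ?exprn_ge0 ?nm_ge0 //.
apply: le_trans (nmB _ _) _; rewrite /c.
by have := bF (r + N)%N; have := bF (r + N).+1; lra.
Qed.

(** The sum is independent of r by [cauchy_const], and as r tends to infinity only the term
    m = 0 survives. *)
Lemma cauchy_sum r : has_sum (cauchyT r) (qp p p)^-1.
Proof.
suff <- : F r = (qp p p)^-1 by [].
have FE k : F (r + k)%N = F r by elim: k => [|k IH]; rewrite ?addn0 // addnS -cauchy_const.
have [B B0 hB] := cauchyT_bounded.
pose f (m : nat) : C := if m == 0%N then (qp p p)^-1 else 0.
have hs : has_sum f (qp p p)^-1.
  have := @has_sum_supp R nat [:: 0%N] f isT; rewrite big_seq1 /f /=; apply.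
  by move=> i; rewrite inE; case: eqP.
apply: tends_unique (tends_cst (F r)) _.
apply: (@tannery _ _ (fun m => B * nm p ^+ m) (fun k => cauchyT (r + k))) hs.
- exact: bsumZ (ltW B0) (bsum_geometric p1).
- move=> k m; apply: le_trans (hB _ m) _; rewrite ler_wpM2l ?(ltW B0) //.
  by apply: (nmX_le p1); case: m => // m; rewrite mulSn; lia.
- move=> [|m].
    rewrite /f /=; apply: (@tends_shift _ _ _ 0).
    have h := tendsV (qpoch_pp_neq0 p1) (poch_tends p p1).
    apply: eq_tends (tends_comp (f := fun k => (r + k)%N) _ h) => [k|N].
      by rewrite /cauchyT mul0n !add0n poch0 expr0 !mul1r.
    by exists N => k hk; lia.
  move=> e e0; rewrite /f /=.
  have ec : 0 < e / (2 * B) by rewrite divr_gt0 // mulr_gt0.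
  have [N hN] := asum_small (asum_geometric 1 p1) ec.
  exists N => k hk; have := hN k hk; rewrite mul1r nmX subr0 => h.
  apply: le_lt_trans (hB _ _) _.
  apply: (@le_lt_trans _ _ (B * (e / (2 * B)))).
    rewrite ler_wpM2l ?(ltW B0) //; apply: le_trans h; apply: (nmX_le p1); nia.
  have -> : B * (e / (2 * B)) = e / 2 by field; rewrite gt_eqF.
  by lra.
- by move=> k; rewrite -[X in has_sum _ X](FE k); exact: FP.
Qed.
End Cauchy.

Section Bailey.
Variable R : realType.
Local Notation C := R[i].
Local Notation K := (R[i] : numFieldType).
Local Notation qp := (@qpoch K).
Variable s : C.
Hypotheses (s0 : s != 0) (s1 : nm s < 1).
Local Notation p := (s ^+ 2).

Let p0 : p != 0. Proof. by rewrite expf_neq0. Qed.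
Let p1 : nm p < 1. Proof. exact: nmX_lt1. Qed.

Variable x : C.
Hypotheses (x0 : x != 0) (hx : forall n : int, x * p ^ n != 1).

Lemma recip_fintheta1 N : (fintheta x p N.+1)^-1 =
  \sum_(0 <= J < 2 * N.+1) lamT s (- s) x p (J%:Z - N.+1%:Z) /
     (poch p p J * poch p p ((2 * N).+1 - J)).
Proof.
have b0 (i : 'I_1) : (1 : C) != 0 by exact: oner_neq0.
have hb (i k : 'I_1) : i != k -> forall n : int, (1 : C) / 1 * p ^ n != 1.
  by rewrite !ord1 eqxx.
have hx' (i : 'I_1) (n : int) : x * 1 * p ^ n != 1 by rewrite mulr1.
have := fintheta_partial_fractions s0 s1 b0 hb x0 isT (ltn0Sn N) hx'.
rewrite !big_ord1 mulr1 => ->; rewrite big_mkord; apply: eq_bigr => J _.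
rewrite /pf_coef !(big_pred0 _ _ _ (P := fun k : 'I_1 => k != ord0)); first last.
  by move=> k; rewrite ord1 eqxx.
  by move=> k; rewrite ord1 eqxx.
rewrite !mulr1 !expr1 mulrC; congr (_ / (_ * poch _ _ _)).
by have := ltn_ord J; lia.
Qed.

(** Identifies j and - 1 - j: the partial fraction coefficients at these two poles agree. *)
Definition fold_int (j : int) : nat := match j with Posz k => k | Negz k => k end.

(** What the n-th summand contributes to the coefficient of the poles k and - 1 - k. *)
Definition bailey_coef (k n : nat) : C :=
  if (k <= n)%N then p ^+ (n * n + n) / (poch p p (n - k) * poch p p (n + k).+1)
  else 0.

Lemma bailey_row n :
  has_sum (fun j : int => bailey_coef (fold_int j) n * lamT s (- s) x p j)
    (p ^+ (n * n + n) / fintheta x p n.+1).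
Proof.
pose A := [seq J%:Z - n.+1%:Z | J <- index_iota 0 (2 * n.+1)].
have uA : uniq A.
  rewrite map_inj_uniq ?iota_uniq // => a b /eqP h; apply/eqP.
  by move: h; lia.
have := @has_sum_supp R int A (fun j => bailey_coef (fold_int j) n * lamT s (- s) x p j) uA.
have -> : \sum_(i <- A) bailey_coef (fold_int i) n * lamT s (- s) x p i =
   p ^+ (n * n + n) / fintheta x p n.+1.
  rewrite /A big_map recip_fintheta1 big_distrr /=.
  rewrite [LHS]big_nat_cond [RHS]big_nat_cond; apply: eq_bigr => J /andP[/andP[_ hJ] _].
  rewrite [X in _ = _ * X]mulrC [RHS]mulrA /bailey_coef.
  congr (_ * _).
  have [h|h] := leqP n.+1 J.
    have -> : J%:Z - n.+1%:Z = (J - n.+1)%N%:Z by lia.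
    rewrite /fold_int ifT; last by lia.
    have -> : (n - (J - n.+1) = (2 * n).+1 - J)%N by lia.
    have -> : ((n + (J - n.+1)).+1 = J)%N by lia.
    by rewrite (mulrC (poch p p _)).
  have -> : J%:Z - n.+1%:Z = Negz (n - J)%N by lia.
  rewrite /fold_int ifT; last by lia.
  have -> : (n - (n - J) = J)%N by lia.
  by have -> : ((n + (n - J)).+1 = (2 * n).+1 - J)%N by lia.
apply => j hj; rewrite /bailey_coef; case: ifP => h; last by rewrite mul0r.
case/negP: hj; apply/mapP; case: j h => k /= h.
  by exists (n.+1 + k)%N; [rewrite mem_index_iota; lia | lia].
by exists (n - k)%N; [rewrite mem_index_iota; lia | lia].
Qed.

(** Cauchy's identity with r = 2k + 1, after the substitution n = k + m. *)
Lemma bailey_column k : has_sum (bailey_coef k) (p ^+ (k * k + k) / qp p p).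
Proof.
have h := has_sumZ (p ^+ (k * k + k)) (cauchy_sum p1 (2 * k).+1).
have := @has_sum_reindex R nat nat (fun n => k <= n)%N (fun n => n - k)%N _ _ _ _ h.
move=> h2; apply: eq_has_sum (h2 _ _) => [n|m n|m _].
- rewrite /bailey_coef; case: ifP => // kn.
  rewrite /cauchyT mulrA -(exprD p).
  have -> : (k * k + k + ((n - k) * (n - k) + (n - k) * (2 * k).+1) = n * n + n)%N by nia.
  by have -> : (n - k + (2 * k).+1 = (n + k).+1)%N by lia.
- by rewrite /in_mem /=; lia.
- by exists (k + m)%N; lia.
Qed.

Lemma lamT_cube j : p ^+ (fold_int j * fold_int j + fold_int j) * lamT s (- s) x p j =
  lamT (s ^+ 3) (- s ^+ 3) x p j.
Proof.
have e : p ^+ (fold_int j * fold_int j + fold_int j) = p ^ (j * j + j).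
  by rewrite exprnP; congr (_ ^ _); case: j => k; rewrite /fold_int; nia.
rewrite e /lamT mulrA; congr (_ / _).
have f m (l : int) : (s ^+ m) ^ l = s ^ (m%:Z * l) by rewrite [s ^+ m]exprnP exprz_exp.
have g (a : C) : (- a) ^ j = (- 1) ^ j * a ^ j.
  by rewrite -[- a]mulN1r expfzMl.
rewrite (g s) (g (s ^+ 3)) !f.
have -> : 2%:Z * (j * j + j) = (j * j) + (j * j) + j + j by ring.
have -> : 3%:Z * (j * j) = (j * j) + (j * j) + (j * j) by ring.
have -> : 3%:Z * j = j + j + j by ring.
rewrite !(expfzDr _ _ s0).
by move: (s ^ (j * j)) (s ^ j) ((- 1) ^ j) => u v w; ring.
Qed.

(** The double family over poles and summands is dominated by the product of the terms of
    an Appell-Lerch sum and a geometric series.  Its rows are the partial fractions of the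
    summands, its columns are evaluated by Cauchy's identity. *)
Lemma bailey : has_sum (fun n => p ^+ (n * n + n) / fintheta x p n.+1)
  (lam (s ^+ 3) (- s ^+ 3) x p / qp p p).
Proof.
pose f (jn : int * nat) :=
  bailey_coef (fold_int jn.1) jn.2 * lamT s (- s) x p jn.1.
have [B B0 hB] := poch_inv_bounded p1 (pp_neq1 p1).
have af : asum f.
  have g1 := asum_prod (asum_lam (- s) x s1 p0 p1) (asum_geometric 1 p1).
  have BB : 0 <= B * B by rewrite mulr_ge0 ?(ltW B0).
  apply: asum_le (bsumZ BB g1) => -[j n]; rewrite /f /= mul1r.
  rewrite (nmM (bailey_coef _ _)) (nmM (lamT _ _ _ _ _)) mulrC mulrCA ler_wpM2l ?nm_ge0 //.
  rewrite /bailey_coef; case: ifP => _; last by rewrite nm0 mulr_ge0 ?nm_ge0.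
  rewrite nmM mulrC ler_pM ?nm_ge0 //.
    by rewrite invfM nmM ler_pM ?nm_ge0.
  by rewrite !(nmX p); apply: (nmX_le p1); case: n => // n; rewrite mulSn; lia.
have [t ht] := asum_has_sum af.
have h1 : has_sum (fun j => lamT s (- s) x p j * (p ^+ (fold_int j * fold_int j + fold_int j) /
    qp p p)) t.
  apply: has_sum_fubini ht _ => j; rewrite /f /=.
  by apply: eq_has_sum (has_sumZ _ (bailey_column _)) => n; rewrite mulrC.
have -> : lam (s ^+ 3) (- s ^+ 3) x p / qp p p = t.
  rewrite mulrC; apply: has_sum_unique h1.
  have := lamP (- s ^+ 3) x (nmX_lt1 s1 (m := 3) isT) p0 p1.
  move=> /(has_sumZ (qp p p)^-1); apply: eq_has_sum => j.
  by rewrite -lamT_cube; move: (lamT _ _ _ _ _) (p ^+ _) => a b; ring.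
pose f' (nj : nat * int) := f (nj.2, nj.1).
have h2 : has_sum f' t.
  by apply: (has_sum_bij (h := fun nj : nat * int => (nj.2, nj.1))) ht;
     exists (fun jn : int * nat => (jn.2, jn.1)) => -[].
by apply: has_sum_fubini h2 _ => n; exact: bailey_row.
Qed.
End Bailey.

(** * Generating functions of odd Durfee symbols *)

Section Rows.

(** Bounding the entries by [2 * L] instead of [2 * D + 1] lets the induction start at the
    empty row. *)
Definition odd_row_below (L : nat) (a : seq nat) : bool :=
  [&& all odd a, sorted geq a & all (fun x => x < 2 * L)%N a].

Lemma odd_durfee_rowE D a : odd_durfee_row D a = odd_row_below D.+1 a.
Proof.
congr [&& _, _ & _]; apply: eq_all => x.
by lia.
Qed.

Lemma odd_row_below0 a : odd_row_below 0 a = (a == [::]).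
Proof. by case: a => [|x a] //=; rewrite /odd_row_below /= !andbF. Qed.

Lemma geq_trans : transitive geq.
Proof. by move=> y x z /= xy yz; apply: leq_trans yz xy. Qed.

Lemma sorted_geq_split M a : sorted geq a -> all (fun x => x <= M)%N a ->
  a = nseq (count_mem M a) M ++ [seq x <- a | x != M].
Proof.
elim: a => [//|x a IH] /=; rewrite (path_sortedE geq_trans) => /andP[xa sa] /andP[xM aM].
have [-> /=|xM'] := eqVneq x M; first by rewrite add0n -IH.
have e : all (fun y => y != M) a.
  apply/allP => y /(allP xa) /= yx.
  by apply: contra xM' => /eqP yM; rewrite eqn_leq xM /= -yM.
rewrite (all_filterP e) (_ : count_mem M a = 0%N) //.
by apply/eqP; rewrite -leqn0 leqNgt -has_count; apply/hasPn => y /(allP e).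
Qed.

Lemma odd_row_cat_nseq L m a : odd_row_below L a ->
  odd_row_below L.+1 (nseq m (2 * L).+1 ++ a).
Proof.
move=> /and3P[h1 h2 h3]; apply/and3P; split.
- by rewrite all_cat h1 andbT; apply/allP => x /nseqP[-> _]; rewrite /= oddM.
- elim: m => [//|m IH]; rewrite /= (path_sortedE geq_trans) IH andbT all_cat.
  apply/andP; split; first by apply/allP => x /nseqP[-> _] /=.
  by apply/allP => x /(allP h3) /=; lia.
- rewrite all_cat; apply/andP; split; first by apply/allP => x /nseqP[-> _]; lia.
  by apply/allP => x /(allP h3); lia.
Qed.

(** A row is the same as the multiplicity of its largest admissible entry [2 * L + 1]
    together with a row whose entries are below [2 * L]; on generating functions this
    bijection adds one geometric series. *)
Definition peel (L : nat) (a : seq nat) : nat * seq nat :=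
  (count_mem (2 * L).+1 a, [seq x <- a | x != (2 * L).+1]).

Lemma peelK L a : odd_row_below L.+1 a ->
  a = nseq (peel L a).1 (2 * L).+1 ++ (peel L a).2.
Proof.
move=> /and3P[_ h2 h3]; apply: sorted_geq_split => //.
by apply/allP => x /(allP h3); lia.
Qed.

Lemma peel_row L a : odd_row_below L.+1 a -> odd_row_below L (peel L a).2.
Proof.
move=> /and3P[h1 h2 h3]; apply/and3P; split.
- by apply/allP => x; rewrite mem_filter => /andP[_ /(allP h1)].
- by apply: sorted_filter => //; exact: geq_trans.
- apply/allP => x; rewrite mem_filter => /andP[/eqP xL xa].
  by have := allP h1 _ xa; have := allP h3 _ xa; lia.
Qed.

Lemma peel_cat L m a : odd_row_below L a -> peel L (nseq m (2 * L).+1 ++ a) = (m, a).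
Proof.
move=> /and3P[_ _ h3]; have e : all (fun x => x != (2 * L).+1) a.
  by apply/allP => x /(allP h3); lia.
rewrite /peel count_cat filter_cat (all_filterP e) count_nseq /= eqxx mul1n.
rewrite (_ : count_mem _ a = 0%N); last first.
  by apply/eqP; rewrite -leqn0 leqNgt -has_count; apply/hasPn => y /(allP e).
have -> : [seq x <- nseq m (2 * L).+1 | x != (2 * L).+1] = [::].
  by elim: m => //= m ->; rewrite eqxx.
by rewrite addn0.
Qed.

End Rows.

Section RowSums.
Variable R : realType.
Local Notation C := R[i].
Implicit Types (z q : C).

Definition rowT (L : nat) z q (a : seq nat) : C :=
  if odd_row_below L a then z ^+ size a * q ^+ sumn a else 0.

Lemma rowT_peel L z q a :
  rowT L.+1 z q a = if odd_row_below L.+1 a then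
    (z * q ^+ (2 * L).+1) ^+ (peel L a).1 * rowT L z q (peel L a).2 else 0.
Proof.
rewrite /rowT; case: ifP => // h; rewrite (peel_row h) {1 2}(peelK h).
rewrite size_cat size_nseq sumn_cat sumn_nseq exprMn.
rewrite (exprD z) (exprD q (_ * _)) (exprM q (2 * L).+1).
by rewrite mulrACA.
Qed.

Lemma peel_inj L : {in odd_row_below L.+1 &, injective (peel L)}.
Proof. by move=> a b ha hb h; rewrite (peelK ha) (peelK hb) h. Qed.

Lemma nm_zq z q k : nm z <= 1 -> nm q < 1 -> nm (z * q ^+ k.+1) < 1.
Proof.
move=> z1 q1; rewrite nmM; apply: le_lt_trans (nmX_lt1 q1 (ltn0Sn k)).
by rewrite ler_piMl ?nm_ge0.
Qed.

Lemma asum_rowT L z q : nm z <= 1 -> nm q < 1 -> asum (rowT L z q).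
Proof.
move=> z1 q1; elim: L => [|L IH].
  exists 1 => B uB; rewrite (bigID (pred1 [::])) /= [X in _ + X]big1 ?addr0; last first.
    by move=> a /negPf an; rewrite /rowT odd_row_below0 an nm0.
  rewrite -big_filter; have [nB|nB] := boolP ([::] \in B).
    by rewrite filter_pred1_uniq // big_seq1 /rowT odd_row_below0 eqxx mul1r expr0 nm1.
  rewrite big_filter big1_seq //= => a /andP[/eqP -> h]; by rewrite h in nB.
have g := asum_geometric 1 (nm_zq (2 * L) z1 q1).
have := asum_reindex (@peel_inj L) (asum_prod g IH); apply: bsum_le => a.
by rewrite rowT_peel mul1r.
Qed.

Lemma has_sum_rowT L z q : nm z <= 1 -> nm q < 1 ->
  has_sum (rowT L z q) (poch (z * q) (q ^+ 2) L)^-1.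
Proof.
move=> z1 q1; elim: L => [|L IH].
  rewrite poch0 invr1; have := @has_sum_supp R _ [:: [::]] (rowT 0 z q) isT.
  rewrite big_seq1 /rowT odd_row_below0 eqxx mul1r expr0; apply => a.
  by rewrite inE odd_row_below0 => /negPf ->.
have n1 := nm_zq (2 * L) z1 q1.
have g : asum (fun m : nat => (z * q ^+ (2 * L).+1) ^+ m).
  by apply: asum_le (asum_geometric 1 n1) => m; rewrite mul1r.
have := has_sum_prod g (asum_rowT L z1 q1) (has_sum_geometric n1) IH.
have -> : (1 - z * q ^+ (2 * L).+1)^-1 * (poch (z * q) (q ^+ 2) L)^-1 =
   (poch (z * q) (q ^+ 2) L.+1)^-1.
  by rewrite pochS invfM mulrC -(exprM q) -mulrA -(exprS q).
move=> h; apply: eq_has_sum (has_sum_reindex (@peel_inj L) _ h).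
- by move=> a; rewrite rowT_peel.
- move=> [m a] /= ma; have ra : odd_row_below L a.
    by move: ma; rewrite /rowT; case: ifP => // _; rewrite mulr0 eqxx.
  by exists (nseq m (2 * L).+1 ++ a); [exact: odd_row_cat_nseq | exact: peel_cat].
Qed.

Lemma nm_rowT L z q a : nm z = 1 ->
  nm (rowT L z q a) = if odd_row_below L a then nm q ^+ sumn a else 0.
Proof.
by move=> z1; rewrite /rowT; case: ifP => _; rewrite ?nm0 // nmM !nmX z1 expr1n mul1r.
Qed.

(** For z = 1 and q replaced by |q| the terms are nonnegative, so partial sums are at most
    the sum, which is bounded in [L] because the infinite product is not 0. *)
Lemma rowT_uniform_bound q : nm q < 1 -> exists2 M, 0 < M &
  forall L z, nm z = 1 -> forall B : seq (seq nat), uniq B -> \sum_(a <- B) nm (rowT L z q a) <=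
      M.
Proof.
move=> q1; pose r := real_complex R (nm q).
have r1 : nm r < 1 by rewrite nm_real ger0_norm ?nm_ge0.
have r21 : nm (r ^+ 2) < 1 by apply: nmX_lt1.
have hr k : 1 * r * (r ^+ 2) ^+ k != 1.
  rewrite mul1r -(exprM r) -(exprS r); exact: expf_neq1.
have [M M0 hM] := poch_inv_bounded r21 hr.
exists M => // L z z1 B uB; apply: le_trans (hM L).
have le11 : nm (1 : C) <= 1 by rewrite nm1.
apply: has_sum_partial_le (has_sum_rowT L le11 r1) uB => a; first exact: nm_ge0.
rewrite nm_rowT // /rowT; case: ifP => _; last by rewrite raddf0.
by rewrite expr1n mul1r rmorphXn.
Qed.

End RowSums.

Section Symbols.
Variable R : realType.
Local Notation C := R[i].
Local Notation K := (R[i] : numFieldType).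
Variables (z q : C).
Hypotheses (z1 : nm z = 1) (q0 : q != 0) (q1 : nm q < 1).

Local Notation symbol := (seq nat * seq nat * nat)%type.

Definition symbol_weight (w : symbol) : nat :=
  let: (a, b, D) := w in (sumn a + sumn b + 2 * D ^ 2 + 2 * D + 1)%N.

Definition symbolT (w : symbol) : C :=
  let: (a, b, D) := w in
  q ^+ (2 * D ^ 2 + 2 * D + 1) * (rowT D.+1 z q a * rowT D.+1 z^-1 q b).

Let z0 : z != 0. Proof. by rewrite -nm_gt0 z1. Qed.
Let zV1 : nm z^-1 = 1. Proof. by rewrite nmV z1 invr1. Qed.
Let zle : nm z <= 1. Proof. by rewrite z1. Qed.
Let zVle : nm z^-1 <= 1. Proof. by rewrite zV1. Qed.

Lemma odd_durfeeE n w : odd_durfee n w = odd_durfee (symbol_weight w) w && (n == symbol_weight w).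
Proof.
case: w => [[a b] D]; rewrite /odd_durfee /symbol_weight eqxx andbT -andbA.
by [].
Qed.

Lemma symbolT_durfee w : symbolT w =
  if odd_durfee (symbol_weight w) w then z ^ odd_rank w * q ^+ symbol_weight w else 0.
Proof.
case: w => [[a b] D]; rewrite /symbolT /rowT /odd_durfee !odd_durfee_rowE eqxx andbT.
case: ifP => _; last by rewrite mul0r mulr0.
case: ifP => _; last by rewrite !mulr0.
rewrite /odd_rank /symbol_weight (expfzDr _ _ z0) -(exprnP z) -exprnN exprVn.
have -> : (sumn a + sumn b + 2 * D ^ 2 + 2 * D + 1 = 2 * D ^ 2 + 2 * D + 1 + (sumn a + sumn b))%N.
  by lia.
rewrite (exprD q (2 * D ^ 2 + 2 * D + 1)) (exprD q (sumn a)).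
move: (q ^+ (2 * D ^ 2 + 2 * D + 1)) (q ^+ sumn a) (q ^+ sumn b) => u v w.
move: (z ^+ size a) (z ^+ size b)^-1 => y y'.
by ring.
Qed.

(** The summation order: subscript and first row outside, second row inside. *)
Let Tri (i : nat * seq nat * seq nat) : symbol := (i.1.2, i.2, i.1.1).

Let head (i : nat * seq nat) : C :=
  q ^+ (2 * i.1 ^ 2 + 2 * i.1 + 1) * rowT i.1.+1 z q i.2.

Let symbolT_Tri i : symbolT (Tri i) = head i.1 * rowT i.1.1.+1 z^-1 q i.2.
Proof. by rewrite /head -mulrA. Qed.

Let asum_head : asum head.
Proof.
have [M M0 hM] := rowT_uniform_bound q1.
apply: (@asum_tonelli _ _ _ _ (fun D : nat => nm q ^+ (2 * D ^ 2 + 2 * D + 1) * M)).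
  have := bsumZ (ltW M0) (bsum_geometric q1); apply: bsum_le => D.
  by rewrite mulrC ler_wpM2l ?(ltW M0) //; apply: (nmX_le q1); lia.
move=> D B uB; rewrite /head /=.
rewrite (eq_bigr _ (fun i _ => nmM _ _)) -big_distrr /= nmX ler_wpM2l ?exprn_ge0 ?nm_ge0 //.
exact: hM.
Qed.

Let asum_Tri : asum (fun i => symbolT (Tri i)).
Proof.
have [M M0 hM] := rowT_uniform_bound q1.
apply: (@asum_tonelli _ _ _ _ (fun i => M * nm (head i))).
  exact: bsumZ (ltW M0) asum_head.
move=> i B uB; rewrite (eq_bigr _ (fun b _ => congr1 (@nm R) (symbolT_Tri (i, b)))) /=.
rewrite (eq_bigr _ (fun b _ => nmM _ _)) -big_distrr /= mulrC ler_wpM2r ?nm_ge0 //.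
exact: hM.
Qed.

Let Tri_bij : bijective Tri.
Proof. by exists (fun w : symbol => ((w.2, w.1.1), w.1.2)) => [[[]]|[[]]]. Qed.

Lemma asum_symbolT : asum symbolT.
Proof.
have [g _ gK] := Tri_bij.
have := asum_inj (can_inj gK) asum_Tri; apply: bsum_le => w.
by rewrite gK.
Qed.

Lemma has_sum_symbolT t :
  has_sum (fun D => q ^+ (2 * D ^ 2 + 2 * D + 1) / (poch (z * q) (q ^+ 2) D.+1 *
      poch (z^-1 * q) (q ^+ 2) D.+1)) t -> has_sum symbolT t.
Proof.
move=> ht; have h := csumP asum_symbolT; suff -> : t = csum symbolT by [].
have h1 := has_sum_bij Tri_bij h.
have h2 : has_sum (fun i => head i * (poch (z^-1 * q) (q ^+ 2) i.1.+1)^-1) (csum symbolT).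
  apply: has_sum_fubini h1 _ => i.
  apply: eq_has_sum (has_sumZ _ (has_sum_rowT i.1.+1 zVle q1)) => b.
  by rewrite symbolT_Tri.
apply: has_sum_unique ht _; apply: has_sum_fubini h2 _ => D; rewrite /head /=.
have := has_sumZ (q ^+ (2 * D ^ 2 + 2 * D + 1) / poch (z^-1 * q) (q ^+ 2) D.+1)
  (has_sum_rowT D.+1 zle q1).
have -> : q ^+ (2 * D ^ 2 + 2 * D + 1) / poch (z^-1 * q) (q ^+ 2) D.+1 /
   poch (z * q) (q ^+ 2) D.+1 = q ^+ (2 * D ^ 2 + 2 * D + 1) /
   (poch (z * q) (q ^+ 2) D.+1 * poch (z^-1 * q) (q ^+ 2) D.+1).
  by rewrite -mulrA; congr (_ * _); rewrite invfM mulrC.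
by apply: eq_has_sum => a; rewrite mulrAC.
Qed.

(** Every symbol of weight n contributes |q|^n to an absolutely convergent series. *)
Lemma finite_odd_durfee n : finite_set [set w : symbol | odd_durfee n w].
Proof.
apply: contrapT => inf; have [M hM] := asum_symbolT.
have [N hN] : exists N : nat, M / nm q ^+ n < N%:R.
  by exists (Num.truncn (M / nm q ^+ n)).+1; exact: truncnS_gt.
have [B sB cB] := @infinite_set_fset _ _ N inf.
have := hM B (fset_uniq B).
have qn0 : 0 < nm q ^+ n by rewrite exprn_gt0 // nm_gt0.
have -> : \sum_(w <- B) nm (symbolT w) = #|` B|%:R * nm q ^+ n.
  have e w : w \in B -> nm (symbolT w) = nm q ^+ n.
    move=> /sB /=; rewrite odd_durfeeE symbolT_durfee => /andP[-> /eqP ->].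
    by rewrite nmM nmXz z1 nmX exp1rz mul1r.
  rewrite big_seq (eq_bigr _ e) -big_seq big_const_seq count_predT.
  by rewrite iter_addr_0 [RHS]mulr_natl.
rewrite -ler_pdivlMr // => h; have := le_lt_trans h hN.
by rewrite ltr_nat ltnNge cB.
Qed.

(** The symbols of weight [n], grouped by their rank. *)
Lemma sum_N0 n : has_sum (fun w => if n == symbol_weight w then symbolT w else 0)
  (\sum_(m \in [set: int]) ((N0 m n)%:R * (z : K) ^ m * (q : K) ^+ n)).
Proof.
pose S := fset_set [set w : symbol | odd_durfee n w].
have inS w : (w \in S) = odd_durfee n w.
  rewrite (in_fset_set (finite_odd_durfee n)).
  by apply/idP/idP => [/set_mem //|h]; apply/mem_set.
have N0E m : N0 m n = #|` [fset w in S | odd_rank w == m]%fset|.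
  have fin : finite_set [set w : symbol | odd_durfee n w /\ odd_rank w = m].
    by apply: sub_finite_set (finite_odd_durfee n) => w [].
  rewrite /N0; congr (#|` _|); apply/fsetP => w; rewrite (in_fset_set fin).
  rewrite !inE /= inS; apply/idP/andP => [/set_mem[-> ->]|[h /eqP e]] //.
  exact/mem_set.
have -> : \sum_(m \in [set: int]) ((N0 m n)%:R * z ^ m * q ^+ n) =
   \sum_(w <- S) z ^ odd_rank w * q ^+ n.
  rewrite (partition_big_imfset _ odd_rank).
  rewrite (fsbigTE [fset odd_rank w | w in S]%fset).
    apply: eq_bigr => m _; rewrite N0E.
    rewrite (eq_bigr (fun _ => z ^ m * q ^+ n)) => [|w /eqP -> //].
    rewrite big_fset_condE /= big_const_seq.
    by rewrite count_predT iter_addr_0 -mulrA [LHS]mulr_natl.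
  move=> m hm; rewrite N0E (_ : [fset w in S | _]%fset = fset0) ?cardfs0 ?mul0r //.
  apply/fsetP => w; rewrite !inE /=; apply/negP => /andP[wS /eqP e].
  by case/negP: hm; apply/imfsetP; exists w.
have := @has_sum_supp R _ S (fun w => if n == symbol_weight w then symbolT w else 0) (fset_uniq
    S).
rewrite (_ : \sum_(w <- S) _ = \sum_(w <- S) z ^ odd_rank w * q ^+ n).
  apply => w; rewrite inS odd_durfeeE symbolT_durfee; case: eqP => // _; rewrite andbT.
  by move=> /negPf ->.
apply: eq_big_seq => w; rewrite inS odd_durfeeE symbolT_durfee => /andP[-> /eqP ->].
by rewrite eqxx.
Qed.

(** All symbols, grouped by their weight. *)
Lemma R0_eq t : has_sum symbolT t -> R0 (z : K) q = t.
Proof.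
move=> ht; rewrite /R0; apply: limn_eq; rewrite /series /=; apply: has_sum_series.
pose D (nw : nat * symbol) := nw.1.+1 == symbol_weight nw.2.
have h := @has_sum_reindex R _ _ D snd symbolT t _ _ ht.
have h1 := h _ _; apply: has_sum_fubini (h1 _ _) _ => [||n].
- move=> [n w] [m v]; rewrite /in_mem /D /= => /eqP e1 /eqP e2 e3.
  by move: e1; rewrite e3 -e2 => -[->].
- move=> w _; exists ((symbol_weight w).-1, w) => //.
  by rewrite /D /=; case: w => [[a b] d] /=; rewrite addn1.
- exact: (sum_N0 n.+1).
Qed.
End Symbols.

(** * Specialization to the fifth root of unity *)

Section Final.
Variable R : realType.
Local Notation C := R[i].
Local Notation K := (R[i] : numFieldType).
Local Notation qp := (@qpoch K).

(** [bailey] with base q^2 at x = z q. *)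
Lemma R0_lerch (z q : C) : nm z = 1 -> q != 0 -> nm q < 1 ->
  R0 (z : K) q = q * lam (q ^+ 3) (- q ^+ 3) (z * q) (q ^+ 2) / qp (q ^+ 2) (q ^+ 2).
Proof.
move=> z1 q0 q1; have z0 : z != 0 by rewrite -nm_gt0 z1.
have x0 : z * q != 0 by rewrite mulf_neq0.
have hx (n : int) : z * q * (q ^+ 2) ^ n != 1.
  rewrite -mulrA [q ^+ 2]exprnP exprz_exp -{1}(expr1z q) -(expfzDr _ _ q0).
  apply/eqP => /(congr1 (@nm R)); rewrite nmM z1 mul1r nmXz nm1 => h.
  have q0' : 0 < nm q by rewrite nm_gt0.
  have : (nm q ^ (1 + 2%:Z * n) == nm q ^ 0) by rewrite h.
  rewrite (inj_eq (ieexprIz _ _)) //; first by lia.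
  by rewrite lt_eqF.
apply: R0_eq => //; apply: has_sum_symbolT => //.
have := has_sumZ q (bailey q0 q1 x0 hx); rewrite mulrA.
apply: eq_has_sum => D; rewrite mulrA /fintheta -(exprM q) -(exprS q).
have -> : (2 * (D * D + D)).+1 = (2 * D ^ 2 + 2 * D + 1)%N by nia.
by have -> : q ^+ 2 / (z * q) = z^-1 * q by field; rewrite z0 q0.
Qed.

Lemma nmC (a b : R) : nm (Complex a b) = Num.sqrt (a ^+ 2 + b ^+ 2).
Proof. by []. Qed.

Lemma nm_cexp (w : C) : nm (cexp w) = expR (complex.Re w).
Proof.
case: w => a b; rewrite /cexp nmC !exprMn -mulrDr cos2Dsin2 mulr1.
by rewrite sqrtr_sqr ger0_norm // expR_ge0.
Qed.

Lemma cexpD (v w : C) : cexp (v + w) = cexp v * cexp w.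
Proof.
case: v w => a b [c d]; rewrite /cexp /= expRD cosD sinD.
by apply/eqP; rewrite eq_complex /=; apply/andP; split; apply/eqP; ring.
Qed.

Lemma cexp0 : cexp (0 : C) = 1.
Proof. by rewrite /cexp /= expR0 cos0 sin0 mulr0 mulr1. Qed.

Lemma cexpMn (w : C) n : cexp (w *+ n) = cexp w ^+ n.
Proof. by elim: n => [|n IH]; rewrite ?mulr0n ?cexp0 ?expr0 // mulrS cexpD IH exprS. Qed.

Lemma nm_nome tau : nm (nome tau : C) = expR (- (2 * pi * complex.Im tau)).
Proof.
rewrite /nome nm_cexp; congr (expR _); case: tau => a b /=; ring.
Qed.

Lemma zeta5_angle : (2 * (pi : R)%:C * 'i / 5 : C)%C = Complex 0 (2 * pi / 5).
Proof.
apply: (canLR (mulfK _)); first by rewrite pnatr_eq0.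
by apply/eqP; rewrite eq_complex /=; apply/andP; split; apply/eqP; field.
Qed.

Lemma nm_zeta5 : nm (zeta5 : C) = 1.
Proof. by rewrite /zeta5 zeta5_angle nm_cexp /= expR0. Qed.

Lemma zeta5X5 : (zeta5 : C) ^+ 5 = 1.
Proof.
rewrite /zeta5 zeta5_angle -cexpMn.
have -> : (Complex 0 (2 * pi / 5) : C) *+ 5 = Complex 0 (pi *+ 2).
  by apply/eqP; rewrite eq_complex /=; apply/andP; split; apply/eqP; field.
by rewrite /cexp /= expR0 cos2pi sin2pi !mul1r.
Qed.

(** The root of unity differs from 1 because sin (2 pi / 5) is positive. *)
Lemma zeta5_sum : 1 + (zeta5 : C) + zeta5 ^+ 2 + zeta5 ^+ 3 + zeta5 ^+ 4 = 0.
Proof.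
have z1 : (zeta5 : C) - 1 != 0.
  rewrite subr_eq0 /zeta5 zeta5_angle /cexp /= expR0 !mul1r; apply/eqP => -[_].
  have : 0 < sin (2 * pi / 5 : R).
    by apply: sin_gt0_pi; have := pi_gt0 R => ?; apply/andP; split; lra.
  by move=> h e; rewrite e ltxx in h.
apply: (mulfI z1); rewrite mulr0; transitivity ((zeta5 : C) ^+ 5 - 1); first by ring.
by rewrite zeta5X5 subrr.
Qed.

Lemma Src_S5 (r : int) tau : nome tau != 0 :> C -> nm (nome tau) < 1 ->
  Src r 5 tau = S5 (nome tau : C) r.
Proof.
move=> q0 q1; rewrite /Src /S5.
move: (nome tau) q0 q1 => q q0 q1.
have q75 := nmX_lt1 q1 (m := 75) isT.
have q150 := nmX_lt1 q1 (m := 150) isT.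
have q150' : q ^+ 150 != 0 by rewrite expf_neq0.
have h1 := asum_lam (- q ^ 125%:Z) (q ^ (30%:Z * r - 15%:Z)) q75 q150' q150.
have h2 := lamP (- q ^ 125%:Z) (q ^ (30%:Z * r - 15%:Z)) q75 q150' q150.
set f := fun n : int => _ / (1 + _).
have e : f =1 lamT (q ^+ 75) (- q ^ 125%:Z) (q ^ (30%:Z * r - 15%:Z)) (q ^+ 150).
  move=> n; rewrite /f /lamT.
  have -> : (- 1) ^ (5 : int) = - 1 :> C.
    have -> : (5 : int) = 5%:Z by [].
    by rewrite -(exprnP (- 1)) -signr_odd.
  have -> : 3 * 5 ^+ 2 * n ^+ 2 + 5 * 5 ^+ 2 * n = 75%:Z * (n * n) + 125%:Z * n by ring.
  have -> : 6 * 5 ^+ 2 * n + (2 + 6 * r - 5) * 5 = (30%:Z * r - 15%:Z) + 150%:Z * n by ring.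
  have -> : (- q ^ 125%:Z) ^ n = (- 1) ^ n * q ^ (125%:Z * n).
    by rewrite -[- q ^ _]mulN1r expfzMl exprz_exp.
  rewrite !qpow !(expfzDr _ _ q0) mulN1r; congr (_ / _).
  by rewrite mulrCA.
have -> : bilateral (f : int -> K) = qlam q 75 125%:Z (30%:Z * r - 15%:Z) 150.
  apply: bilateral_eq; first by apply: bsum_le h1 => n; rewrite e.
  by apply: eq_has_sum h2 => n; rewrite e.
have -> : 'i%C ^ (1 - 5) = 1 :> C.
  have -> : (1 - 5 : int) = - 4%:Z by [].
  rewrite -exprnN; have -> : ('i%C : C) ^+ 4 = 1; last by rewrite invr1.
  have -> : ('i%C : C) ^+ 4 = ('i%C ^+ 2) ^+ 2 by rewrite -exprM.
  by rewrite sqr_i sqrrN expr1n.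
have -> : (2 * 5 ^+ 2 : int) = 50%:Z by [].
rewrite -(exprnP q 50) mul1r.
have -> // : 5 * (6 * r + 2 - 5) - 3 * r ^+ 2 - 2 * r =
  5%:Z * (6%:Z * r - 3%:Z) - 3%:Z * (r * r) - 2%:Z * r by ring.
Qed.

(** The factors 1 - q^(50k) of J50, sorted by k modulo 3. *)
Lemma theta50_J150 (q : C) : q != 0 -> nm q < 1 ->
  theta (q ^+ 50) (q ^+ 150) * qp (q ^+ 150) (q ^+ 150) = qp (q ^+ 50) (q ^+ 50).
Proof.
move=> q0 q1; have q50 := nmX_lt1 q1 (m := 50) isT.
have := qpoch_dissect (q ^+ 50) q50 (m := 3) isT.
rewrite !big_ord_recl big_ord0 /= mulr1 expr0 mulr1 expr1 -!(exprM q) => ->.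
rewrite thetaE mulrA.
have -> : q ^+ 150 / q ^+ 50 = q ^+ 50 * q ^+ 50.
  by rewrite (exprD q 50 100) mulrAC mulfV ?expf_neq0 // mul1r (exprD q 50 50).
by rewrite -!(exprD q).
Qed.

Lemma qJE (m : nat) (q : C) : qp (q ^+ m) (q ^+ m) = qJ m (q : K).
Proof. by []. Qed.

Lemma qbracket1 (a p : C) : qbracket ([:: a] : seq K) (p : K) = theta a p.
Proof. by rewrite /qbracket big_seq1 thetaE. Qed.

Lemma qbracket2 (a b p : C) :
  qbracket ([:: a; b] : seq K) (p : K) = theta a p * theta b p.
Proof. by rewrite /qbracket big_cons big_seq1 !thetaE. Qed.

Lemma qbracket3 (a b c p : C) :
  qbracket ([:: a; b; c] : seq K) (p : K) = theta a p * (theta b p * theta c p).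
Proof. by rewrite /qbracket 2!big_cons big_seq1 !thetaE. Qed.

End Final.

Theorem theorem1p7 (R : realType) (tau : R[i]) (htau : 0 < complex.Im tau) :
  let q := nome tau in
  let zeta := zeta5 : R[i] in
  let J50 := qJ 50 q in
  let J150 := qJ 150 q in
  let br50 := fun s : seq R[i] => qbracket s (q ^+ 50) in
  let br150 := fun s : seq R[i] => qbracket s (q ^+ 150) in
  R0 zeta q =
    - 2 * Src 3 5 tau
    + (zeta + zeta ^+ 4) * (Src 0 5 tau - Src 1 5 tau)
    + (zeta ^+ 2 + zeta ^+ 3) * (Src 2 5 tau + Src 4 5 tau)
    + q ^+ 5 * J150 / br150 [:: q ^+ 15; q ^+ 50]
    - J50 * br50 [:: q ^+ 25] / br50 [:: q ^+ 10] ^+ 2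
    + q * J50 * br50 [:: q ^+ 15] / br50 [:: q ^+ 10] ^+ 2
    - q ^+ 2 * J50 * br50 [:: q ^+ 15] ^+ 2
        / br50 [:: q ^+ 10; q ^+ 10; q ^+ 25]
    - q ^+ 17 * J150 / br150 [:: q ^+ 50; q ^+ 75]
    + q ^+ 3 * J50 * br50 [:: q ^+ 5; q ^+ 25]
        / br50 [:: q ^+ 10; q ^+ 10; q ^+ 15]
    - q ^+ 4 * J50 * br50 [:: q ^+ 5] / br50 [:: q ^+ 10] ^+ 2
    + (zeta ^+ 2 + zeta ^+ 3) *
      (q ^+ 5 * J150 / br150 [:: q ^+ 15; q ^+ 50]
       - J50 * br50 [:: q ^+ 15] ^+ 2 / br50 [:: q ^+ 5; q ^+ 10; q ^+ 20]
       - q ^+ 6 * (J50 * br50 [:: q ^+ 5] / br50 [:: q ^+ 10; q ^+ 20])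
       - q ^+ 2 * (J50 * br50 [:: q ^+ 25] / br50 [:: q ^+ 10; q ^+ 20])
       + q ^+ 3 * (J50 * br50 [:: q ^+ 15] / br50 [:: q ^+ 10; q ^+ 20])
       + q ^+ 9 * (J50 * br50 [:: q ^+ 5] ^+ 2
                     / br50 [:: q ^+ 10; q ^+ 15; q ^+ 20])
       + q ^+ 14 * J150 / br150 [:: q ^+ 45; q ^+ 50]).
Proof.
have q1 : nm (nome tau) < 1.
  by rewrite nm_nome expR_lt1 oppr_lt0 !mulr_gt0 // pi_gt0.
have q0 : nome tau != 0 by rewrite -nm_gt0 nm_nome expR_gt0.
move=> q zeta J50 J150 br50 br150.
have -> : Src 0 5 tau = S5 q 0 := Src_S5 0 q0 q1.
have -> : Src 1 5 tau = S5 q 1 := Src_S5 1 q0 q1.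
have -> : Src 2 5 tau = S5 q 2%:Z := Src_S5 2%:Z q0 q1.
have -> : Src 3 5 tau = S5 q 3%:Z := Src_S5 3%:Z q0 q1.
have -> : Src 4 5 tau = S5 q 4%:Z := Src_S5 4%:Z q0 q1.
have := zeta5_sum R; have := zeta5X5 R; have := nm_zeta5 R; rewrite -/zeta.
move=> nz z5 zs; rewrite -/q in q0 q1; clearbody q zeta.
have b1 a : br50 [:: a] = theta a (q ^+ 50) by exact: qbracket1.
have b2 a b : br50 [:: a; b] = theta a (q ^+ 50) * theta b (q ^+ 50) by exact: qbracket2.
have b3 a b c : br50 [:: a; b; c] =
    theta a (q ^+ 50) * (theta b (q ^+ 50) * theta c (q ^+ 50)) by exact: qbracket3.
have c2 a b : br150 [:: a; b] = theta a (q ^+ 150) * theta b (q ^+ 150) by exact: qbracket2.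
have j0 : J50 != 0 := qpoch_pp_neq0 (nmX_lt1 q1 (m := 50) isT).
have tJ : theta (q ^+ 50) (q ^+ 150) * J150 = J50 := theta50_J150 q0 q1.
have h := main_identity q0 q1 z5 zs; rewrite !thE (qJE 50) (qJE 150) -/J50 -/J150 in h.
rewrite (R0_lerch nz q0 q1) h !b1 !b2 !b3 !c2.
clearbody J50 J150 br50 br150; clear h b1 b2 b3 c2.
change (5 * 1)%N with 5%N; change (5 * 2)%N with 10%N; change (5 * 3)%N with 15%N.
change (5 * 4)%N with 20%N; change (5 * 5)%N with 25%N.
move: tJ (theta (q ^+ 5) (q ^+ 50)) (theta (q ^+ 10) (q ^+ 50)) (theta (q ^+ 15) (q ^+ 50)).
move: (theta (q ^+ 20) (q ^+ 50)) (theta (q ^+ 25) (q ^+ 50)) (theta (q ^+ 50) (q ^+ 150)).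
move: (theta (q ^+ 15) (q ^+ 150)) (theta (q ^+ 45) (q ^+ 150)) (theta (q ^+ 75) (q ^+ 150)).
move: (S5 q 0) (S5 q 1) (S5 q 2%:Z) (S5 q 3%:Z) (S5 q 4%:Z) => s0 s1 s2 s3 s4.
move=> w15 w45 w75 t4 t5 w50 tJ t1 t2 t3.
have : J50 != 0 := j0.
rewrite -{1}tJ mulf_eq0 negb_or => /andP[w0 j150].
(* by [tJ] the factor [w50] in the brackets to the base q^150 is [J50 / J150] *)
have kr c w : c * J150 / (w * w50) = c * (J150 ^+ 2 / w / J50).
  rewrite -tJ !invfM; move: (w^-1) => u; field.
  by rewrite w0 j150.
have kl c w : c * J150 / (w50 * w) = c * (J150 ^+ 2 / w / J50).
  by rewrite (mulrC w50).
rewrite !kr kl; clear kr kl tJ j0.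
move: (J150 ^+ 2 / w15 / J50) (J150 ^+ 2 / w45 / J50) (J150 ^+ 2 / w75 / J50) => y15 y45 y75.
by rewrite !expr2 !mulrA.
Qed.
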